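(* Let $\Gamma$ be a strict Lie 2-group corresponding to a crossed module of Lie groups $(H_1,H_0,\Psi,\Phi)$, with associated strict Lie 2-algebra $(\mathfrak h_1\oplus\mathfrak h_0;\mathfrak l_1,\mathfrak l_2)$, and let $(A,B)$ be a $\Gamma$-connection on a manifold $M$. On the graded vector bundle with degree $-1$ part $M\times\mathfrak h_1$ and degree $0$ part $TM\oplus(M\times\mathfrak h_0)$ define, for $X,Y,Z\in\mathfrak X(M)$, $u,v,w\in\Gamma(M\times\mathfrak h_0)$, $m\in\Gamma(M\times\mathfrak h_1)$, $$l_1(m)=\mathfrak l_1(m),$$ $$l_2(X+u,Y+v)=[X,Y]+L_Xv+\mathfrak l_2(A(X),v)-L_Yu-\mathfrak l_2(A(Y),u)+\mathrm{fcurv}(A,B)(X,Y)+\mathfrak l_2(u,v),$$ $$l_2(X+u,m)=L_Xm+\mathfrak l_2(A(X),m)+\mathfrak l_2(u,m),$$ $$l_3(X+u,Y+v,Z+w)=-\mathrm{curv}(A,B)(X,Y,Z)+\mathfrak l_2(B(X,Y),w)+\mathfrak l_2(B(Y,Z),u)+\mathfrak l_2(B(Z,X),v).$$ Then $((M\times\mathfrak h_1)\oplus(TM\oplus(M\times\mathfrak h_0));\rho=\mathrm{pr}_{TM},l_1,l_2,l_3)$ is a transitive Lie 2-algebroid.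
   Context: A crossed module of Lie groups $(H_1,H_0,\Psi,\Phi)$: Lie groups $H_1,H_0$, a Lie group morphism $\Psi:H_1\to H_0$ and an action $\Phi$ of $H_0$ on $H_1$ by Lie group automorphisms with $\Psi(\Phi_g(h))=g\Psi(h)g^{-1}$ and $\Phi_{\Psi(h)}(h')=hh'h^{-1}$. Strict Lie 2-groups (internal categories in Lie groups) correspond one-to-one to crossed modules. Differentiating gives a crossed module of Lie algebras $(\mathfrak h_1,\mathfrak h_0,\psi,\phi)$: $\psi:\mathfrak h_1\to\mathfrak h_0$ a Lie algebra morphism, $\phi:\mathfrak h_0\to\mathrm{Der}(\mathfrak h_1)$ an action, $\psi(\phi_u(m))=[u,\psi(m)]$, $\phi_{\psi(m)}(p)=[m,p]$. The associated strict Lie 2-algebra $(\mathfrak h_1\oplus\mathfrak h_0;\mathfrak l_1,\mathfrak l_2)$ ($\mathfrak h_1$ in degree $-1$) has $\mathfrak l_1=\psi$, $\mathfrak l_2(u,v)=[u,v]_{\mathfrak h_0}$, $\mathfrak l_2(u,m)=-\mathfrak l_2(m,u)=\phi_u(m)$; extended $C^\infty(M)$-linearly to sections. A $\Gamma$-connection on $M$ is a pair $(A,B)$, $A\in\Omega^1(M,\mathfrak h_0)$, $B\in\Omega^2(M,\mathfrak h_1)$; $\mathrm{curv}(A,B)=dB+\mathfrak l_2(A,B)\in\Omega^3(M,\mathfrak h_1)$ and $\mathrm{fcurv}(A,B)=dA+\frac12\mathfrak l_2(A,A)-\mathfrak l_1(B)\in\Omega^2(M,\mathfrak h_0)$. Conventions: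 $\mathfrak l_2(A,A)(X,Y)=2\mathfrak l_2(A(X),A(Y))$, $\mathfrak l_2(A,B)(X,Y,Z)=\mathfrak l_2(A(X),B(Y,Z))+\mathfrak l_2(A(Y),B(Z,X))+\mathfrak l_2(A(Z),B(X,Y))$. $L_X$ is the derivative of vector-valued functions along $X$. Also $l_2(m,X+u)=-l_2(X+u,m)$. A Lie 2-algebra $(V_{-1}\oplus V_0;l_1,l_2,l_3)$: linear $l_1:V_{-1}\to V_0$; bilinear $l_2$, skew-symmetric on $V_0$ with values in $V_0$, $l_2(x,m)=-l_2(m,x)\in V_{-1}$, zero on $V_{-1}\times V_{-1}$; totally skew-symmetric $l_3:V_0^3\to V_{-1}$; such that for $w,x,y,z\in V_0$, $m,n\in V_{-1}$: $l_1l_2(x,m)=l_2(x,l_1m)$; $l_2(l_1m,n)=l_2(m,l_1n)$; $l_1l_3(x,y,z)=l_2(x,l_2(y,z))-l_2(l_2(x,y),z)-l_2(y,l_2(x,z))$; $l_3(x,y,l_1m)=l_2(x,l_2(y,m))-l_2(l_2(x,y),m)-l_2(y,l_2(x,m))$; $l_2(w,l_3(x,y,z))-l_2(x,l_3(w,y,z))+l_2(y,l_3(w,x,z))+l_2(l_3(w,x,y),z)-l_3(l_2(w,x),y,z)-l_3(x,l_2(w,y),z)-l_3(x,y,l_2(w,z))+l_3(w,l_2(x,y),z)+l_3(w,y,l_2(x,z))-l_3(w,x,l_2(y,z))=0$. A Lie 2-algebroid over $M$: graded vector bundle $A_{-1}\oplus A_0$, bundle map $\rho:A_0\to TM$, brackets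 making $(\Gamma(A_{-1})\oplus\Gamma(A_0);l_1,l_2,l_3)$ a Lie 2-algebra, with $l_1,l_3$ $C^\infty(M)$-linear and $l_2(X^0,fY)=fl_2(X^0,Y)+\rho(X^0)(f)Y$ for $X^0\in\Gamma(A_0)$ and $Y$ a section of $A_0$ or $A_{-1}$. It is transitive if $\rho$ is surjective. *)

(* Defs.v *)
From HB Require Import structures.
From mathcomp Require Import all_boot all_order all_algebra.
From mathcomp Require Import all_classical all_reals all_analysis.
Set Implicit Arguments.
Unset Strict Implicit.
Unset Printing Implicit Defensive.
Import Order.TTheory GRing.Theory Num.Theory.
Import numFieldNormedType.Exports.
Local Open Scope classical_set_scope.
Local Open Scope ring_scope.

Fixpoint Ck_on (R : realType) (V W : normedModType R) (k : nat) (U : set V)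
    (f : V -> W) : Prop :=
  if k is k'.+1 then
    (forall x, U x -> differentiable f x) /\
    (forall v : V, Ck_on k' U (fun x => 'D_v f x))
  else forall x, U x -> {for x, continuous f}.

(* Only used for U open and V finite-dimensional, where this is C^oo. *)
Definition smooth_on (R : realType) (V W : normedModType R) (U : set V)
  (f : V -> W) : Prop := forall k, Ck_on k U f.

(* A smooth manifold without boundary, given by a topological space with a
   smooth atlas; cinv i matters only on the image of the chart i.  The choice
   chart_at of one chart around each point is there to represent tangent
   vectors (see tvec); every atlas admits such a choice. *)
Record manifold (R : realType) := Manifold {
  mpoint :> topologicalType;
  mdim : nat;
  chart : Type;
  cdom : chart -> set mpoint;
  cmap : chart -> mpoint -> 'rV[R]_mdim;
  cinv : chart -> 'rV[R]_mdim -> mpoint;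
  chart_at : mpoint -> chart;
  cdom_chart_at : forall p, cdom (chart_at p) p;
  open_cdom : forall i, open (cdom i);
  open_cimage : forall i, open (cmap i @` cdom i);
  cmapK : forall i p, cdom i p -> cinv i (cmap i p) = p;
  continuous_cmap : forall i p, cdom i p -> {for p, continuous (cmap i)};
  continuous_cinv : forall i x,
    (cmap i @` cdom i) x -> {for x, continuous (cinv i)};
  smooth_transition : forall i j,
    smooth_on (cmap i @` (cdom i `&` cdom j)) (cmap j \o cinv i);
  hausdorff_manifold : hausdorff_space mpoint;
  second_countable_manifold : @second_countable mpoint
}.

(* Each tangent space T_pM is identified with R^dim M by means of the
   preferred chart chart_at p: v : tvec R M, seen in T_pM, is the tangent
   vector whose coordinates in chart_at p are v.  Since chart_at p varies
   arbitrarily with p, smoothness of a map M -> tvec R M must not be read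
   naively; it is defined through the bundle charts of tangent_bundle. *)
Notation tvec R M := 'rV[R]_(mdim M).

Definition at_chart (R : realType) (M : manifold R) (T : Type) (p : M)
  (f : M -> T) : 'rV[R]_(mdim M) -> T := f \o cinv (chart_at p).

Definition at_coord (R : realType) (M : manifold R) (p : M) :
  'rV[R]_(mdim M) := cmap (chart_at p) p.

(* Derivative of a vector-valued function at p along v in T_pM. *)
Definition dfun (R : realType) (M : manifold R) (W : normedModType R)
  (f : M -> W) (p : M) (v : tvec R M) : W := 'D_v (at_chart p f) (at_coord p).

Definition tmap (R : realType) (M N : manifold R) (f : M -> N) (p : M)
  (v : tvec R M) : tvec R N := dfun (cmap (chart_at (f p)) \o f) p v.

Definition smooth_fun_on (R : realType) (M : manifold R) (W : normedModType R)
    (D : set M) (f : M -> W) : Prop :=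
  forall i : chart M, smooth_on (cmap i @` (cdom i `&` D)) (f \o cinv i).

Definition smooth_fun (R : realType) (M : manifold R) (W : normedModType R)
  (f : M -> W) : Prop := smooth_fun_on setT f.

Definition smooth_map (R : realType) (M N : manifold R) (f : M -> N) : Prop :=
  continuous f /\
  forall (i : chart M) (j : chart N),
    smooth_on (cmap i @` (cdom i `&` f @^-1` cdom j)) (cmap j \o f \o cinv i).

(* Smoothness of f as a map on the product manifold M x N, whose atlas
   consists of the products of charts. *)
Definition smooth_map2 (R : realType) (M N P : manifold R) (f : M -> N -> P) :
    Prop :=
  continuous (fun z : M * N => f z.1 z.2) /\
  forall (i : chart M) (j : chart N) (k : chart P),
    smooth_on
      ((fun z : M * N => (cmap i z.1, cmap j z.2)) @`
        [set z | [/\ cdom i z.1, cdom j z.2 & cdom k (f z.1 z.2)]])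
      (fun x : 'rV[R]_(mdim M) * 'rV[R]_(mdim N) =>
         cmap k (f (cinv i x.1) (cinv j x.2))).

(* The data of a vector bundle: all fibres are carried by one R-vector space,
   which is no restriction since this says nothing about how the fibres fit
   together; that is encoded by the local trivializations
   tri i p : E_p -> R^rank (with inverse trinv i p), for p in tdom i. *)
Record vbundle (R : realType) (M : manifold R) := VBundle {
  fib : lmodType R;
  vrank : nat;
  tindex : Type;
  tdom : tindex -> set M;
  tri : tindex -> M -> fib -> 'rV[R]_vrank;
  trinv : tindex -> M -> 'rV[R]_vrank -> fib
}.

Record is_vbundle (R : realType) (M : manifold R) (E : vbundle M) : Prop := {
  tdom_open : forall i : tindex E, open (tdom i);
  tdom_cover : forall p : M, exists i : tindex E, tdom i p;
  tri_linear : forall (i : tindex E) p, tdom i p -> linear (tri i p);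
  triK : forall (i : tindex E) p, tdom i p -> cancel (tri i p) (trinv i p);
  trinvK : forall (i : tindex E) p, tdom i p -> cancel (trinv i p) (tri i p);
  tri_transition : forall (i j : tindex E) (e : 'rV[R]_(vrank E)),
    smooth_fun_on (tdom i `&` tdom j) (fun p => tri j p (trinv i p e))
}.

Definition smooth_section (R : realType) (M : manifold R) (E : vbundle M) :
    set (M -> fib E) :=
  [set s | forall i : tindex E, smooth_fun_on (tdom i) (fun p => tri i p (s p))].

Definition tcoord (R : realType) (M : manifold R) (i : chart M) (p : M)
  (v : tvec R M) : 'rV[R]_(mdim M) := dfun (cmap i) p v.

Definition tcoord_inv (R : realType) (M : manifold R) (i : chart M) (p : M)
    (w : 'rV[R]_(mdim M)) : tvec R M :=
  'D_w (cmap (chart_at p) \o cinv i) (cmap i p).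

Definition tangent_bundle (R : realType) (M : manifold R) : vbundle M :=
  @VBundle R M 'rV[R]_(mdim M) (mdim M) (chart M) (@cdom R M)
    (@tcoord R M) (@tcoord_inv R M).

Definition trivial_bundle (R : realType) (M : manifold R) (n : nat) :
    vbundle M :=
  @VBundle R M 'rV[R]_n n unit (fun=> setT) (fun _ _ v => v) (fun _ _ v => v).

Definition sum_bundle (R : realType) (M : manifold R) (E F : vbundle M) :
    vbundle M :=
  @VBundle R M (fib E * fib F)%type (vrank E + vrank F)
    (tindex E * tindex F)%type
    (fun i => tdom i.1 `&` tdom i.2)
    (fun i p v => row_mx (tri i.1 p v.1) (tri i.2 p v.2))
    (fun i p w => (trinv i.1 p (lsubmx w), trinv i.2 p (rsubmx w))).

Definition vfield (R : realType) (M : manifold R) : set (M -> tvec R M) :=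
  @smooth_section R M (tangent_bundle M).

Definition lie_deriv (R : realType) (M : manifold R) (W : normedModType R)
  (X : M -> tvec R M) (f : M -> W) : M -> W := fun p => dfun f p (X p).

Definition vf_coord (R : realType) (M : manifold R) (i : chart M)
    (X : M -> tvec R M) : 'rV[R]_(mdim M) -> 'rV[R]_(mdim M) :=
  fun x => tcoord i (cinv i x) (X (cinv i x)).

(* [X, Y]^k = X(Y^k) - Y(X^k) in the coordinates of the preferred chart. *)
Definition vf_bracket (R : realType) (M : manifold R) (X Y : M -> tvec R M) :
    M -> tvec R M :=
  fun p => 'D_(X p) (vf_coord (chart_at p) Y) (at_coord p)
         - 'D_(Y p) (vf_coord (chart_at p) X) (at_coord p).

Record is_form1 (R : realType) (M : manifold R) (W : normedModType R)
    (a : M -> tvec R M -> W) : Prop := {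
  form1_linear : forall p, linear (a p);
  form1_smooth : forall X, vfield X -> smooth_fun (fun p => a p (X p))
}.

Record is_form2 (R : realType) (M : manifold R) (W : normedModType R)
    (b : M -> tvec R M -> tvec R M -> W) : Prop := {
  form2_linearr : forall p v, linear (b p v);
  form2_linearl : forall p v, linear (fun u => b p u v);
  form2_alternating : forall p v, b p v v = 0;
  form2_smooth : forall X Y, vfield X -> vfield Y ->
    smooth_fun (fun p => b p (X p) (Y p))
}.

Definition ev1 (R : realType) (M : manifold R) (W : normedModType R)
  (a : M -> tvec R M -> W) (X : M -> tvec R M) : M -> W := fun p => a p (X p).

Definition ev2 (R : realType) (M : manifold R) (W : normedModType R)
  (b : M -> tvec R M -> tvec R M -> W) (X Y : M -> tvec R M) : M -> W :=
  fun p => b p (X p) (Y p).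

(* Exterior derivatives, evaluated on vector fields (without 1/k! factors). *)
Definition ext_d1 (R : realType) (M : manifold R) (W : normedModType R)
    (a : M -> tvec R M -> W) (X Y : M -> tvec R M) : M -> W := fun p =>
  lie_deriv X (ev1 a Y) p - lie_deriv Y (ev1 a X) p - ev1 a (vf_bracket X Y) p.

Definition ext_d2 (R : realType) (M : manifold R) (W : normedModType R)
    (b : M -> tvec R M -> tvec R M -> W) (X Y Z : M -> tvec R M) : M -> W := fun p =>
  lie_deriv X (ev2 b Y Z) p - lie_deriv Y (ev2 b X Z) p
  + lie_deriv Z (ev2 b X Y) p
  - ev2 b (vf_bracket X Y) Z p + ev2 b (vf_bracket X Z) Y p
  - ev2 b (vf_bracket Y Z) X p.

(* V1 is the part of degree -1 and V0 the part of degree 0; l2ij is the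
   component of l_2 on V_(-i) x V_(-j), the component on V1 x V1 being zero. *)
Record lie2_ops (V1 V0 : Type) := Lie2Ops {
  l1 : V1 -> V0;
  l200 : V0 -> V0 -> V0;
  l201 : V0 -> V1 -> V1;
  l210 : V1 -> V0 -> V1;
  l3 : V0 -> V0 -> V0 -> V1
}.

Definition linear_in (R : realType) (V W : lmodType R) (S : set V)
    (f : V -> W) : Prop :=
  forall (a : R) x y, S x -> S y -> f (a *: x + y) = a *: f x + f y.

(* The operations L restrict to the linear subspaces S1 of V1 and S0 of V0,
   and make S1 + S0 a Lie 2-algebra. *)
Record is_lie2_algebra (R : realType) (V1 V0 : lmodType R) (S1 : set V1)
    (S0 : set V0) (L : lie2_ops V1 V0) : Prop := {
  sub1_0 : S1 0;
  sub1_lin : forall (a : R) m n, S1 m -> S1 n -> S1 (a *: m + n);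
  sub0_0 : S0 0;
  sub0_lin : forall (a : R) x y, S0 x -> S0 y -> S0 (a *: x + y);
  l1_closed : forall m, S1 m -> S0 (l1 L m);
  l200_closed : forall x y, S0 x -> S0 y -> S0 (l200 L x y);
  l201_closed : forall x m, S0 x -> S1 m -> S1 (l201 L x m);
  l210_closed : forall m x, S1 m -> S0 x -> S1 (l210 L m x);
  l3_closed : forall x y z, S0 x -> S0 y -> S0 z -> S1 (l3 L x y z);
  l1_linear : linear_in S1 (l1 L);
  l200_linearr : forall x, S0 x -> linear_in S0 (l200 L x);
  l200_linearl : forall y, S0 y -> linear_in S0 (fun x => l200 L x y);
  l201_linearr : forall x, S0 x -> linear_in S1 (l201 L x);
  l201_linearl : forall m, S1 m -> linear_in S0 (fun x => l201 L x m);
  l3_linear1 : forall y z, S0 y -> S0 z -> linear_in S0 (fun x => l3 L x y z);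
  l3_linear2 : forall x z, S0 x -> S0 z -> linear_in S0 (fun y => l3 L x y z);
  l3_linear3 : forall x y, S0 x -> S0 y -> linear_in S0 (fun z => l3 L x y z);
  l200_skew : forall x y, S0 x -> S0 y -> l200 L x y = - l200 L y x;
  l201_skew : forall x m, S0 x -> S1 m -> l201 L x m = - l210 L m x;
  l3_skew12 : forall x y z, S0 x -> S0 y -> S0 z ->
    l3 L x y z = - l3 L y x z;
  l3_skew23 : forall x y z, S0 x -> S0 y -> S0 z ->
    l3 L x y z = - l3 L x z y;
  l1_l2 : forall x m, S0 x -> S1 m ->
    l1 L (l201 L x m) = l200 L x (l1 L m);
  l2_l1 : forall m n, S1 m -> S1 n ->
    l201 L (l1 L m) n = l210 L m (l1 L n);
  l1_l3 : forall x y z, S0 x -> S0 y -> S0 z ->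
    l1 L (l3 L x y z) =
    l200 L x (l200 L y z) - l200 L (l200 L x y) z - l200 L y (l200 L x z);
  l3_l1 : forall x y m, S0 x -> S0 y -> S1 m ->
    l3 L x y (l1 L m) =
    l201 L x (l201 L y m) - l201 L (l200 L x y) m - l201 L y (l201 L x m);
  l2_l3 : forall w x y z, S0 w -> S0 x -> S0 y -> S0 z ->
    l201 L w (l3 L x y z) - l201 L x (l3 L w y z) + l201 L y (l3 L w x z)
    + l210 L (l3 L w x y) z
    - l3 L (l200 L w x) y z - l3 L x (l200 L w y) z - l3 L x y (l200 L w z)
    + l3 L w (l200 L x y) z + l3 L w y (l200 L x z) - l3 L w x (l200 L y z)
    = 0
}.

Definition fscale (R : realType) (T : Type) (V : lmodType R) (f : T -> R)
  (s : T -> V) : T -> V := fun p => f p *: s p.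

Record is_bundle_map (R : realType) (M : manifold R) (E F : vbundle M)
    (h : M -> fib E -> fib F) : Prop := {
  bundle_map_linear : forall p, linear (h p);
  bundle_map_smooth : forall s,
    smooth_section s -> smooth_section (E := F) (fun p => h p (s p))
}.

(* The operations act on all set-theoretic sections M -> fib E; the axioms
   only concern the smooth ones. *)
Record is_lie2_algebroid (R : realType) (M : manifold R) (E1 E0 : vbundle M)
    (rho : M -> fib E0 -> fib (tangent_bundle M))
    (L : lie2_ops (M -> fib E1) (M -> fib E0)) : Prop := {
  algebroid_bundle1 : is_vbundle E1;
  algebroid_bundle0 : is_vbundle E0;
  algebroid_anchor : is_bundle_map rho;
  algebroid_lie2 :
    is_lie2_algebra (@smooth_section R M E1) (@smooth_section R M E0) L;
  algebroid_l1 : forall f m, smooth_fun f -> smooth_section m ->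
    l1 L (fscale f m) = fscale f (l1 L m);
  algebroid_l3_1 : forall f x y z, smooth_fun f ->
    smooth_section x -> smooth_section y -> smooth_section z ->
    l3 L (fscale f x) y z = fscale f (l3 L x y z);
  algebroid_l3_2 : forall f x y z, smooth_fun f ->
    smooth_section x -> smooth_section y -> smooth_section z ->
    l3 L x (fscale f y) z = fscale f (l3 L x y z);
  algebroid_l3_3 : forall f x y z, smooth_fun f ->
    smooth_section x -> smooth_section y -> smooth_section z ->
    l3 L x y (fscale f z) = fscale f (l3 L x y z);
  algebroid_leibniz0 : forall (f : M -> R) x y, smooth_fun f ->
    smooth_section x -> smooth_section y ->
    l200 L x (fscale f y) =
    fscale f (l200 L x y) + fscale (lie_deriv (fun p => rho p (x p)) f) y;
  algebroid_leibniz1 : forall (f : M -> R) x m, smooth_fun f ->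
    smooth_section x -> smooth_section m ->
    l201 L x (fscale f m) =
    fscale f (l201 L x m) + fscale (lie_deriv (fun p => rho p (x p)) f) m
}.

Definition is_transitive_lie2_algebroid (R : realType) (M : manifold R)
    (E1 E0 : vbundle M) (rho : M -> fib E0 -> fib (tangent_bundle M))
    (L : lie2_ops (M -> fib E1) (M -> fib E0)) : Prop :=
  is_lie2_algebroid rho L /\
  forall (p : M) (v : fib (tangent_bundle M)), exists a, rho p a = v.

Record lie_group (R : realType) := LieGroup {
  gman :> manifold R;
  gmul : gman -> gman -> gman;
  gone : gman;
  ginv : gman -> gman;
  gmulA : forall a b c, gmul a (gmul b c) = gmul (gmul a b) c;
  gmul1 : forall a, gmul gone a = a;
  gmulV : forall a, gmul (ginv a) a = gone;
  gmul_smooth : smooth_map2 gmul;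
  ginv_smooth : smooth_map ginv
}.

(* The Lie algebra is the tangent space at the identity, with the bracket
   given by left-invariant vector fields. *)
Notation lie_of R G := 'rV[R]_(mdim (gman G)).

Definition left_inv (R : realType) (G : lie_group R) (x : lie_of R G) :
  G -> tvec R G := fun g => tmap (gmul g) (gone G) x.

Definition lie_bracket (R : realType) (G : lie_group R) (x y : lie_of R G) :
  lie_of R G := vf_bracket (left_inv x) (left_inv y) (gone G).

Record crossed_module (R : realType) := CrossedModule {
  H1 : lie_group R;
  H0 : lie_group R;
  Psi : H1 -> H0;
  Phi : H0 -> H1 -> H1;
  Psi_smooth : smooth_map Psi;
  Psi_morph : forall h h', Psi (gmul h h') = gmul (Psi h) (Psi h');
  Phi_smooth : smooth_map2 Phi;
  Phi_morph : forall g h h', Phi g (gmul h h') = gmul (Phi g h) (Phi g h');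
  Phi_one : forall h, Phi (gone H0) h = h;
  Phi_mul : forall g g' h, Phi (gmul g g') h = Phi g (Phi g' h);
  Psi_Phi : forall g h, Psi (Phi g h) = gmul (gmul g (Psi h)) (ginv g);
  Phi_Psi : forall h h', Phi (Psi h) h' = gmul (gmul h h') (ginv h)
}.

Notation h1 R G := (lie_of R (H1 G)).
Notation h0 R G := (lie_of R (H0 G)).

Definition dPsi (R : realType) (G : crossed_module R) (m : h1 R G) : h0 R G :=
  tmap (@Psi R G) (gone (H1 G)) m.

(* phi_u(m) = d/dt (T_e Phi_(g_t))(m) at t = 0, for a curve g_t in H0 through
   the identity with velocity u; here T_e Phi_g : T_e H1 -> T_e H1. *)
Definition dPhi (R : realType) (G : crossed_module R) (u : h0 R G) (m : h1 R G) :
    h1 R G :=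
  dfun (fun g : H0 G => tmap (Phi g) (gone (H1 G)) m) (gone (H0 G)) u.

Definition strict_lie2 (R : realType) (G : crossed_module R) :
    lie2_ops (h1 R G) (h0 R G) :=
  Lie2Ops (@dPsi R G) (@lie_bracket R (H0 G)) (@dPhi R G)
    (fun m u => - dPhi u m) (fun _ _ _ => 0).

Section Connection.
Context (R : realType) (G : crossed_module R) (M : manifold R).
Variables (A : M -> tvec R M -> h0 R G) (B : M -> tvec R M -> tvec R M -> h1 R G).
Let L := strict_lie2 G.

Definition is_connection : Prop := is_form1 A /\ is_form2 B.

Definition curv (X Y Z : M -> tvec R M) : M -> h1 R G := fun p =>
  ext_d2 B X Y Z p
  + (l201 L (ev1 A X p) (ev2 B Y Z p) + l201 L (ev1 A Y p) (ev2 B Z X p)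
     + l201 L (ev1 A Z p) (ev2 B X Y p)).

Definition fcurv (X Y : M -> tvec R M) : M -> h0 R G := fun p =>
  ext_d1 A X Y p + 2%:R^-1 *: (2%:R *: l200 L (ev1 A X p) (ev1 A Y p))
  - l1 L (ev2 B X Y p).

Definition bundle1 : vbundle M := trivial_bundle M (mdim (H1 G)).
Definition bundle0 : vbundle M :=
  sum_bundle (tangent_bundle M) (trivial_bundle M (mdim (H0 G))).

Definition anchor (p : M) (a : fib bundle0) : fib (tangent_bundle M) := a.1.

Definition vpart (x : M -> fib bundle0) : M -> tvec R M := fun p => (x p).1.
Definition hpart (x : M -> fib bundle0) : M -> h0 R G := fun p => (x p).2.

Definition conn_l1 (m : M -> fib bundle1) : M -> fib bundle0 :=
  fun p => (0, l1 L (m p)).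

Definition conn_l200 (x y : M -> fib bundle0) : M -> fib bundle0 :=
  let X := vpart x in let u := hpart x in
  let Y := vpart y in let v := hpart y in
  fun p => (vf_bracket X Y p,
    lie_deriv X v p + l200 L (ev1 A X p) (v p)
    - lie_deriv Y u p - l200 L (ev1 A Y p) (u p)
    + fcurv X Y p + l200 L (u p) (v p)).

Definition conn_l201 (x : M -> fib bundle0) (m : M -> fib bundle1) :
    M -> fib bundle1 :=
  let X := vpart x in let u := hpart x in
  fun p => lie_deriv X (m : M -> h1 R G) p + l201 L (ev1 A X p) (m p)
           + l201 L (u p) (m p).

Definition conn_l210 (m : M -> fib bundle1) (x : M -> fib bundle0) :
  M -> fib bundle1 := fun p => - conn_l201 x m p.

Definition conn_l3 (x y z : M -> fib bundle0) : M -> fib bundle1 :=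
  let X := vpart x in let u := hpart x in
  let Y := vpart y in let v := hpart y in
  let Z := vpart z in let w := hpart z in
  fun p => - curv X Y Z p + l210 L (ev2 B X Y p) (w p)
           + l210 L (ev2 B Y Z p) (u p) + l210 L (ev2 B Z X p) (v p).

Definition conn_lie2 : lie2_ops (M -> fib bundle1) (M -> fib bundle0) :=
  Lie2Ops conn_l1 conn_l200 conn_l201 conn_l210 conn_l3.

End Connection.

(* Main.v *)
Require Import Defs.
From mathcomp Require Import all_boot all_order all_algebra.
From mathcomp Require Import all_classical all_reals all_analysis.
From mathcomp Require Import ring lra.
From HB Require Import structures.
Set Implicit Arguments.
Unset Strict Implicit.
Unset Printing Implicit Defensive.
Import Order.TTheory GRing.Theory Num.Theory.
Import numFieldNormedType.Exports.
Local Open Scope classical_set_scope.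
Local Open Scope ring_scope.
(* Otherwise a failed comparison of two derivatives unfolds them to limits of
   difference quotients. *)
#[local] Opaque derive.

(** Write a section X + u of TM + (M x h0) as the pair of X and
    [vert] (X + u) := u + A(X).  In these terms A disappears.
    The bracket of the theorem becomes
      X(vert y) - Y(vert x) + [vert x, vert y] - psi (B(X, Y))
    over [X, Y] ([vert_l200]): the bracket of the untwisted algebroid
    TM + (M x h0), corrected by - psi B.  The action on sections m of M x h1
    becomes nabla_x m = X(m) + phi_(vert x) m ([nablaE]), and l3 becomes
    minus the covariant exterior derivative of B ([conn_l3E], [covdB]).

    Each axiom is then a statement about such a twist.  The untwisted action
    is flat, so nabla has curvature phi_(psi B) ([nabla_curvature]), and this
    is l3 (x, y, l1 m) by the Peiffer identity phi_(psi m) n = - phi_(psi n) m.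
    The Jacobi identities of vector fields and of h0, together with the
    equivariance psi (phi_u m) = [u, psi m], leave in the Jacobiator exactly
    psi applied to l3 ([conn_l1_l3]).  The last identity ([conn_l2_l3]) says
    that the covariant derivative of the covariant derivative of B vanishes:
    the curvature terms phi_(psi B(w, x)) B(y, z) cancel in pairs, again by
    the Peiffer identity.

    From Lie theory this takes only three facts on the crossed module: phi is
    a representation of h0 ([dPhi_bracket]), psi is equivariant
    ([dPsi_dPhi]), and the Peiffer identity ([dPhi_dPsi_skew]).  The first
    holds because the left-invariant field of u differentiates the function
    g |-> T Phi_g (m) to g |-> T Phi_g (phi_u m), and because [u, v] is the
    value at the identity of a bracket of left-invariant fields.  The two
    others are derivatives at the identity of
      Psi (Phi_g (h)) g = g Psi (h)   and   Phi_(Psi h) (h') h = h h';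
    [dfun_adjoint] computes such derivatives without any use of the
    exponential map.

    From differential geometry it takes the calculus of vector fields on a
    manifold: [X, Y] acts on functions as a commutator, satisfies the Jacobi
    identity, and has in every chart the same coordinate expression.  All of
    it reduces, in coordinates, to the symmetry of second derivatives
    ([schwarz]), through the derivative of x |-> D_(Y x) F (x)
    ([derive_derive_vf]). *)

(** * Derivatives of linear, composite and bilinear maps *)

Section Differential.
Variable R : realType.
Implicit Types U V W : normedModType R.

(** Differentiability is a local property: the functions have the same
    first-order expansion at x. *)
Lemma near_eq_differentiable V W (f g : V -> W) (x : V) :
  (\forall y \near x, f y = g y) -> differentiable f x -> differentiable g x.
Proof.
move=> fg df.
have gE : g \o shift x = cst (g x) + 'd f x +o_ 0 id.
  rewrite -(nbhs_singleton fg).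
  apply/eqaddoP => e e0.
  have /eqaddoP/(_ e e0) := diff_locally df.
  have /= : \forall h \near (0 : V), f (h + x) = g (h + x).
    by move: fg; rewrite (near_shift 0) /=; apply: filterS => h /=; rewrite subr0.
  by apply: filterS2 => h E; rewrite !fctE /= E.
apply/diff_locallyP; have dg := diff_unique (diff_continuous df) gE.
by split; rewrite dg //; apply: diff_continuous.
Qed.

Lemma lin_differentiable V W (f : V -> W) (x : V) :
  linear f -> continuous f -> differentiable f x.
Proof.
move=> fl fc; pose fM := GRing.isLinear.Build _ _ _ _ _ fl.
pose fL : {linear _ -> _} := HB.pack f fM.
exact: (@linear_differentiable _ _ _ fL).
Qed.

Lemma derive_lin V W (f : V -> W) (x v : V) :
  linear f -> continuous f -> 'D_v f x = f v.
Proof.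
move=> fl fc; rewrite deriveE; last exact: lin_differentiable.
pose fM := GRing.isLinear.Build _ _ _ _ _ fl.
pose fL : {linear _ -> _} := HB.pack f fM.
by rewrite (@diff_lin _ _ _ fL).
Qed.

Lemma derive_comp U V W (f : U -> V) (g : V -> W) (x v : U) :
  differentiable f x -> differentiable g (f x) ->
  'D_v (g \o f) x = 'D_('D_v f x) g (f x).
Proof.
move=> df dg; rewrite !deriveE //; last exact: differentiable_comp.
by rewrite diff_comp.
Qed.

Lemma derive_linear V W (f : V -> W) (x : V) :
  differentiable f x -> linear (fun v => 'D_v f x).
Proof. by move=> df a u v; rewrite !deriveE// linearP. Qed.

Definition cont_bilinear U V W (b : U -> V -> W) :=
  [/\ forall u, linear (b u), forall v, linear (b^~ v) &
      continuous (fun p : U * V => b p.1 p.2)].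

Lemma cont_bilinear_diff (T U V W : normedModType R) (b : U -> V -> W)
    (f : T -> U) (g : T -> V) (x : T) :
  cont_bilinear b -> differentiable f x -> differentiable g x ->
  differentiable (fun y => b (f y) (g y)) x /\
  forall v, 'D_v (fun y => b (f y) (g y)) x = b ('D_v f x) (g x) + b (f x) ('D_v g x).
Proof.
move=> [b1 b2 bc] df dg.
have bb : bilinear_for (GRing.Scale.Law.clone _ _ *:%R _) (GRing.Scale.Law.clone _ _ *:%R _) b.
  by split => [u|u] a y z /=; [exact: b2|exact: b1].
pose bM := bilinear_isBilinear.Build _ _ _ _ _ _ _ bb.
pose bL : {bilinear _ -> _ -> _} := HB.pack b bM.
have dp : differentiable (fun y => (f y, g y)) x by exact: differentiable_pair.
have dB := @differentiable_bilin _ _ _ _ bL (f x, g x) bc.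
have dc := differentiable_comp dp dB.
split => [|v]; first exact: dc.
rewrite !deriveE //.
have -> : 'd (fun y => b (f y) (g y)) x v =
    'd (fun p : U * V => bL p.1 p.2) (f x, g x) ('d (fun y => (f y, g y)) x v).
  by have /(congr1 (@^~ v)) := diff_comp dp dB.
have /(congr1 (@^~ ('d (fun y => (f y, g y)) x v))) -> := @diff_bilin _ _ _ _ bL (f x, g x) bc.
have /(congr1 (@^~ v)) /= -> := diff_pair df dg.
by rewrite addrC.
Qed.

End Differential.

(** * Smooth maps on open sets *)

Section Smooth.
Variable R : realType.
Implicit Types T U V W : normedModType R.

Lemma open_near (S : topologicalType) (D : set S) (P : S -> Prop) (x : S) :
  open D -> D x -> (forall y, D y -> P y) -> \forall y \near x, P y.
Proof. by move=> oD Dx DP; apply: filterS (open_nbhs_nbhs (conj oD Dx)). Qed.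

(** A linear map on R^n is a finite sum of multiples of coordinates. *)
Lemma row_continuous n W (L : 'rV[R]_n -> W) : linear L -> continuous L.
Proof.
move=> Ll; pose LM := GRing.isLinear.Build _ _ _ _ _ Ll.
pose LL : {linear _ -> _} := HB.pack L LM.
have LE : L = (fun v => \sum_(i < n) v 0 i *: L (delta_mx 0 i)).
  apply/funext => v; rewrite {1}[v]row_sum_delta -[L]/(LL : _ -> _) linear_sum.
  by apply: eq_bigr => i _; rewrite linearZ.
rewrite LE; apply: continuous_big => [|i _ x]; first exact: add_continuous.
apply: (@continuous_comp _ _ _ (fun v : 'rV[R]_n => v 0 i) (fun a : R => a *: L (delta_mx 0 i))).
  exact: coord_continuous.
exact: scalel_continuous.
Qed.

Lemma row_cont_bilinear m n W (b : 'rV[R]_m -> 'rV[R]_n -> W) :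
  (forall u, linear (b u)) -> (forall v, linear (b^~ v)) -> cont_bilinear b.
Proof.
move=> b1 b2; split => //.
have bE : (fun p : 'rV[R]_m * 'rV[R]_n => b p.1 p.2) =
    (fun p => \sum_(i < m) p.1 0 i *: b (delta_mx 0 i) p.2).
  apply/funext => -[u v] /=.
  pose LM := GRing.isLinear.Build _ _ _ _ _ (b2 v).
  pose LL : {linear _ -> _} := HB.pack (b^~ v) LM.
  rewrite {1}[u]row_sum_delta -[LHS]/(LL _) linear_sum.
  by apply: eq_bigr => i _; rewrite linearZ.
rewrite bE; apply: continuous_big => [|i _ [u v]]; first exact: add_continuous.
apply: (@continuousZ _ _ _ (fun p : 'rV[R]_m * 'rV[R]_n => p.1 0 i)
  (fun p => b (delta_mx 0 i) p.2)).
  apply: (@continuous_comp _ _ _ fst (fun w : 'rV[R]_m => w 0 i)).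
    exact: cvg_fst.
  exact: coord_continuous.
apply: (@continuous_comp _ _ _ snd (b (delta_mx 0 i))).
  exact: cvg_snd.
exact: row_continuous.
Qed.

Lemma scale_cont_bilinear W : @cont_bilinear R R W W (fun a w => a *: w).
Proof.
split=> [a|w|].
- by move=> c u v; rewrite scalerDr !scalerA mulrC.
- by move=> c u v; rewrite scalerDl -scalerA.
- exact: scale_continuous.
Qed.

Lemma Ck_on_sub V W k (D D' : set V) (f : V -> W) :
  D' `<=` D -> Ck_on k D f -> Ck_on k D' f.
Proof.
move=> DD'; elim: k f => [|k IH] f /=; first by move=> H x /DD'/H.
by move=> [H1 H2]; split => [x /DD'/H1//|v]; apply: IH.
Qed.

Lemma Ck_onW V W k (D : set V) (f : V -> W) : Ck_on k.+1 D f -> Ck_on k D f.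
Proof.
elim: k f => [|k IH] f; first by move=> [H _] x /H/differentiable_continuous.
by move=> [H1 H2]; split => // v; apply: IH.
Qed.

Lemma eq_Ck_on V W k (D : set V) (f g : V -> W) : open D ->
  (forall x, D x -> f x = g x) -> Ck_on k D f -> Ck_on k D g.
Proof.
move=> oD; elim: k f g => [|k IH] f g fg /=.
  move=> H x Dx; have := H x Dx; rewrite /prop_for /continuous_at (fg _ Dx).
  apply: cvg_trans; apply: near_eq_cvg.
  exact: (open_near oD Dx).
move=> [H1 H2]; split=> [x Dx|v].
  exact: near_eq_differentiable (open_near oD Dx fg) (H1 _ Dx).
apply: IH (H2 v) => x Dx; apply: near_eq_derive.
exact: (open_near oD Dx).
Qed.

Lemma Ck_on_cst V W k (D : set V) (c : W) : Ck_on k D (fun=> c).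
Proof.
elim: k c => [|k IH] c; first by move=> x _; exact: cvg_cst.
split=> [x _|v]; first exact: differentiable_cst.
suff -> : (fun x => 'D_v (fun=> c) x) = (fun=> 0) by exact: IH.
by apply/funext => x; rewrite derive_cst.
Qed.

Lemma Ck_onD V W k (D : set V) (f g : V -> W) : open D ->
  Ck_on k D f -> Ck_on k D g -> Ck_on k D (fun x => f x + g x).
Proof.
move=> oD; elim: k f g => [|k IH] f g /=.
  by move=> H1 H2 x Dx; apply: cvgD; [exact: H1|exact: H2].
move=> [f1 f2] [g1 g2]; split=> [x Dx|v].
  by apply: differentiableD; [exact: f1|exact: g1].
apply: (eq_Ck_on oD _ (IH _ _ (f2 v) (g2 v))) => x Dx.
by rewrite deriveD//; apply: diff_derivable; [exact: f1|exact: g1].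
Qed.

Lemma Ck_on_lin V W W' k (D : set V) (f : V -> W) (L : W -> W') : open D ->
  linear L -> continuous L -> Ck_on k D f -> Ck_on k D (fun x => L (f x)).
Proof.
move=> oD Ll Lc; elim: k f => [|k IH] f /=.
  by move=> H1 x Dx; apply: continuous_comp; [exact: H1|exact: Lc].
move=> [f1 f2]; split=> [x Dx|v].
  by apply: differentiable_comp; [exact: f1|exact: lin_differentiable].
apply: (eq_Ck_on oD _ (IH _ (f2 v))) => x Dx.
have dL : differentiable L (f x) by exact: lin_differentiable.
by rewrite (derive_comp _ (f1 _ Dx) dL) [RHS]derive_lin.
Qed.

Lemma Ck_on_bilin T U V W k (D : set T) (b : U -> V -> W)
    (f : T -> U) (g : T -> V) : open D ->
  cont_bilinear b -> Ck_on k D f -> Ck_on k D g ->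
  Ck_on k D (fun x => b (f x) (g x)).
Proof.
move=> oD bb; elim: k f g => [|k IH] f g.
  move=> H1 H2 x Dx; have [_ _ bc] := bb.
  apply: (@continuous_comp _ _ _ (fun x => (f x, g x)) (fun p : U * V => b p.1 p.2)).
    by apply: cvg_pair; [exact: H1|exact: H2].
  exact: bc.
move=> fk gk; have [f1 f2] := fk; have [g1 g2] := gk; split=> [x Dx|v].
  by have [] := cont_bilinear_diff bb (f1 _ Dx) (g1 _ Dx).
apply: (eq_Ck_on oD _ (Ck_onD oD (IH _ _ (f2 v) (Ck_onW gk)) (IH _ _ (Ck_onW fk) (g2 v)))).
by move=> x Dx; have [_ ->] := cont_bilinear_diff bb (f1 _ Dx) (g1 _ Dx).
Qed.

Lemma Ck_on_sum V W k n (D : set V) (f : 'I_n -> V -> W) : open D ->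
  (forall i, Ck_on k D (f i)) -> Ck_on k D (fun x => \sum_i f i x).
Proof.
move=> oD H; elim: n f H => [|n IH] f H.
  by apply: (eq_Ck_on oD _ (@Ck_on_cst V W k D 0)) => x _; rewrite big_ord0.
apply: (eq_Ck_on oD _ (Ck_onD oD (H ord0) (IH (fun i => f (lift ord0 i)) _))) => [x _|i //].
by rewrite big_ord_recl.
Qed.

Lemma derive_row_sum n W (g : 'rV[R]_n -> W) x v : differentiable g x ->
  'D_v g x = \sum_i v 0 i *: 'D_(delta_mx 0 i) g x.
Proof.
move=> dg; rewrite deriveE // {1}[v]row_sum_delta linear_sum.
by apply: eq_bigr => i _; rewrite linearZ /= deriveE.
Qed.

(** By induction on k: D_v (g o f) is the sum over the basis of the coordinates
    of D_v f times (D_(e_i) g) o f, so it only involves compositions with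
    derivatives of g and scalar multiplications. *)
Lemma Ck_on_comp V n W k (D : set V) (D' : set 'rV[R]_n)
    (f : V -> 'rV[R]_n) (g : 'rV[R]_n -> W) : open D ->
  (forall x, D x -> D' (f x)) -> Ck_on k D f -> Ck_on k D' g ->
  Ck_on k D (g \o f).
Proof.
move=> oD fD; elim: k g => [|k IH] g.
  by move=> H1 H2 x Dx; apply: continuous_comp; [exact: H1|exact/H2/fD].
move=> fk [g1 g2]; have [f1 f2] := fk; split=> [x Dx|v].
  by apply: differentiable_comp; [exact: f1|exact/g1/fD].
have Dk i : Ck_on k D (fun x => ('D_v f x) 0 i *: ('D_(delta_mx 0 i) g \o f) x).
  apply: (@Ck_on_bilin _ R W W _ _ (fun a w => a *: w)) => //.
  - exact: scale_cont_bilinear.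
  - apply: (@Ck_on_lin _ _ _ _ _ _ (fun w : 'rV[R]_n => w 0 i : R^o) oD) => //.
    + by move=> c u w; rewrite !mxE.
    + exact: coord_continuous.
    + exact: f2.
  - exact: (IH _ (Ck_onW fk) (g2 _)).
apply: (eq_Ck_on oD _ (Ck_on_sum oD Dk)) => x Dx.
have dg := g1 _ (fD _ Dx).
by rewrite (derive_comp _ (f1 _ Dx) dg) [RHS]derive_row_sum.
Qed.

(** When D_v f does not depend on the point, D_v (g o f) = (D_(l v) g) o f:
    no basis is needed, so g may be defined on any normed module, such as a
    product. *)
Lemma Ck_on_comp_affine U V W k (D : set U) (D' : set V)
    (f : U -> V) (l : U -> V) (g : V -> W) : open D ->
  (forall x, differentiable f x) -> (forall x v, 'D_v f x = l v) ->
  (forall x, D x -> D' (f x)) -> Ck_on k D' g -> Ck_on k D (g \o f).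
Proof.
move=> oD df fl fD; elim: k g => [|k IH] g.
  move=> H2 x Dx; apply: continuous_comp; first exact: differentiable_continuous.
  exact/H2/fD.
move=> [g1 g2]; split=> [x Dx|v].
  by apply: differentiable_comp => //; exact/g1/fD.
apply: (eq_Ck_on oD _ (IH _ (g2 (l v)))) => x Dx.
by rewrite (derive_comp _ (df x) (g1 _ (fD _ Dx))) fl.
Qed.

Lemma smooth_on_differentiable V W (D : set V) (f : V -> W) x :
  smooth_on D f -> D x -> differentiable f x.
Proof. by move=> /(_ 1%N)[+ _] Dx; exact. Qed.

Lemma smooth_on_derive V W (D : set V) (f : V -> W) v :
  smooth_on D f -> smooth_on D ('D_v f).
Proof. by move=> fs k; have [_] := fs k.+1; exact. Qed.

Lemma smooth_on_sub V W (D D' : set V) (f : V -> W) :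
  D' `<=` D -> smooth_on D f -> smooth_on D' f.
Proof. by move=> DD' fs k; exact: Ck_on_sub (fs k). Qed.

Lemma eq_smooth_on V W (D : set V) (f g : V -> W) : open D ->
  (forall x, D x -> f x = g x) -> smooth_on D f -> smooth_on D g.
Proof. by move=> oD fg fs k; exact: eq_Ck_on (fs k). Qed.

Lemma smooth_on_cst V W (D : set V) (c : W) : smooth_on D (fun=> c).
Proof. by move=> k; exact: Ck_on_cst. Qed.

Lemma smooth_onD V W (D : set V) (f g : V -> W) : open D ->
  smooth_on D f -> smooth_on D g -> smooth_on D (fun x => f x + g x).
Proof. by move=> oD fs gs k; exact: Ck_onD. Qed.

Lemma smooth_on_lin V W W' (D : set V) (f : V -> W) (L : W -> W') : open D ->
  linear L -> continuous L -> smooth_on D f -> smooth_on D (fun x => L (f x)).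
Proof. by move=> oD Ll Lc fs k; exact: Ck_on_lin. Qed.

Lemma smooth_on_bilin T U V W (D : set T) (b : U -> V -> W)
    (f : T -> U) (g : T -> V) : open D ->
  cont_bilinear b -> smooth_on D f -> smooth_on D g ->
  smooth_on D (fun x => b (f x) (g x)).
Proof. by move=> oD bb fs gs k; exact: Ck_on_bilin. Qed.

Lemma smooth_on_comp V n W (D : set V) (D' : set 'rV[R]_n)
    (f : V -> 'rV[R]_n) (g : 'rV[R]_n -> W) : open D ->
  (forall x, D x -> D' (f x)) -> smooth_on D f -> smooth_on D' g ->
  smooth_on D (g \o f).
Proof. by move=> oD fD fs gs k; exact: Ck_on_comp (fs k) (gs k). Qed.

Lemma smooth_on_comp_affine U V W (D : set U) (D' : set V)
    (f : U -> V) (l : U -> V) (g : V -> W) : open D ->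
  (forall x, differentiable f x) -> (forall x v, 'D_v f x = l v) ->
  (forall x, D x -> D' (f x)) -> smooth_on D' g -> smooth_on D (g \o f).
Proof. by move=> oD df fl fD gs k; exact: Ck_on_comp_affine (gs k). Qed.

(** The direction may vary smoothly with the point, because D_v g is a
    combination of the D_(e_i) g with the coordinates of v as coefficients. *)
Lemma smooth_on_derive_along V n W (D : set V) (D' : set 'rV[R]_n)
    (f X : V -> 'rV[R]_n) (g : 'rV[R]_n -> W) : open D ->
  (forall x, D x -> D' (f x)) -> smooth_on D f -> smooth_on D X ->
  smooth_on D' g -> smooth_on D (fun x => 'D_(X x) g (f x)).
Proof.
move=> oD fD fs Xs gs k.
have Dk i : Ck_on k D (fun x => (X x) 0 i *: ('D_(delta_mx 0 i) g \o f) x).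
  apply: (@Ck_on_bilin _ R W W _ _ (fun a w => a *: w)) => //.
  - exact: scale_cont_bilinear.
  - apply: (@Ck_on_lin _ _ _ _ _ _ (fun w : 'rV[R]_n => w 0 i : R^o) oD) => //.
    + by move=> c u w; rewrite !mxE.
    + exact: coord_continuous.
  - by apply: (smooth_on_comp oD fD fs); exact: smooth_on_derive.
apply: (eq_Ck_on oD _ (Ck_on_sum oD Dk)) => x Dx /=.
by rewrite [RHS]derive_row_sum//; apply: smooth_on_differentiable gs (fD _ Dx).
Qed.

End Smooth.

(** * Symmetry of second derivatives *)

Section Schwarz.
Variable R : realType.
Implicit Types U V W : normedModType R.

Lemma eq_derive_on V W (D : set V) (f g : V -> W) (x v : V) : open D -> D x ->
  (forall y, D y -> f y = g y) -> 'D_v f x = 'D_v g x.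
Proof.
by move=> oD Dx fg; apply: near_eq_derive; exact: open_near oD Dx fg.
Qed.

Lemma line_differentiable V (c v : V) t :
  differentiable (fun t : R => c + t *: v) t /\
  forall s, 'D_s (fun t : R => c + t *: v) t = s *: v.
Proof.
have sl : linear (fun t : R => t *: v) by move=> a y z; rewrite scalerDl scalerA.
have sc : continuous (fun t : R => t *: v) by exact: scalel_continuous.
have ds := lin_differentiable t sl sc.
split=> [|s]; first by apply: differentiableD.
rewrite deriveD; [|exact: derivable_cst|exact: diff_derivable].
by rewrite derive_cst add0r derive_lin.
Qed.

Lemma is_derive_line V (f : V -> R) (c v : V) (t : R) :
  differentiable f (c + t *: v) ->
  is_derive t 1 (fun t => f (c + t *: v)) ('D_v f (c + t *: v)).
Proof.
move=> df; have [dl Dl] := line_differentiable c v t.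
have dc := @differentiable_comp _ _ _ _ _ f _ dl df.
apply: DeriveDef; first exact: diff_derivable dc.
by have := derive_comp (1 : R) dl df; rewrite Dl scale1r.
Qed.

Lemma mean_value_on (f df : R -> R) (s : R) : 0 < s ->
  (forall t, 0 <= t <= s -> is_derive t 1 f (df t)) ->
  exists2 a, 0 <= a <= s & f s - f 0 = s * df a.
Proof.
move=> s0 fd.
have [a as_ ea] : exists2 a, a \in `]0, s[%R & f s - f 0 = df a * (s - 0).
  apply: MVT => // [t|].
    by rewrite in_itv /= => /andP[t0 ts]; apply: fd; rewrite !ltW.
  apply: derivable_within_continuous => t; rewrite in_itv /= => ts.
  by have [] := fd _ ts.
move: as_; rewrite in_itv /= => /andP[a0 as_].
by exists a; [rewrite !ltW|rewrite ea subr0 mulrC].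
Qed.

(** The mean value theorem along v, applied to the difference of f on two
    parallel segments, then along u. *)
Lemma second_difference_mean V (D : set V) (f : V -> R) (x u v : V) (s : R) :
  0 < s -> (forall a b, 0 <= a <= s -> 0 <= b <= s -> D (x + a *: u + b *: v)) ->
  Ck_on 2 D f ->
  exists a b, [/\ 0 <= a <= s, 0 <= b <= s &
    f (x + s *: u + s *: v) - f (x + s *: u) - f (x + s *: v) + f x =
    s ^+ 2 * 'D_u ('D_v f) (x + a *: u + b *: v)].
Proof.
move=> s0 inD [f1 /(_ v)[f2 _]].
have ss : 0 <= s <= s by rewrite (ltW s0) lexx.
have s00 : (0 : R) <= 0 <= s by rewrite lexx (ltW s0).
have zu (w : V) (t : R) : x + t *: w = x + 0 *: u + t *: w by rewrite scale0r addr0.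
pose ph t := f (x + s *: u + t *: v) - f (x + t *: v).
pose dph t := 'D_v f (x + s *: u + t *: v) - 'D_v f (x + t *: v).
have phd t : 0 <= t <= s -> is_derive t 1 ph (dph t).
  move=> ts; apply: is_deriveB; apply: is_derive_line; apply: f1; first exact: inD.
  by rewrite zu; exact: inD.
have [b bs' eb] := mean_value_on s0 phd.
pose ps r := 'D_v f (x + b *: v + r *: u).
pose dps t := 'D_u ('D_v f) (x + b *: v + t *: u).
have psd t : 0 <= t <= s -> is_derive t 1 ps (dps t).
  by move=> ts; apply: is_derive_line; apply: f2; rewrite addrAC; exact: inD.
have [a as_ ea] := mean_value_on s0 psd.
exists a, b; split; [exact: as_|exact: bs'|].
have key (p q k l : R) : p - q - k + l = p - k - (q - l) by ring.
have -> : f (x + s *: u + s *: v) - f (x + s *: u) - f (x + s *: v) + f x = ph s - ph 0.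
  by rewrite /ph !scale0r !addr0; exact: key.
have edph : dph b = ps s - ps 0 by rewrite /dph /ps scale0r addr0 addrAC.
by rewrite eb edph ea [x + a *: u + _]addrAC /dps expr2 mulrA.
Qed.

(** The second difference of f over a small parallelogram is symmetric in u
    and v, and by [second_difference_mean] it is close to either iterated
    derivative. *)
Lemma schwarz_real V (D : set V) (f : V -> R) (x u v : V) : open D -> D x ->
  Ck_on 2 D f -> 'D_u ('D_v f) x = 'D_v ('D_u f) x.
Proof.
move=> oD Dx f2.
have c1 : {for x, continuous ('D_u ('D_v f))} := (f2.2 v).2 u x Dx.
have c2 : {for x, continuous ('D_v ('D_u f))} := (f2.2 u).2 v x Dx.
apply/eqP; rewrite -subr_eq0 -normr_le0; apply/ler_addgt0Pl => e e0; rewrite addr0.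
have e20 : 0 < e / 2 by rewrite divr_gt0.
have nD := open_nbhs_nbhs (conj oD Dx).
have n1 : \forall t \near x, `|'D_u ('D_v f) x - 'D_u ('D_v f) t| <= e / 2.
  by move/cvgrPdist_le: c1; apply.
have n2 : \forall t \near x, `|'D_v ('D_u f) x - 'D_v ('D_u f) t| <= e / 2.
  by move/cvgrPdist_le: c2; apply.
have [r /= r0 rP] := (nbhs_ballP _ _).1 (filterI nD (filterI n1 n2)).
have k0 : 0 < `|u| + `|v| + 1 by rewrite ltr_wpDl // addr_ge0.
(* the + 1 keeps the denominator positive when u = v = 0 *)
pose s := r / (`|u| + `|v| + 1) / 2.
have s0 : 0 < s by rewrite !divr_gt0.
have near_x (a b : R) (w z : V) : `|w| + `|z| = `|u| + `|v| -> 0 <= a <= s -> 0 <= b <= s ->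
    ball x r (x + a *: w + b *: z).
  move=> wz /andP[a0 as_] /andP[b0 bs]; rewrite -ball_normE /ball_ /=.
  rewrite -addrA opprD addrA subrr sub0r normrN.
  apply: le_lt_trans (ler_normD _ _) _; rewrite !normrZ !ger0_norm //.
  have h1 : a * `|w| + b * `|z| <= s * (`|u| + `|v|).
    by rewrite -wz mulrDr lerD // ler_wpM2r.
  apply: le_lt_trans h1 _.
  have : s * (`|u| + `|v|) < s * 2 * (`|u| + `|v| + 1).
    have : 0 <= s * (`|u| + `|v|) by rewrite mulr_ge0 ?addr_ge0 // ltW.
    by lra.
  by rewrite /s mulfVK // mulfVK // gt_eqF.
have [a1 [b1 [a1s b1s e1]]] := @second_difference_mean _ D f x u v s s0
   (fun a b ha hb => (rP _ (near_x a b u v erefl ha hb)).1) f2.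
have [a2 [b2 [a2s b2s e2]]] := @second_difference_mean _ D f x v u s s0
   (fun a b ha hb => (rP _ (near_x a b v u (addrC _ _) ha hb)).1) f2.
have [_ [r1 _]] := rP _ (near_x _ _ u v erefl a1s b1s).
have [_ [_ r2]] := rP _ (near_x _ _ v u (addrC _ _) a2s b2s).
have E : 'D_u ('D_v f) (x + a1 *: u + b1 *: v) = 'D_v ('D_u f) (x + a2 *: v + b2 *: u).
  have key (F k l m p q : R) : F - k - l + m = s ^+ 2 * p -> F - l - k + m = s ^+ 2 * q -> p = q.
    move=> ep eq; have sn : s ^+ 2 != 0 by rewrite expf_neq0 // gt_eqF.
    by apply: (mulfI sn); rewrite -ep -eq; ring.
  by move: e2; rewrite [x + s *: v + _]addrAC; exact: key e1.
have gen (p q k : R) : p - k = (p - q) - (k - q) by ring.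
have -> : 'D_u ('D_v f) x - 'D_v ('D_u f) x =
   ('D_u ('D_v f) x - 'D_u ('D_v f) (x + a1 *: u + b1 *: v))
   - ('D_v ('D_u f) x - 'D_v ('D_u f) (x + a2 *: v + b2 *: u)) by rewrite E; exact: gen.
apply: le_trans (ler_normB _ _) _.
by rewrite (splitr e); exact: lerD r1 r2.
Qed.

Lemma derive_coord V n (f : V -> 'rV[R]_n) (x v : V) i : differentiable f x ->
  'D_v (fun y => f y 0 i) x = ('D_v f x) 0 i.
Proof.
move=> df.
have cl : linear (fun w : 'rV[R]_n => w 0 i : R^o) by move=> c a b; rewrite !mxE.
have cc : continuous (fun w : 'rV[R]_n => w 0 i : R^o) by exact: coord_continuous.
have dc : differentiable (fun w : 'rV[R]_n => w 0 i : R^o) (f x) by exact: lin_differentiable.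
by have := derive_comp v df dc; rewrite [RHS]derive_lin.
Qed.

Lemma schwarz V n (D : set V) (f : V -> 'rV[R]_n) (x u v : V) : open D -> D x ->
  smooth_on D f -> 'D_u ('D_v f) x = 'D_v ('D_u f) x.
Proof.
move=> oD Dx fs; apply/rowP => i.
have dd y w : D y -> 'D_w (fun y => f y 0 i) y = ('D_w f y) 0 i.
  by move=> Dy; rewrite derive_coord//; exact: smooth_on_differentiable Dy.
have d2 w z : 'D_w ('D_z (fun y => f y 0 i)) x = ('D_w ('D_z f) x) 0 i.
  rewrite -derive_coord; last exact: smooth_on_differentiable (smooth_on_derive _ fs) Dx.
  by apply: (eq_derive_on _ oD Dx) => y Dy; exact: dd.
apply: etrans (esym (d2 u v)) _; apply: etrans _ (d2 v u).
apply: (schwarz_real _ _ oD Dx).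
apply: (@Ck_on_lin _ _ _ _ _ _ _ (fun w : 'rV[R]_n => w 0 i : R^o) oD) => //.
  by move=> c a b; rewrite !mxE.
exact: coord_continuous.
Qed.

(** Product rule for F along a direction given by coordinates: D_(Y y) F is
    the sum of the Y_i times D_(e_i) F.  The vectors e_i may span a proper
    subspace of V, as for partial derivatives in one of two variables. *)
Lemma derive_derive_along V n W (D : set V) (F : V -> W) (Y : V -> 'rV[R]_n)
    (e : 'I_n -> V) (x u : V) : open D -> D x -> smooth_on D F -> differentiable Y x ->
  'D_u (fun y => 'D_(\sum_i Y y 0 i *: e i) F y) x =
  'D_u ('D_(\sum_i Y x 0 i *: e i) F) x + 'D_(\sum_i ('D_u Y x) 0 i *: e i) F x.
Proof.
move=> oD Dx Fs dY.
have Fd y : D y -> differentiable F y by move=> Dy; exact: smooth_on_differentiable Dy.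
have DE y (w : 'rV[R]_n) : D y -> 'D_(\sum_i w 0 i *: e i) F y = \sum_i w 0 i *: 'D_(e i) F y.
  move=> Dy; rewrite deriveE ?linear_sum //; last exact: Fd.
  by apply: eq_bigr => i _; rewrite linearZ /= deriveE //; exact: Fd.
have -> : 'D_u (fun y => 'D_(\sum_i Y y 0 i *: e i) F y) x =
    'D_u (fun y => \sum_i Y y 0 i *: 'D_(e i) F y) x.
  by apply: (eq_derive_on _ oD Dx) => y Dy; exact: DE.
have -> : 'D_u ('D_(\sum_i Y x 0 i *: e i) F) x = 'D_u (fun y => \sum_i Y x 0 i *: 'D_(e i) F y) x.
  by apply: (eq_derive_on _ oD Dx) => y Dy; exact: DE.
have dF i : differentiable ('D_(e i) F) x.
  exact: smooth_on_differentiable (smooth_on_derive _ Fs) Dx.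
have dYi i : differentiable (fun y => Y y 0 i : R^o) x.
  have dc : differentiable (fun w : 'rV[R]_n => w 0 i : R) (Y x) by exact: differentiable_coord.
  exact: differentiable_comp dY dc.
have sb := @scale_cont_bilinear R W.
have P i := cont_bilinear_diff sb (dYi i) (dF i).
have Q i := cont_bilinear_diff sb (differentiable_cst (Y x 0 i : R^o) x) (dF i).
have sumD (h : 'I_n -> V -> W) : (forall i, differentiable (h i) x) ->
    'D_u (fun y => \sum_i h i y) x = \sum_i 'D_u (h i) x.
  move=> dh; rewrite -derive_sum; last by move=> i; exact: diff_derivable.
  by congr ('D_u _ x); apply/funext => y; rewrite fct_sumE.
rewrite sumD; last by move=> i; exact: (P i).1.
rewrite sumD; last by move=> i; exact: (Q i).1.
rewrite DE // -big_split /=; apply: eq_bigr => i _.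
by rewrite (P i).2 (Q i).2 derive_cst scale0r add0r addrC derive_coord.
Qed.

Lemma derive_derive_vf n W (D : set 'rV[R]_n) (F : 'rV[R]_n -> W) (Y : 'rV[R]_n -> 'rV[R]_n)
    (x u : 'rV[R]_n) : open D -> D x -> smooth_on D F -> differentiable Y x ->
  'D_u (fun y => 'D_(Y y) F y) x = 'D_u ('D_(Y x) F) x + 'D_('D_u Y x) F x.
Proof.
move=> oD Dx Fs dY.
have := @derive_derive_along _ _ _ D F Y (fun i => delta_mx 0 i) x u oD Dx Fs dY.
rewrite -!row_sum_delta => <-; congr ('D_u _ x); apply/funext => y.
by rewrite -row_sum_delta.
Qed.

End Schwarz.

(** * Vector fields on open sets of R^n *)

Section LocalFields.
Variable R : realType.

Lemma derive_dirB (V W : normedModType R) (F : V -> W) x u v : differentiable F x ->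
  'D_(u - v) F x = 'D_u F x - 'D_v F x.
Proof. by move=> dF; rewrite (deriveE _ dF) linearB -!deriveE. Qed.

Lemma derive_linear_comb (V W : normedModType R) (F G : V -> W) (a : R) x v :
  differentiable F x -> differentiable G x ->
  'D_v (fun y => a *: F y + G y) x = a *: 'D_v F x + 'D_v G x.
Proof.
move=> dF dG.
have [dA DA] := cont_bilinear_diff (@scale_cont_bilinear R W) (differentiable_cst a x) dF.
have /= E := DA v; rewrite deriveD; [|exact: diff_derivable|exact: diff_derivable].
by rewrite E derive_cst scale0r add0r.
Qed.

Definition along n (W : normedModType R) (X : 'rV[R]_n -> 'rV[R]_n) (F : 'rV[R]_n -> W) :
  'rV[R]_n -> W := fun x => 'D_(X x) F x.

Definition local_bracket n (X Y : 'rV[R]_n -> 'rV[R]_n) : 'rV[R]_n -> 'rV[R]_n :=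
  fun x => along X Y x - along Y X x.

Lemma along_smooth n (W : normedModType R) (D : set 'rV[R]_n) X (F : 'rV[R]_n -> W) : open D ->
  smooth_on D X -> smooth_on D F -> smooth_on D (along X F).
Proof.
move=> oD Xs Fs; apply: (@smooth_on_derive_along _ _ _ _ D D id X F) => //.
move=> k; apply: (eq_Ck_on oD (f := fun x => id x)) => //.
elim: k => [|k IH]; first by move=> x _; exact: cvg_id.
split=> [x _|v]; first exact: (lin_differentiable _ (fun a b c => erefl)) (fun _ => cvg_id).
apply: (eq_Ck_on oD _ (@Ck_on_cst _ _ _ k D v)) => x _.
by rewrite derive_id.
Qed.

Lemma smooth_onB (V W : normedModType R) (D : set V) (f g : V -> W) : open D ->
  smooth_on D f -> smooth_on D g -> smooth_on D (fun x => f x - g x).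
Proof.
move=> oD fs gs; apply: smooth_onD => //.
apply: (@smooth_on_lin _ _ _ _ D g (fun w => - w)) => //.
  by move=> a u v; rewrite opprD scalerN.
by move=> x; exact: opp_continuous.
Qed.

Lemma local_bracket_smooth n (D : set 'rV[R]_n) X Y : open D ->
  smooth_on D X -> smooth_on D Y -> smooth_on D (local_bracket X Y).
Proof. by move=> oD Xs Ys; apply: smooth_onB => //; exact: along_smooth. Qed.

Lemma related_along m n (W : normedModType R) (D : set 'rV[R]_m) (D' : set 'rV[R]_n)
    T X X' (F : 'rV[R]_n -> W) x :
  open D -> D x -> (forall y, D y -> D' (T y)) -> smooth_on D T -> smooth_on D' F ->
  X' (T x) = 'D_(X x) T x ->
  along X' F (T x) = 'D_(X x) (F \o T) x.
Proof.
move=> oD Dx TD Ts Fs XT.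
rewrite derive_comp; last 2 first.
- exact: smooth_on_differentiable Ts Dx.
- exact: smooth_on_differentiable Fs (TD _ Dx).
by rewrite /along XT.
Qed.

(** If T maps X to X' and Y to Y', both sides of
    X'(Y') o T = X(Y' o T) = X(D_Y T) are equal to the second derivative of T
    along X and Y plus D_(X(Y)) T; the second derivatives cancel in the
    commutator.  This gives both the independence of the bracket from the
    chart and the invariance of brackets of left-invariant fields. *)
Lemma bracket_related m n (D : set 'rV[R]_m) (D' : set 'rV[R]_n) T X Y X' Y' x :
  open D -> open D' -> D x -> (forall y, D y -> D' (T y)) -> smooth_on D T ->
  smooth_on D X -> smooth_on D Y -> smooth_on D' X' -> smooth_on D' Y' ->
  (forall y, D y -> X' (T y) = 'D_(X y) T y) ->
  (forall y, D y -> Y' (T y) = 'D_(Y y) T y) ->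
  local_bracket X' Y' (T x) = 'D_(local_bracket X Y x) T x.
Proof.
move=> oD oD' Dx TD Ts Xs Ys X's Y's XT YT.
(* the first-order operator Z' applied to the field Z2', at T x *)
have half Z Z' Z2 Z2' : smooth_on D Z2 -> smooth_on D' Z2' ->
   (forall y, D y -> Z' (T y) = 'D_(Z y) T y) -> (forall y, D y -> Z2' (T y) = 'D_(Z2 y) T y) ->
   along Z' Z2' (T x) = 'D_(Z x) ('D_(Z2 x) T) x + 'D_(along Z Z2 x) T x.
  move=> Z2s Z2's ZT Z2T.
  rewrite (related_along oD Dx TD Ts Z2's (ZT _ Dx)).
  rewrite (@eq_derive_on _ _ _ D _ (fun y => 'D_(Z2 y) T y)) //.
  exact: (derive_derive_vf _ oD Dx Ts (smooth_on_differentiable Z2s Dx)).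
rewrite /local_bracket (half X X' Y Y') // (half Y Y' X X') //.
rewrite (schwarz _ _ oD Dx Ts).
have dT := smooth_on_differentiable Ts Dx.
rewrite derive_dirB //.
by rewrite opprD addrACA subrr add0r.
Qed.

(** The second derivatives of F cancel in the commutator. *)
Lemma along_bracket n k (D : set 'rV[R]_n) X Y (F : 'rV[R]_n -> 'rV[R]_k) x : open D -> D x ->
  smooth_on D X -> smooth_on D Y -> smooth_on D F ->
  along (local_bracket X Y) F x = along X (along Y F) x - along Y (along X F) x.
Proof.
move=> oD Dx Xs Ys Fs; have dF := smooth_on_differentiable Fs Dx.
rewrite [in RHS]/along (derive_derive_vf _ oD Dx Fs (smooth_on_differentiable Ys Dx)).
rewrite (derive_derive_vf _ oD Dx Fs (smooth_on_differentiable Xs Dx)).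
rewrite (schwarz _ _ oD Dx Fs) opprD addrACA subrr add0r.
exact: derive_dirB.
Qed.

Lemma alongB n (W : normedModType R) (D : set 'rV[R]_n) X (F G : 'rV[R]_n -> W) x :
  D x -> smooth_on D F -> smooth_on D G ->
  along X (fun y => F y - G y) x = along X F x - along X G x.
Proof.
move=> Dx Fs Gs; rewrite /along deriveB //; apply: diff_derivable.
  exact: smooth_on_differentiable Fs Dx.
exact: smooth_on_differentiable Gs Dx.
Qed.

(** Expanded with [along_bracket], every term cancels. *)
Lemma local_jacobi n (D : set 'rV[R]_n) X Y Z x : open D -> D x ->
  smooth_on D X -> smooth_on D Y -> smooth_on D Z ->
  local_bracket X (local_bracket Y Z) x =
  local_bracket (local_bracket X Y) Z x + local_bracket Y (local_bracket X Z) x.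
Proof.
move=> oD Dx Xs Ys Zs.
have E A B C : smooth_on D A -> smooth_on D B -> smooth_on D C ->
  local_bracket A (local_bracket B C) x =
  along A (along B C) x - along A (along C B) x - (along B (along C A) x - along C (along B A) x).
  move=> As Bs Cs; rewrite {1}/local_bracket (along_bracket oD) //.
  by rewrite (alongB _ Dx) //; exact: along_smooth.
have -> : local_bracket (local_bracket X Y) Z x = - local_bracket Z (local_bracket X Y) x.
  by rewrite {1 3}/local_bracket opprB.
have key (a b c d e f : 'rV[R]_n) :
    a - b - (c - d) = - (e - d - (a - f)) + (f - c - (b - e)).
  by apply/rowP => i; rewrite !mxE; ring.
by rewrite (E X Y Z) // (E Z X Y) // (E Y X Z) //; exact: key.
Qed.

End LocalFields.

(** * Coordinates on a manifold *)

Section Manifold.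
Variables (R : realType) (M : manifold R).
Implicit Types (i j : chart M) (p : M) (W : normedModType R).

Definition cimg i := cmap i @` cdom i.

Lemma open_cimg i : open (cimg i).
Proof. exact: (@open_cimage R M i). Qed.
Arguments open_cimg i : clear implicits.

Lemma open_dom i : open (cdom i).
Proof. exact: (@open_cdom R M i). Qed.
Arguments open_dom i : clear implicits.

Lemma image_cdomIP i (O : set M) x :
  (cmap i @` (cdom i `&` O)) x <-> cimg i x /\ O (cinv i x).
Proof.
split.
  by move=> [p [ip Op] <-]; split; [exists p|rewrite cmapK].
by move=> [[p ip <-]]; rewrite cmapK // => Op; exists p.
Qed.

(** On the image of a chart, this set is the preimage of O under the inverse
    of the chart. *)
Lemma open_image_cdomI i (O : set M) : open O -> open (cmap i @` (cdom i `&` O)).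
Proof.
move=> oO; rewrite openE => x /image_cdomIP[xi Ox].
have n1 : nbhs x (cimg i) by exact: open_nbhs_nbhs (conj (open_cimg i) xi).
have n2 : nbhs x (cinv i @^-1` O).
  by apply: (continuous_cinv xi); exact: open_nbhs_nbhs.
by apply: filterS2 n1 n2 => y yi yO; apply/image_cdomIP.
Qed.

Definition overlap i j := cmap i @` (cdom i `&` cdom j).

Lemma open_overlap i j : open (overlap i j).
Proof. by apply: open_image_cdomI; exact: open_dom. Qed.
Arguments open_overlap i j : clear implicits.

Lemma cinv_dom i x : cimg i x -> cdom i (cinv i x).
Proof. by move=> [p ip <-]; rewrite cmapK. Qed.

Lemma cinvK i x : cimg i x -> cmap i (cinv i x) = x.
Proof. by move=> [p ip <-]; rewrite cmapK. Qed.

Lemma cimg_cmap i p : cdom i p -> cimg i (cmap i p).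
Proof. by move=> ip; exists p. Qed.

Lemma overlap_cmap i j p : cdom i p -> cdom j p -> overlap i j (cmap i p).
Proof. by move=> ip jp; exists p. Qed.

Lemma transition_differentiable i j p : cdom i p -> cdom j p ->
  differentiable (cmap j \o cinv i) (cmap i p).
Proof.
move=> ip jp; apply: smooth_on_differentiable (smooth_transition i j) _.
exact: overlap_cmap.
Qed.

Lemma chart_change W (f : M -> W) i j p : cdom i p -> cdom j p ->
  \forall x \near cmap i p, (f \o cinv i) x = ((f \o cinv j) \o (cmap j \o cinv i)) x.
Proof.
move=> ip jp; have E x : overlap i j x ->
    (f \o cinv i) x = ((f \o cinv j) \o (cmap j \o cinv i)) x.
  by move=> /image_cdomIP[xi xj] /=; rewrite cmapK.
exact: open_near (open_overlap i j) (overlap_cmap ip jp) E.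
Qed.

Definition mdiff W (f : M -> W) p := differentiable (at_chart p f) (at_coord p).

Lemma differentiable_chart W (f : M -> W) i j p : cdom i p -> cdom j p ->
  differentiable (f \o cinv j) (cmap j p) -> differentiable (f \o cinv i) (cmap i p).
Proof.
move=> ip jp dj.
have E := chart_change f ip jp.
have E' : \forall x \near cmap i p, ((f \o cinv j) \o (cmap j \o cinv i)) x = (f \o cinv i) x.
  by apply: filterS E => x ->.
apply: near_eq_differentiable E' _; apply: differentiable_comp.
  exact: transition_differentiable.
by rewrite /= cmapK.
Qed.

Lemma mdiff_chart W (f : M -> W) i p : cdom i p ->
  mdiff f p <-> differentiable (f \o cinv i) (cmap i p).
Proof.
by move=> ip; split; apply: differentiable_chart => //; exact: cdom_chart_at.
Qed.

(** The derivative of f at p may be computed in any chart around p, once the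
    tangent vector is expressed in that chart. *)
Lemma dfun_chart W (f : M -> W) i p v : cdom i p -> mdiff f p ->
  dfun f p v = 'D_(tcoord i p v) (f \o cinv i) (cmap i p).
Proof.
move=> ip df; have cp := cdom_chart_at p.
have di := (mdiff_chart f ip).1 df.
rewrite /dfun /at_chart /at_coord.
rewrite (near_eq_derive _ (chart_change f cp ip)) derive_comp.
- by rewrite /= cmapK.
- exact: transition_differentiable.
- by rewrite /= cmapK.
Qed.

Lemma mdiff_cmap i p : cdom i p -> mdiff (cmap i) p.
Proof. by move=> ip; apply: transition_differentiable => //; exact: cdom_chart_at. Qed.

Lemma tcoord_change i j p v : cdom i p -> cdom j p ->
  tcoord j p v = 'D_(tcoord i p v) (cmap j \o cinv i) (cmap i p).
Proof. by move=> ip jp; apply: dfun_chart => //; exact: mdiff_cmap. Qed.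

Lemma dfun_linear W (f : M -> W) p : mdiff f p -> linear (dfun f p).
Proof. by move=> df; exact: derive_linear. Qed.

Lemma tcoord_linear i p : cdom i p -> linear (tcoord i p).
Proof. by move=> ip; apply: dfun_linear; exact: mdiff_cmap. Qed.

Lemma derive_cmap_cinv i x w : cimg i x -> 'D_w (cmap i \o cinv i) x = w.
Proof.
move=> xi; rewrite (@eq_derive_on _ _ _ (cimg i) _ id) ?derive_id //.
  exact: open_cimg.
by move=> y yi; exact: cinvK.
Qed.

Lemma tcoord_chart_at p v : tcoord (chart_at p) p v = v.
Proof. by apply: derive_cmap_cinv; apply: cimg_cmap; exact: cdom_chart_at. Qed.

Lemma tcoordK i p : cdom i p -> cancel (tcoord i p) (tcoord_inv i p).
Proof.
move=> ip v; rewrite /tcoord_inv -tcoord_change ?tcoord_chart_at //.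
exact: cdom_chart_at.
Qed.

(** The two transition maps between the chart i and the preferred chart at p
    are inverse to each other, so their derivatives are too. *)
Lemma tcoord_invK i p : cdom i p -> cancel (tcoord_inv i p) (tcoord i p).
Proof.
move=> ip w; have cp := cdom_chart_at p.
rewrite /tcoord /dfun /tcoord_inv /at_coord.
have E : cmap (chart_at p) p = (cmap (chart_at p) \o cinv i) (cmap i p) by rewrite /= cmapK.
rewrite E -derive_comp; last 2 first.
- exact: transition_differentiable.
- by rewrite /= cmapK //; exact: transition_differentiable.
rewrite -(@near_eq_derive _ _ _ _ _ _ _ (chart_change (cmap i) ip cp)).
by apply: derive_cmap_cinv; exact: cimg_cmap.
Qed.

End Manifold.

Arguments open_cimg {R M} i.
Arguments open_dom {R M} i.
Arguments open_overlap {R M} i j.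

(** * Functions and vector fields on a manifold *)

Section FieldsOnManifold.
Variables (R : realType) (M : manifold R).
Implicit Types (i j : chart M) (p : M) (W : normedModType R) (X Y Z : M -> tvec R M).

Lemma cimgE i : cmap i @` (cdom i `&` setT) = cimg i.
Proof. by rewrite setIT. Qed.

Lemma smooth_funP W (f : M -> W) :
  smooth_fun f <-> forall i, smooth_on (cimg i) (f \o cinv i).
Proof. by split=> H i; have := H i; rewrite cimgE. Qed.

(** Transition maps are smooth, so that one chart containing D is enough. *)
Lemma smooth_fun_on_chart W i (D : set M) (f : M -> W) : open D -> D `<=` cdom i ->
  smooth_on (cmap i @` D) (f \o cinv i) -> smooth_fun_on D f.
Proof.
move=> oD Di fs k.
apply: (@eq_smooth_on _ _ _ _ ((f \o cinv i) \o (cmap i \o cinv k))).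
- exact: open_image_cdomI.
- by move=> x /image_cdomIP[xk xD] /=; rewrite cmapK //; exact: Di.
apply: (@smooth_on_comp _ _ _ _ _ (cmap i @` D)) => //.
- exact: open_image_cdomI.
- by move=> x /image_cdomIP[xk xD] /=; exists (cinv k x).
apply: smooth_on_sub (smooth_transition k i).
by move=> x [p [pk pD] <-]; exists p => //; split=> //; exact: Di.
Qed.

Lemma smooth_fun_on_sub W (D D' : set M) (f : M -> W) : D' `<=` D ->
  smooth_fun_on D f -> smooth_fun_on D' f.
Proof.
move=> DD' fs i; apply: smooth_on_sub (fs i).
by move=> x [p [pi pD] <-]; exists p => //; split=> //; exact: DD'.
Qed.

Lemma vfieldP X : vfield X <-> forall i, smooth_on (cimg i) (vf_coord i X).
Proof.
split=> H i.
  by have := H i i; rewrite setIid; exact.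
apply: (@smooth_fun_on_chart _ i) => //; first exact: open_dom.
exact: H.
Qed.

Lemma smooth_fun_cover W (f : M -> W) :
  (forall i, smooth_fun_on (cdom i) f) -> smooth_fun f.
Proof. by move=> fs; apply/smooth_funP => i; have := fs i i; rewrite setIid. Qed.

Lemma smooth_fun_mdiff W (f : M -> W) p : smooth_fun f -> mdiff f p.
Proof.
move=> /smooth_funP fs; apply: smooth_on_differentiable (fs _) _.
by apply: cimg_cmap; exact: cdom_chart_at.
Qed.

Lemma smooth_fun_cst W (c : W) : smooth_fun (fun _ : M => c : W).
Proof. by move=> i; exact: smooth_on_cst. Qed.

Lemma smooth_funD W (f g : M -> W) : smooth_fun f -> smooth_fun g ->
  smooth_fun (fun p => f p + g p).
Proof.
move=> /smooth_funP fs /smooth_funP gs; apply/smooth_funP => i.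
exact: (smooth_onD (open_cimg i) (fs i) (gs i)).
Qed.

Lemma smooth_fun_lin W (W' : normedModType R) (f : M -> W) (L : W -> W') :
  linear L -> continuous L -> smooth_fun f -> smooth_fun (fun p => L (f p)).
Proof.
move=> Ll Lc /smooth_funP fs; apply/smooth_funP => i.
exact: (smooth_on_lin (open_cimg i) Ll Lc (fs i)).
Qed.

Lemma smooth_fun_bilin (U V W : normedModType R) (b : U -> V -> W) (f : M -> U) (g : M -> V) :
  cont_bilinear b -> smooth_fun f -> smooth_fun g -> smooth_fun (fun p => b (f p) (g p)).
Proof.
move=> bb /smooth_funP fs /smooth_funP gs; apply/smooth_funP => i.
exact: (smooth_on_bilin (open_cimg i) bb (fs i) (gs i)).
Qed.

Lemma smooth_funN W (f : M -> W) : smooth_fun f -> smooth_fun (fun p => - f p).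
Proof.
apply: (@smooth_fun_lin _ _ _ (fun w : W => - w)).
  by move=> a u v; rewrite opprD scalerN.
by move=> x; exact: opp_continuous.
Qed.

Lemma smooth_funB W (f g : M -> W) : smooth_fun f -> smooth_fun g ->
  smooth_fun (fun p => f p - g p).
Proof. by move=> fs gs; apply: smooth_funD => //; exact: smooth_funN. Qed.

Lemma smooth_fun_scale W (f : M -> R) (g : M -> W) : smooth_fun f -> smooth_fun g ->
  smooth_fun (fun p => f p *: g p).
Proof. by apply: smooth_fun_bilin; exact: scale_cont_bilinear. Qed.

Lemma dfunD W (f g : M -> W) p v : mdiff f p -> mdiff g p ->
  dfun (fun q => f q + g q) p v = dfun f p v + dfun g p v.
Proof. by move=> df dg; rewrite /dfun -deriveD //; exact: diff_derivable. Qed.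

Lemma dfun_lin W (W' : normedModType R) (f : M -> W) (L : W -> W') p v : linear L -> continuous L ->
  mdiff f p -> dfun (fun q => L (f q)) p v = L (dfun f p v).
Proof.
move=> Ll Lc df.
have dL : differentiable L (at_chart p f (at_coord p)) by exact: lin_differentiable.
by have := derive_comp v df dL; rewrite [RHS]derive_lin.
Qed.

Lemma dfun_bilin (U V W : normedModType R) (b : U -> V -> W) (f : M -> U) (g : M -> V) p v :
  cont_bilinear b -> mdiff f p -> mdiff g p ->
  dfun (fun q => b (f q) (g q)) p v = b (dfun f p v) (g p) + b (f p) (dfun g p v).
Proof.
move=> bb df dg; have [_ /(_ v)] := cont_bilinear_diff bb df dg.
by rewrite /dfun /at_chart /at_coord /= !cmapK //; exact: cdom_chart_at.
Qed.

Lemma dfun_scale W (f : M -> R) (g : M -> W) p v : mdiff f p -> mdiff g p ->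
  dfun (fun q => f q *: g q) p v = dfun f p v *: g p + f p *: dfun g p v.
Proof. exact: (@dfun_bilin R W W (fun a w => a *: w) f g p v (@scale_cont_bilinear R W)). Qed.

Lemma dfun_cst W (c : W) p v : dfun (fun _ : M => c) p v = 0.
Proof. by rewrite /dfun derive_cst. Qed.

Lemma dfunN W (f : M -> W) p v : mdiff f p -> dfun (fun q => - f q) p v = - dfun f p v.
Proof.
apply: (@dfun_lin _ _ _ (fun w : W => - w)).
  by move=> a u w; rewrite opprD scalerN.
by move=> x; exact: opp_continuous.
Qed.

Lemma dfunB W (f g : M -> W) p v : mdiff f p -> mdiff g p ->
  dfun (fun q => f q - g q) p v = dfun f p v - dfun g p v.
Proof.
move=> df dg; rewrite dfunD ?dfunN //; rewrite /mdiff.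
exact: differentiableN.
Qed.

(** Coordinate expression of X(f), in any chart and not only in the preferred
    chart at each point. *)
Lemma lie_deriv_local W X (f : M -> W) i x : smooth_fun f -> cimg i x ->
  lie_deriv X f (cinv i x) = along (vf_coord i X) (f \o cinv i) x.
Proof.
move=> fs xi; rewrite /lie_deriv (dfun_chart _ (cinv_dom xi) (smooth_fun_mdiff _ fs)).
by rewrite cinvK.
Qed.

Lemma lie_deriv_smooth W X (f : M -> W) : vfield X -> smooth_fun f ->
  smooth_fun (lie_deriv X f).
Proof.
move=> /vfieldP Xs fs; apply/smooth_funP => i.
apply: (@eq_smooth_on _ _ _ _ (along (vf_coord i X) (f \o cinv i))).
- exact: open_cimg.
- by move=> x xi /=; rewrite lie_deriv_local.
- by apply: along_smooth => //; [exact: open_cimg|exact: (smooth_funP _).1].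
Qed.

Lemma vf_coord_cmap X i p : cdom i p -> vf_coord i X (cmap i p) = tcoord i p (X p).
Proof. by move=> ip; rewrite /vf_coord cmapK. Qed.

Lemma vf_coord_at X p : vf_coord (chart_at p) X (at_coord p) = X p.
Proof.
by rewrite vf_coord_cmap ?tcoord_chart_at //; exact: cdom_chart_at.
Qed.

Lemma vf_bracketE X Y p :
  vf_bracket X Y p = local_bracket (vf_coord (chart_at p) X) (vf_coord (chart_at p) Y) (at_coord p).
Proof. by rewrite /local_bracket /along !vf_coord_at. Qed.

Lemma vf_coord_change X i j x : overlap i j x ->
  vf_coord j X ((cmap j \o cinv i) x) = 'D_(vf_coord i X x) (cmap j \o cinv i) x.
Proof.
move=> /image_cdomIP[xi xj]; apply: etrans (vf_coord_cmap X xj) _.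
by apply: etrans (tcoord_change (X (cinv i x)) (cinv_dom xi) xj) _; rewrite cinvK.
Qed.

(** The definition of the bracket uses a different chart at each point; this
    is its expression in one fixed chart.  The transition map relates the
    coordinate expressions of a field in two charts, so [bracket_related]
    applies. *)
Lemma vf_bracket_local X Y i x : vfield X -> vfield Y -> cimg i x ->
  vf_coord i (vf_bracket X Y) x = local_bracket (vf_coord i X) (vf_coord i Y) x.
Proof.
move=> /vfieldP Xs /vfieldP Ys [p ip <-]; rewrite vf_coord_cmap // vf_bracketE.
have cp := cdom_chart_at p; set c := chart_at p.
rewrite (tcoord_change _ cp ip) tcoord_chart_at.
have Ex : cmap i p = (cmap i \o cinv c) (cmap c p) by rewrite /= cmapK.
have subc : overlap c i `<=` cimg c by move=> y /image_cdomIP[].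
rewrite [in RHS]Ex; symmetry; apply: (@bracket_related _ _ _ (overlap c i) (cimg i)).
- exact: open_overlap.
- exact: open_cimg.
- exact: overlap_cmap.
- by move=> y /image_cdomIP[yc yi] /=; exact: cimg_cmap.
- exact: smooth_transition.
- exact: smooth_on_sub (Xs c).
- exact: smooth_on_sub (Ys c).
- exact: Xs.
- exact: Ys.
- by move=> y; exact: vf_coord_change.
- by move=> y; exact: vf_coord_change.
Qed.

Lemma vf_bracket_vfield X Y : vfield X -> vfield Y -> vfield (vf_bracket X Y).
Proof.
move=> Xs Ys; apply/vfieldP => i.
apply: (@eq_smooth_on _ _ _ _ (local_bracket (vf_coord i X) (vf_coord i Y))).
- exact: open_cimg.
- by move=> x xi; rewrite vf_bracket_local.
- by apply: local_bracket_smooth; [exact: open_cimg|exact: (vfieldP _).1|exact: (vfieldP _).1].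
Qed.

Lemma cimg_at p : cimg (chart_at p) (at_coord p).
Proof. by apply: cimg_cmap; exact: cdom_chart_at. Qed.

Lemma eq_along n W (D : set 'rV[R]_n) V (F G : 'rV[R]_n -> W) x : open D -> D x ->
  (forall y, D y -> F y = G y) -> along V F x = along V G x.
Proof. by move=> oD Dx FG; exact: eq_derive_on oD Dx FG. Qed.

Lemma lie_deriv_at W X (f : M -> W) p :
  lie_deriv X f p = along (vf_coord (chart_at p) X) (f \o cinv (chart_at p)) (at_coord p).
Proof. by rewrite /along vf_coord_at. Qed.

Lemma lie_deriv_bracket k X Y (f : M -> 'rV[R]_k) p : vfield X -> vfield Y -> smooth_fun f ->
  lie_deriv (vf_bracket X Y) f p = lie_deriv X (lie_deriv Y f) p - lie_deriv Y (lie_deriv X f) p.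
Proof.
move=> Xs Ys fs; rewrite !lie_deriv_at; set c := chart_at p; set x := at_coord p.
have oc := open_cimg c; have xc : cimg c x by exact: cimg_at.
have fl := (smooth_funP f).1 fs c.
have E U V (Us : vfield U) (Vs : vfield V) :
    along (vf_coord c U) (lie_deriv V f \o cinv c) x =
    along (vf_coord c U) (along (vf_coord c V) (f \o cinv c)) x.
  by apply: (eq_along _ oc xc) => y yc; exact: lie_deriv_local.
apply: etrans _ (esym (congr2 (fun u v => u - v) (E X Y Xs Ys) (E Y X Ys Xs))).
apply: etrans _ (along_bracket oc xc ((vfieldP X).1 Xs c) ((vfieldP Y).1 Ys c) fl).
by rewrite /along vf_bracket_local.
Qed.

Lemma eq_local_bracket n (D : set 'rV[R]_n) (A B A' B' : 'rV[R]_n -> 'rV[R]_n) x : open D -> D x ->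
  (forall y, D y -> A y = A' y) -> (forall y, D y -> B y = B' y) ->
  local_bracket A B x = local_bracket A' B' x.
Proof.
move=> oD Dx AA BB; rewrite /local_bracket /along (AA _ Dx) (BB _ Dx).
by rewrite (eq_derive_on _ oD Dx AA) (eq_derive_on _ oD Dx BB).
Qed.

Lemma vf_jacobi X Y Z p : vfield X -> vfield Y -> vfield Z ->
  vf_bracket X (vf_bracket Y Z) p =
  vf_bracket (vf_bracket X Y) Z p + vf_bracket Y (vf_bracket X Z) p.
Proof.
move=> Xs Ys Zs; rewrite !vf_bracketE; set c := chart_at p; set x := at_coord p.
have oc := open_cimg c; have xc : cimg c x by exact: cimg_at.
have E A B (As : vfield A) (Bs : vfield B) y (yc : cimg c y) := vf_bracket_local As Bs yc.
apply: etrans (eq_local_bracket oc xc (fun _ _ => erefl) (E _ _ Ys Zs)) _.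
apply: etrans (local_jacobi oc xc ((vfieldP X).1 Xs c) ((vfieldP Y).1 Ys c) ((vfieldP Z).1 Zs c)) _.
apply: esym; apply: congr2.
  exact: (eq_local_bracket oc xc (E _ _ Xs Ys) (fun _ _ => erefl)).
exact: (eq_local_bracket oc xc (fun _ _ => erefl) (E _ _ Xs Zs)).
Qed.

Lemma vf_bracketC X Y p : vf_bracket X Y p = - vf_bracket Y X p.
Proof. by rewrite /vf_bracket opprB. Qed.

Lemma vf_coord_differentiable X i x : vfield X -> cimg i x -> differentiable (vf_coord i X) x.
Proof. by move=> /vfieldP Xs; exact: smooth_on_differentiable. Qed.

Lemma tcoordZD i p a v w : cdom i p -> tcoord i p (a *: v + w) = a *: tcoord i p v + tcoord i p w.
Proof. by move=> ip; exact: tcoord_linear. Qed.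

Lemma vf_bracket_linearr a X Y Z p : vfield X -> vfield Y -> vfield Z ->
  vf_bracket X (fun q => a *: Y q + Z q) p = a *: vf_bracket X Y p + vf_bracket X Z p.
Proof.
move=> Xs Ys Zs; pose c := chart_at p; pose x := at_coord p.
have oc : open (cimg c) by exact: open_cimg.
have xc : cimg c x by exact: cimg_at.
have dY := vf_coord_differentiable Ys xc; have dZ := vf_coord_differentiable Zs xc.
have dX := vf_coord_differentiable Xs xc.
have E1 : 'D_(X p) (vf_coord c (fun q => a *: Y q + Z q)) x =
    a *: 'D_(X p) (vf_coord c Y) x + 'D_(X p) (vf_coord c Z) x.
  apply: etrans (derive_linear_comb a _ dY dZ).
  by apply: (eq_derive_on _ oc xc) => y yc; exact: tcoordZD (cinv_dom yc).
have E2 := derive_linear dX a (Y p) (Z p).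
have key (u v w z : tvec R M) : a *: u + v - (a *: w + z) = a *: (u - w) + (v - z).
  by rewrite scalerBr opprD addrACA.
exact: etrans (congr2 (fun u v => u - v) E1 E2) (key _ _ _ _).
Qed.

Lemma vfield_linear a X Y : vfield X -> vfield Y -> vfield (fun q => a *: X q + Y q).
Proof.
move=> /vfieldP Xs /vfieldP Ys; apply/vfieldP => i.
apply: (@eq_smooth_on _ _ _ _ (fun x => a *: vf_coord i X x + vf_coord i Y x)).
- exact: open_cimg.
- by move=> y yc; rewrite -tcoordZD //; exact: cinv_dom.
apply: smooth_onD => //; first exact: open_cimg.
apply: (@smooth_on_lin _ _ _ _ _ (vf_coord i X) (fun w => a *: w)) => //.
- exact: open_cimg.
- by move=> b u v; rewrite scalerDr !scalerA mulrC.
- exact: scaler_continuous.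
Qed.

Lemma tcoordZ i p a v : cdom i p -> tcoord i p (a *: v) = a *: tcoord i p v.
Proof.
move=> ip; have t0 : tcoord i p 0 = 0 by exact: derive0.
by have := tcoordZD a v 0 ip; rewrite t0 !addr0.
Qed.

Lemma vfield_scale (f : M -> R) X : smooth_fun f -> vfield X -> vfield (fscale f X).
Proof.
move=> /smooth_funP fs /vfieldP Xs; apply/vfieldP => i.
apply: (@eq_smooth_on _ _ _ _ (fun x => (f \o cinv i) x *: vf_coord i X x)).
- exact: open_cimg.
- by move=> y yc; rewrite -tcoordZ //; exact: cinv_dom.
exact: (smooth_on_bilin (open_cimg i) (@scale_cont_bilinear R _) (fs i) (Xs i)).
Qed.

Lemma vf_bracket_scaler (f : M -> R) X Y p : smooth_fun f -> vfield X -> vfield Y ->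
  vf_bracket X (fscale f Y) p = f p *: vf_bracket X Y p + lie_deriv X f p *: Y p.
Proof.
move=> fs Xs Ys; pose c := chart_at p; pose x := at_coord p.
have oc : open (cimg c) by exact: open_cimg.
have xc : cimg c x by exact: cimg_at.
have dY := vf_coord_differentiable Ys xc; have dX := vf_coord_differentiable Xs xc.
have df : differentiable (at_chart p f) x := smooth_fun_mdiff p fs.
have fx : at_chart p f x = f p by rewrite /at_chart /= cmapK //; exact: cdom_chart_at.
have E1 : 'D_(X p) (vf_coord c (fscale f Y)) x =
    lie_deriv X f p *: Y p + f p *: 'D_(X p) (vf_coord c Y) x.
  have [_ /(_ (X p))] := cont_bilinear_diff (@scale_cont_bilinear R _) df dY.
  rewrite vf_coord_at fx; apply: etrans.
  by apply: (eq_derive_on _ oc xc) => y yc; exact: tcoordZ (cinv_dom yc).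
have E2 : 'D_(f p *: Y p) (vf_coord c X) x = f p *: 'D_(Y p) (vf_coord c X) x.
  have := derive_linear dX (f p) (Y p) 0.
  by rewrite derive0 !addr0.
have key (a b : R) (u v w : tvec R M) : a *: u + b *: v - b *: w = b *: (v - w) + a *: u.
  by rewrite scalerBr [RHS]addrC addrA.
exact: etrans (congr2 (fun u v => u - v) E1 E2) (key _ _ _ _ _).
Qed.

Lemma tangent_vbundle : is_vbundle (tangent_bundle M).
Proof.
split=> /=.
- exact: open_dom.
- by move=> p; exists (chart_at p); exact: cdom_chart_at.
- exact: tcoord_linear.
- exact: tcoordK.
- exact: tcoord_invK.
move=> i j e; apply: (@smooth_fun_on_chart _ i).
- by apply: openI; exact: open_dom.
- by move=> p [].
apply: (@eq_smooth_on _ _ _ _ ('D_e (cmap j \o cinv i))).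
- exact: open_overlap.
- move=> x [p [ip jp] <-] /=; rewrite cmapK //.
  apply: esym; apply: etrans (tcoord_change _ ip jp) _.
  by rewrite tcoord_invK.
- by apply: smooth_on_derive; exact: smooth_transition.
Qed.

End FieldsOnManifold.

(** * Maps of two variables *)

Section Slices.
Variables (R : realType) (V1 V2 W : normedModType R).
Implicit Type F : V1 * V2 -> W.

#[local] Transparent derive.
(** No differentiability is needed: the difference quotients are equal. *)
Lemma derive_slice2 F x y u : 'D_u (fun y => F (x, y)) y = 'D_(0, u) F (x, y).
Proof.
have E : (fun h : R => h^-1 *: (((fun y => F (x, y)) \o shift y) (h *: u) - F (x, y))) =
    (fun h : R => h^-1 *: ((F \o shift (x, y)) (h *: (0, u)) - F (x, y))).
  apply/funext => h /=; congr (_ *: (F _ - _)).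
  by rewrite -[RHS]/(h *: 0 + x, h *: u + y) scaler0 add0r.
by rewrite /derive E.
Qed.

Lemma derive_slice1 F x y u : 'D_u (fun x => F (x, y)) x = 'D_(u, 0) F (x, y).
Proof.
have E : (fun h : R => h^-1 *: (((fun x => F (x, y)) \o shift x) (h *: u) - F (x, y))) =
    (fun h : R => h^-1 *: ((F \o shift (x, y)) (h *: (u, 0)) - F (x, y))).
  apply/funext => h /=; congr (_ *: (F _ - _)).
  by rewrite -[RHS]/(h *: u + x, h *: 0 + y) scaler0 add0r.
by rewrite /derive E.
Qed.
#[local] Opaque derive.

Lemma pair_differentiable2 (x : V1) (y : V2) :
  differentiable (fun y : V2 => (x, y)) y /\ forall u, 'D_u (fun y : V2 => (x, y)) y = (0, u).
Proof.
have di : differentiable (fun y : V2 => y) y.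
  by apply: lin_differentiable => // z; exact: cvg_id.
have dp := differentiable_pair (differentiable_cst x y) di.
split=> [|u]; first exact: dp.
rewrite (deriveE _ dp).
have /(congr1 (@^~ u)) /= -> := diff_pair (differentiable_cst x y) di.
by rewrite -!deriveE // derive_cst derive_id.
Qed.

Lemma pair_differentiable1 (x : V1) (y : V2) :
  differentiable (fun x : V1 => (x, y)) x /\ forall u, 'D_u (fun x : V1 => (x, y)) x = (u, 0).
Proof.
have di : differentiable (fun x : V1 => x) x.
  by apply: lin_differentiable => // z; exact: cvg_id.
have dp := differentiable_pair di (differentiable_cst y x).
split=> [|u]; first exact: dp.
rewrite (deriveE _ dp).
have /(congr1 (@^~ u)) /= -> := diff_pair di (differentiable_cst y x).
by rewrite -!deriveE // derive_cst derive_id.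
Qed.

Lemma smooth_on_slice2 (D : set (V1 * V2)) (D2 : set V2) F x : open D2 ->
  (forall y, D2 y -> D (x, y)) -> smooth_on D F -> smooth_on D2 (fun y => F (x, y)).
Proof.
move=> oD DD; apply: (@smooth_on_comp_affine _ _ _ _ _ _ (fun y => (x, y))
  (fun u => (0, u))); [exact: oD| | |exact: DD].
  exact: (fun y => (pair_differentiable2 x y).1).
exact: (fun y => (pair_differentiable2 x y).2).
Qed.

Lemma smooth_on_slice1 (D : set (V1 * V2)) (D1 : set V1) F y : open D1 ->
  (forall x, D1 x -> D (x, y)) -> smooth_on D F -> smooth_on D1 (fun x => F (x, y)).
Proof.
move=> oD DD; apply: (@smooth_on_comp_affine _ _ _ _ _ _ (fun x => (x, y))
  (fun u => (u, 0))); [exact: oD| | |exact: DD].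
  exact: (fun x => (pair_differentiable1 x y).1).
exact: (fun x => (pair_differentiable1 x y).2).
Qed.

End Slices.

(** * Tangent maps *)

Section Maps.
Variable R : realType.
Implicit Types (M N P : manifold R) (W : normedModType R).

(** Continuity is part of the notion: differentiability of the expression of f
    in one chart around f p does not imply that f maps a neighbourhood of p into
    that chart. *)
Definition mapdiff M N (f : M -> N) (p : M) :=
  {for p, continuous f} /\ mdiff (cmap (chart_at (f p)) \o f) p.

(** Chain rule through the preferred charts; continuity of f makes the
    coordinate expression of g o f the composite of the expressions of g and
    f near p. *)
Lemma dfun_comp M N W (f : M -> N) (g : N -> W) (p : M) :
  mapdiff f p -> mdiff g (f p) ->
  mdiff (g \o f) p /\ forall v, dfun (g \o f) p v = dfun g (f p) (tmap f p v).
Proof.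
move=> [fc fd] gd; set c := chart_at p; set c' := chart_at (f p).
have cp : cdom c p by exact: cdom_chart_at.
have E0 : cinv c (at_coord p) = p by rewrite /at_coord cmapK.
have E : \forall x \near at_coord p,
    ((at_chart (f p) g) \o (at_chart p (cmap c' \o f))) x = at_chart p (g \o f) x.
  have n1 : nbhs p (f @^-1` cdom c').
    by apply: fc; apply: open_nbhs_nbhs; split; [exact: open_dom|exact: cdom_chart_at].
  have n2 : nbhs (at_coord p) (cinv c @^-1` (f @^-1` cdom c')).
    by apply: (continuous_cinv (cimg_at p)); rewrite E0.
  by apply: filterS n2 => x /= xf; rewrite /at_chart /= cmapK.
have E1 : at_chart p (cmap c' \o f) (at_coord p) = at_coord (f p).
  by rewrite /at_chart /= E0.
have gd' : differentiable (at_chart (f p) g) (at_chart p (cmap c' \o f) (at_coord p)).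
  by rewrite E1.
have dc := differentiable_comp fd gd'.
split=> [|v]; first exact: near_eq_differentiable E dc.
by rewrite /dfun -(near_eq_derive _ E) (derive_comp _ fd gd') E1.
Qed.

Lemma dfun_cmap_comp M N (f : M -> N) (p : M) (j : chart N) : mapdiff f p -> cdom j (f p) ->
  mdiff (cmap j \o f) p /\ forall v, dfun (cmap j \o f) p v = tcoord j (f p) (tmap f p v).
Proof. by move=> fd jp; apply: dfun_comp => //; exact: mdiff_cmap. Qed.

Lemma tmap_comp M N P (f : M -> N) (g : N -> P) (p : M) v :
  mapdiff f p -> mapdiff g (f p) -> tmap (g \o f) p v = tmap g (f p) (tmap f p v).
Proof.
by move=> fd [_ gd]; have [_ E] := dfun_comp fd gd; rewrite /tmap -E.
Qed.

Lemma mapdiff_comp M N P (f : M -> N) (g : N -> P) (p : M) :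
  mapdiff f p -> mapdiff g (f p) -> mapdiff (g \o f) p.
Proof.
move=> fd [gc gd]; have [fc _] := fd; have [D _] := dfun_comp fd gd.
by split => //; apply: continuous_comp.
Qed.

Lemma tmap_linear M N (f : M -> N) (p : M) : mapdiff f p -> linear (tmap f p).
Proof. by move=> [_ fd]; exact: dfun_linear. Qed.

Lemma tmap_id M (p : M) v : tmap (fun q : M => q) p v = v.
Proof. exact: tcoord_chart_at. Qed.

Lemma open_preimage M N (f : M -> N) j : continuous f -> open (f @^-1` cdom j).
Proof. by move=> /continuousP; apply; exact: open_dom. Qed.

Lemma smooth_map_mapdiff M N (f : M -> N) p : smooth_map f -> mapdiff f p.
Proof.
move=> [fc fs]; split; first exact: fc.
apply: smooth_on_differentiable (fs (chart_at p) (chart_at (f p))) _.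
by exists p => //; split; exact: cdom_chart_at.
Qed.

Section TwoVariables.
Variables (M N P : manifold R) (f : M -> N -> P).
Hypothesis fs : smooth_map2 f.

Definition chart2 i j k (x : 'rV[R]_(mdim M) * 'rV[R]_(mdim N)) : 'rV[R]_(mdim P) :=
  cmap k (f (cinv i x.1) (cinv j x.2)).

Definition chart2_dom (i : chart M) (j : chart N) (k : chart P) :
    set ('rV[R]_(mdim M) * 'rV[R]_(mdim N)) :=
  [set x | [/\ cimg i x.1, cimg j x.2 & cdom k (f (cinv i x.1) (cinv j x.2))]].

Lemma chart2_domE i j k : chart2_dom i j k =
  (fun z : M * N => (cmap i z.1, cmap j z.2)) @`
    [set z | [/\ cdom i z.1, cdom j z.2 & cdom k (f z.1 z.2)]].
Proof.
apply/seteqP; split => [[x y] /= [xi yj xyk]|_ [[p q] /= [pi qj pqk] <-]].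
  exists (cinv i x, cinv j y) => /=; last by rewrite !cinvK.
  by split => //; exact: cinv_dom.
by split; rewrite /= ?cmapK //; exact: cimg_cmap.
Qed.

Lemma open_chart2_dom i j k : continuous (fun z : M * N => f z.1 z.2) ->
  open (chart2_dom i j k).
Proof.
move=> fc; rewrite openE => -[x y] /= [xi yj xyk].
have nx : nbhs x (cimg i) by exact: open_nbhs_nbhs (conj (open_cimg i) xi).
have ny : nbhs y (cimg j) by exact: open_nbhs_nbhs (conj (open_cimg j) yj).
have nf : nbhs (cinv i x, cinv j y) [set z | cdom k (f z.1 z.2)].
  by apply: (fc (cinv i x, cinv j y)); exact: open_nbhs_nbhs (conj (open_dom k) xyk).
have [[A B] /= [nA nB] AB] := nf.
exists (cimg i `&` cinv i @^-1` A, cimg j `&` cinv j @^-1` B) => /=.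
  split; apply: filterI => //; first exact: (continuous_cinv xi).
  exact: (continuous_cinv yj).
move=> [x' y'] /= [[x'i x'A] [y'j y'B]]; split => //.
exact: (AB (cinv i x', cinv j y')).
Qed.

Lemma chart2_smooth i j k : smooth_on (chart2_dom i j k) (chart2 i j k).
Proof. by rewrite chart2_domE; have [_ /(_ i j k)] := fs. Qed.

Lemma map2_continuous2 p : continuous (f p).
Proof.
move=> q; apply: (@continuous_comp _ _ _ (fun q => (p, q)) (fun z : M * N => f z.1 z.2)).
  by apply: cvg_pair; [exact: cvg_cst|exact: cvg_id].
by have [+ _] := fs; exact.
Qed.

Lemma map2_continuous1 q : continuous (f^~ q).
Proof.
move=> p; apply: (@continuous_comp _ _ _ (fun p => (p, q)) (fun z : M * N => f z.1 z.2)).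
  by apply: cvg_pair; [exact: cvg_id|exact: cvg_cst].
by have [+ _] := fs; exact.
Qed.

Lemma slice2_smooth_map p : smooth_map (f p).
Proof.
split=> [|j k]; first exact: map2_continuous2.
pose i := chart_at p; have ip : cdom i p by exact: cdom_chart_at.
have oD : open (cmap j @` (cdom j `&` f p @^-1` cdom k)).
  by apply: open_image_cdomI; apply: open_preimage; exact: map2_continuous2.
apply: (@eq_smooth_on _ _ _ _ (fun y => chart2 i j k (cmap i p, y)) _ oD).
  by move=> y _; rewrite /chart2 /= cmapK.
apply: smooth_on_slice2 (chart2_smooth i j k) => // y /image_cdomIP[yj yk].
by split => //=; [exact: cimg_cmap|rewrite cmapK].
Qed.

Lemma slice1_smooth_map q : smooth_map (f^~ q).
Proof.
split=> [|i k]; first exact: map2_continuous1.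
pose j := chart_at q; have jq : cdom j q by exact: cdom_chart_at.
have oD : open (cmap i @` (cdom i `&` (f^~ q) @^-1` cdom k)).
  by apply: open_image_cdomI; apply: open_preimage; exact: map2_continuous1.
apply: (@eq_smooth_on _ _ _ _ (fun x => chart2 i j k (x, cmap j q)) _ oD).
  by move=> y _; rewrite /chart2 /= cmapK.
apply: smooth_on_slice1 (chart2_smooth i j k) => // x /image_cdomIP[xi xk].
by split => //=; [exact: cimg_cmap|rewrite cmapK].
Qed.

(** The tangent map of f(p, -) is a partial derivative of f in coordinates. *)
Lemma tmap_slice2 (i : chart M) (k : chart P) p q v : cdom i p -> cdom k (f p q) ->
  tcoord k (f p q) (tmap (f p) q v) =
  'D_(0, v) (chart2 i (chart_at q) k) (cmap i p, at_coord q).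
Proof.
move=> ip kpq; have sd := smooth_map_mapdiff q (slice2_smooth_map p).
apply: etrans (esym ((dfun_cmap_comp sd kpq).2 v)) _.
apply: etrans _ (derive_slice2 _ _ _ _); rewrite /dfun.
have -> // : at_chart q (cmap k \o f p) = (fun y => chart2 i (chart_at q) k (cmap i p, y)).
by apply/funext => y; rewrite /chart2 /= cmapK.
Qed.

Lemma tmap_slice1 (j : chart N) (k : chart P) p q v : cdom j q -> cdom k (f p q) ->
  tcoord k (f p q) (tmap (f^~ q) p v) =
  'D_(v, 0) (chart2 (chart_at p) j k) (at_coord p, cmap j q).
Proof.
move=> jq kpq; have sd := smooth_map_mapdiff p (slice1_smooth_map q).
apply: etrans (esym ((dfun_cmap_comp sd kpq).2 v)) _.
apply: etrans _ (derive_slice1 _ _ _ _); rewrite /dfun.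
have -> // : at_chart p (cmap k \o f^~ q) = (fun y => chart2 (chart_at p) j k (y, cmap j q)).
by apply/funext => y; rewrite /chart2 /= cmapK.
Qed.

Lemma tmap_slice2_cinv i k x q v : cimg i x -> cdom k (f (cinv i x) q) ->
  tcoord k (f (cinv i x) q) (tmap (f (cinv i x)) q v) =
  'D_(0, v) (chart2 i (chart_at q) k) (x, at_coord q).
Proof. by move=> [p ip <-]; rewrite cmapK //; exact: tmap_slice2. Qed.

Lemma tmap_slice1_cinv j k p y v : cimg j y -> cdom k (f p (cinv j y)) ->
  tcoord k (f p (cinv j y)) (tmap (f^~ (cinv j y)) p v) =
  'D_(v, 0) (chart2 (chart_at p) j k) (at_coord p, y).
Proof. by move=> [q jq <-]; rewrite cmapK //; exact: tmap_slice1. Qed.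

Lemma derive_chart2_smooth i (q : N) k w (D : set 'rV[R]_(mdim M)) : open D ->
  (forall x, D x -> cimg i x /\ cdom k (f (cinv i x) q)) ->
  smooth_on D (fun x => 'D_w (chart2 i (chart_at q) k) (x, at_coord q)).
Proof.
move=> oD DD; have s := smooth_on_derive w (chart2_smooth i (chart_at q) k).
apply: (smooth_on_slice1 oD _ s) => x /DD[xi xk].
split => //=; first exact: cimg_at.
by rewrite /at_coord cmapK //; exact: cdom_chart_at.
Qed.

(** When f(p, q) = r for all p, the tangent maps of f(p, -) at q all take values
    in the same tangent space T_r P, so the dependence on p is that of a
    function with values in a fixed vector space. *)
Lemma tmap_fixed_smooth q (r : P) v : (forall p, f p q = r) ->
  smooth_fun (fun p => tmap (f p) q v).
Proof.
move=> fq; apply/smooth_funP => i; pose k := chart_at r.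
have kr : cdom k r by exact: cdom_chart_at.
apply: eq_smooth_on (derive_chart2_smooth (q := q) (k := k) (0, v) (open_cimg i) _).
- exact: open_cimg.
- move=> x xi; have kx : cdom k (f (cinv i x) q) by rewrite fq.
  apply: etrans (esym (tmap_slice2_cinv v xi kx)) _.
  by rewrite fq tcoord_chart_at.
- by move=> x xi; rewrite fq.
Qed.

End TwoVariables.

End Maps.

(** * The Lie algebra of a Lie group *)

Section LieGroup.
Variables (R : realType) (G : lie_group R).
Implicit Types (g h : G) (u v w : lie_of R G).
Local Notation e := (gone G).

Lemma gmulgV g : gmul g (ginv g) = e.
Proof.
rewrite -[LHS]gmul1 -{1}(gmulV (ginv g)) -gmulA (gmulA (ginv g)) gmulV gmul1.
exact: gmulV.
Qed.

Lemma gmulg1 g : gmul g e = g.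
Proof. by rewrite -(gmulV g) gmulA gmulgV gmul1. Qed.

Lemma gmul_idem g : gmul g g = g -> g = e.
Proof. by move=> E; rewrite -(gmul1 g) -(gmulV g) -gmulA E. Qed.

Lemma gmul1E : gmul e = (fun h => h).
Proof. by apply/funext => h; exact: gmul1. Qed.

Lemma gmulr1E : (fun h => gmul h e) = (fun h : G => h).
Proof. by apply/funext => h; exact: gmulg1. Qed.

Lemma gmull_mapdiff g h : mapdiff (gmul g) h.
Proof. exact: smooth_map_mapdiff (slice2_smooth_map (gmul_smooth G) g). Qed.

Lemma gmulr_mapdiff g h : mapdiff (fun k : G => gmul k g) h.
Proof. exact: smooth_map_mapdiff (slice1_smooth_map (gmul_smooth G) g). Qed.

Lemma left_inv1 v : left_inv v e = v.
Proof. by rewrite /left_inv gmul1E tmap_id. Qed.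

Lemma left_inv_linear a v w g : left_inv (a *: v + w) g = a *: left_inv v g + left_inv w g.
Proof. exact: (tmap_linear (gmull_mapdiff g e)). Qed.

(** A left-invariant field is related to itself by left translations. *)
Lemma left_inv_tmap v g h : left_inv v (gmul g h) = tmap (gmul g) h (left_inv v h).
Proof.
have E : gmul (gmul g h) = gmul g \o gmul h by apply/funext => k /=; rewrite gmulA.
have h1 : gmul h e = h by exact: gmulg1.
have := tmap_comp v (gmull_mapdiff h e) (gmull_mapdiff g (gmul h e)).
by rewrite /left_inv E => ->; rewrite h1.
Qed.

Lemma vf_coord_left_inv i v x : cimg i x ->
  vf_coord i (left_inv v) x =
  'D_(0, v) (chart2 (gmul (l:=G)) i (chart_at e) i) (x, at_coord e).
Proof.
move=> xi; have kx : cdom i (gmul (cinv i x) e) by rewrite gmulg1; exact: cinv_dom.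
apply: etrans _ (tmap_slice2_cinv (gmul_smooth G) v xi kx).
by rewrite gmulg1.
Qed.

(** In coordinates, a left-invariant field is the partial derivative of the
    multiplication in its second variable, at the identity. *)
Lemma left_inv_vfield v : vfield (left_inv v).
Proof.
apply/vfieldP => i.
apply: eq_smooth_on (derive_chart2_smooth (gmul_smooth G)
  (q := e) (i := i) (k := i) (0, v) (open_cimg i) _).
- exact: open_cimg.
- by move=> x xi; exact: esym (vf_coord_left_inv v xi).
- by move=> x xi; split=> //; rewrite gmulg1; exact: cinv_dom.
Qed.

Lemma lie_bracket_linearr a u v w :
  lie_bracket u (a *: v + w) = a *: lie_bracket u v + lie_bracket u w.
Proof.
rewrite /lie_bracket.
have -> : left_inv (a *: v + w) = (fun g => a *: left_inv v g + left_inv w g).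
  by apply/funext => g; exact: left_inv_linear.
by apply: vf_bracket_linearr; exact: left_inv_vfield.
Qed.

Lemma lie_bracketC u v : lie_bracket u v = - lie_bracket v u.
Proof. exact: vf_bracketC. Qed.

Lemma lie_bracket_linearl a u v w :
  lie_bracket (a *: v + w) u = a *: lie_bracket v u + lie_bracket w u.
Proof.
by rewrite lie_bracketC lie_bracket_linearr opprD (lie_bracketC v) (lie_bracketC w) scalerN.
Qed.

(** Left translations preserve left-invariant fields, hence their brackets
    ([bracket_related]). *)
Lemma left_inv_bracket u v : left_inv (lie_bracket u v) = vf_bracket (left_inv u) (left_inv v).
Proof.
apply/funext => g; pose c := chart_at e; pose k := chart_at g.
have g1 := gmulg1 g.
pose T := cmap k \o gmul g \o cinv c.
have s := slice2_smooth_map (gmul_smooth G) g.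
pose D := cmap c @` (cdom c `&` gmul g @^-1` cdom k).
have oD : open D by apply: open_image_cdomI; apply: open_preimage; have [] := s.
have De : D (at_coord e).
  exists e => //; split; first exact: cdom_chart_at.
  by rewrite /= g1; exact: cdom_chart_at.
have Te : T (at_coord e) = at_coord g.
  rewrite /T /= /at_coord cmapK ?g1 //; exact: cdom_chart_at.
have Ds : D `<=` cimg c by move=> x /image_cdomIP[].
have rel w x : D x -> vf_coord k (left_inv w) (T x) = 'D_(vf_coord c (left_inv w) x) T x.
  move=> /image_cdomIP[xc xk].
  have [md E] := dfun_cmap_comp (gmull_mapdiff g (cinv c x)) xk.
  apply: etrans (vf_coord_cmap (left_inv w) xk) _; rewrite left_inv_tmap.
  apply: etrans (esym (E _)) _.
  by apply: etrans (dfun_chart _ (cinv_dom xc) md) _; rewrite cinvK.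
have B := bracket_related oD (open_cimg k) De (D' := cimg k) (T := T) _ (s.2 c k)
  (smooth_on_sub Ds ((vfieldP _).1 (left_inv_vfield u) c))
  (smooth_on_sub Ds ((vfieldP _).1 (left_inv_vfield v) c))
  ((vfieldP _).1 (left_inv_vfield u) k) ((vfieldP _).1 (left_inv_vfield v) k) (rel u) (rel v).
apply: etrans _ (esym (vf_bracketE _ _ _)); rewrite -/k -Te.
apply: etrans _ (esym (B _)).
  rewrite -vf_bracketE /left_inv /tmap /dfun g1; exact: erefl.
by move=> x /image_cdomIP[xc xk]; exact: cimg_cmap.
Qed.

(** Jacobi identity of vector fields, since brackets of left-invariant fields
    are left-invariant. *)
Lemma lie_jacobi u v w :
  lie_bracket u (lie_bracket v w) =
  lie_bracket (lie_bracket u v) w + lie_bracket v (lie_bracket u w).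
Proof.
apply: etrans (congr1 (fun Z => vf_bracket (left_inv u) Z e) (left_inv_bracket v w)) _.
apply: etrans (vf_jacobi e (left_inv_vfield u) (left_inv_vfield v) (left_inv_vfield w)) _.
apply: esym; apply: congr2.
  exact: (congr1 (fun Z => vf_bracket Z (left_inv w) e) (left_inv_bracket u v)).
exact: (congr1 (fun Z => vf_bracket (left_inv v) Z e) (left_inv_bracket u w)).
Qed.

(** The hypothesis says that a(g) = Ad_g v.  With mu the multiplication in
    coordinates at the identity, it reads D_(0, v) mu (x, e) = D_(a x, 0) mu (e, x).
    Differentiating along u at e gives
      D_(u, 0) D_(0, v) mu = D_(0, u) D_(v, 0) mu + D_u a,
    as mu (x, e) = x; by the symmetry of second derivatives D_u a is the
    antisymmetrized mixed derivative of mu, which is the bracket of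
    left-invariant fields at e. *)
Lemma dfun_adjoint (a : G -> lie_of R G) u v : mdiff a e ->
  (forall g, tmap (fun h : G => gmul h g) e (a g) = left_inv v g) ->
  dfun a e u = lie_bracket u v.
Proof.
move=> da aE; pose c := chart_at e; pose x0 := at_coord e.
pose mu := chart2 (gmul (l:=G)) c c c; pose D := chart2_dom (gmul (l:=G)) c c c.
have ce : cdom c e by exact: cdom_chart_at.
have xc : cimg c x0 by exact: cimg_at.
have ex0 : cinv c x0 = e by rewrite /x0 /at_coord cmapK.
have mus : smooth_on D mu := chart2_smooth (gmul_smooth G) c c c.
have oD : open D := open_chart2_dom (gmul_smooth G).1.
have Dx0 : D (x0, x0) by split => //=; rewrite ex0 gmulg1.
have ae : a e = v by have := aE e; rewrite gmulr1E tmap_id left_inv1.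
pose al := a \o cinv c.
have left w x : cimg c x -> vf_coord c (left_inv w) x = 'D_(0, w) mu (x, x0).
  exact: vf_coord_left_inv.
(* the inclusion y |-> (y, 0), in the form required by derive_derive_along *)
pose emb (y : lie_of R G) : lie_of R G * lie_of R G := \sum_i y 0 i *: (delta_mx 0 i, 0).
have embE y : emb y = (y, 0).
  rewrite /emb {2}[y]row_sum_delta; apply: injective_projections => /=.
    by rewrite (raddf_sum fst).
  by rewrite (raddf_sum snd) big1 // => i _ /=; rewrite scaler0.
have right x : cimg c x -> vf_coord c (left_inv v) x = 'D_(al x, 0) mu (x0, x).
  move=> xi; have kx : cdom c (gmul e (cinv c x)) by rewrite gmul1; exact: cinv_dom.
  apply: etrans _ (tmap_slice1_cinv (gmul_smooth G) (al x) xi kx).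
  by rewrite gmul1 aE.
have d1 w z : 'D_w (vf_coord c (left_inv z)) x0 = 'D_(w, 0) ('D_(0, z) mu) (x0, x0).
  apply: etrans _ (derive_slice1 _ _ _ _).
  by apply: (eq_derive_on _ (open_cimg c) xc) => x xi; exact: left.
(* a as a function on the product, depending on the second variable only *)
have dal2 : differentiable (fun p : lie_of R G * lie_of R G => al p.2) (x0, x0) /\
   'D_(0, u) (fun p : lie_of R G * lie_of R G => al p.2) (x0, x0) = dfun a e u.
  have dal : differentiable al x0 by exact: da.
  have ds : differentiable (snd : lie_of R G * lie_of R G -> lie_of R G) (x0, x0).
    by apply: lin_differentiable => // p; exact: cvg_snd.
  split; first exact: (differentiable_comp ds dal).
  apply: etrans (derive_comp (0, u) ds dal) _.
  have -> : 'D_(0, u) (snd : lie_of R G * lie_of R G -> lie_of R G) (x0, x0) = u.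
    by apply: derive_lin => // p; exact: cvg_snd.
  by [].
have d2 : 'D_u (vf_coord c (left_inv v)) x0 = 'D_(0, u) ('D_(v, 0) mu) (x0, x0) + dfun a e u.
  have E1 : 'D_u (vf_coord c (left_inv v)) x0 =
      'D_(0, u) (fun p => 'D_(\sum_i al p.2 0 i *: (delta_mx 0 i, 0)) mu p) (x0, x0).
    apply: etrans _ (derive_slice2 _ _ _ _).
    apply: (eq_derive_on _ (open_cimg c) xc) => x xi /=.
    by rewrite -/(emb (al x)) embE; exact: right.
  apply: etrans E1 _.
  apply: etrans (derive_derive_along _ _ oD Dx0 mus dal2.1) _.
  have alv : \sum_i al x0 0 i *: (delta_mx 0 i, 0) = (v, 0) :> lie_of R G * lie_of R G.
    by rewrite -[LHS]/(emb (al x0)) embE /al /= ex0 ae.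
  apply: congr2; first exact: (congr1
    (fun w : lie_of R G * lie_of R G => 'D_(0, u) ('D_w mu) (x0, x0)) alv).
  rewrite dal2.2; apply: etrans (congr1
    (fun w : lie_of R G * lie_of R G => 'D_w mu (x0, x0)) (embE (dfun a e u))) _.
  apply: etrans (esym (derive_slice1 _ _ _ _)) _.
  apply: etrans (derive_cmap_cinv (dfun a e u) xc).
  have -> // : (fun x => mu (x, x0)) = cmap c \o cinv c.
  by apply/funext => x; rewrite /mu /chart2 /= ex0 gmulg1.
have S := schwarz (v, 0) (0, u) oD Dx0 mus.
have bE : lie_bracket u v = 'D_u (vf_coord c (left_inv v)) x0 - 'D_v (vf_coord c (left_inv u)) x0.
  by rewrite /lie_bracket /vf_bracket !left_inv1.
have key (p q r : lie_of R G) : q = p -> p + r - q = r.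
  by move=> ->; rewrite addrAC subrr add0r.
apply: esym; apply: etrans bE _; apply: etrans (congr2 (fun x y => x - y) d2 (d1 v u)) _.
exact: key S.
Qed.

End LieGroup.

(** * The differential of a crossed module *)

Section CrossedModule.
Variables (R : realType) (G : crossed_module R).
Local Notation H1 := (H1 G).
Local Notation H0 := (H0 G).
Local Notation e1 := (gone H1).
Local Notation e0 := (gone H0).
Implicit Types (g : H0) (h : H1) (u v : h0 R G) (m n : h1 R G).

Lemma Psi1 : Psi e1 = e0 :> H0.
Proof. by apply: gmul_idem; rewrite -Psi_morph gmul1. Qed.

Lemma Phi1 g : Phi g e1 = e1.
Proof. by apply: gmul_idem; rewrite -Phi_morph gmul1. Qed.

Lemma Psi_mapdiff h : mapdiff (@Psi R G) h.
Proof. exact: smooth_map_mapdiff (Psi_smooth G). Qed.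

Lemma Phi_mapdiff g h : mapdiff (Phi g) h.
Proof. exact: smooth_map_mapdiff (slice2_smooth_map (Phi_smooth G) g). Qed.

(** The representation of the group H0 on h1 of which [dPhi] is the derivative. *)
Definition Phi_rep g m : h1 R G := tmap (Phi g) e1 m.

Lemma Phi_rep_linear g : linear (Phi_rep g).
Proof. exact: tmap_linear (Phi_mapdiff g e1). Qed.

Lemma Phi_rep_smooth m : smooth_fun (fun g => Phi_rep g m).
Proof. exact: (@tmap_fixed_smooth _ _ _ _ _ (Phi_smooth G) e1 e1 m Phi1). Qed.

Lemma Phi_rep_mdiff m g : mdiff (fun g => Phi_rep g m) g.
Proof. exact: smooth_fun_mdiff (Phi_rep_smooth m). Qed.

Lemma Phi_rep_mul g g' m : Phi_rep (gmul g g') m = Phi_rep g (Phi_rep g' m).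
Proof.
rewrite /Phi_rep.
have -> : Phi (gmul g g') = Phi g \o Phi g' by apply/funext => h /=; rewrite Phi_mul.
apply: etrans (tmap_comp m (Phi_mapdiff g' e1) (Phi_mapdiff g _)) _.
by rewrite Phi1.
Qed.

Lemma dPsi_linear : linear (@dPsi R G).
Proof. exact: tmap_linear (Psi_mapdiff e1). Qed.

Lemma dPhi_linearl m : linear (fun u => dPhi u m).
Proof. exact: dfun_linear (Phi_rep_mdiff m e0). Qed.

Lemma dPhi_linearr u : linear (dPhi u).
Proof.
move=> a m n; rewrite /dPhi.
have -> : (fun g => tmap (Phi g) e1 (a *: m + n)) =
    (fun g => a *: Phi_rep g m + Phi_rep g n).
  by apply/funext => g; exact: Phi_rep_linear.
exact: derive_linear_comb (Phi_rep_mdiff m e0) (Phi_rep_mdiff n e0).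
Qed.

(** Phi_rep (g h) m = Phi_rep g (Phi_rep h m) is differentiated in h at the
    identity, along u. *)
Lemma lie_deriv_Phi_rep u m g :
  lie_deriv (left_inv u) (fun g => Phi_rep g m) g = Phi_rep g (dPhi u m).
Proof.
have md := Phi_rep_mdiff m (gmul g e0).
have [_ E] := dfun_comp (gmull_mapdiff g e0) md.
have g1 : gmul g e0 = g by exact: gmulg1.
have E1 := E u; rewrite g1 in E1.
apply: etrans (esym E1) _.
have -> : (fun g => Phi_rep g m) \o gmul g = (fun g' => Phi_rep g (Phi_rep g' m)).
  by apply/funext => g' /=; exact: Phi_rep_mul.
exact: dfun_lin (Phi_rep_linear g) (row_continuous (Phi_rep_linear g)) (Phi_rep_mdiff m e0).
Qed.

Lemma Phi_rep1 m : Phi_rep e0 m = m.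
Proof.
rewrite /Phi_rep.
have -> : Phi e0 = (fun h : H1 => h) by apply/funext => h; exact: Phi_one.
exact: tmap_id.
Qed.

(** [lie_deriv_Phi_rep] turns the commutator of left-invariant derivatives of
    g |-> Phi_rep g m into that of dPhi u and dPhi v. *)
Lemma dPhi_bracket u v m : dPhi (lie_bracket u v) m = dPhi u (dPhi v m) - dPhi v (dPhi u m).
Proof.
have E := lie_deriv_bracket e0 (left_inv_vfield u) (left_inv_vfield v) (Phi_rep_smooth m).
have L x y : lie_deriv (left_inv x) (lie_deriv (left_inv y) (fun g => Phi_rep g m)) e0 =
    dPhi x (dPhi y m).
  have -> : lie_deriv (left_inv y) (fun g => Phi_rep g m) = (fun g => Phi_rep g (dPhi y m)).
    by apply/funext => g; exact: lie_deriv_Phi_rep.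
  by apply: etrans (lie_deriv_Phi_rep _ _ _) _; exact: Phi_rep1.
have D : dPhi (lie_bracket u v) m =
    lie_deriv (vf_bracket (left_inv u) (left_inv v)) (fun g => Phi_rep g m) e0 by exact: erefl.
apply: etrans D _; apply: etrans E _; apply: congr2; first exact: L.
by apply: congr1; exact: L.
Qed.

(** Psi (Phi_g h) g = g Psi (h) says that g |-> dPsi (Phi_rep g m) satisfies the
    hypothesis of [dfun_adjoint] with v = dPsi m. *)
Lemma dPsi_dPhi u m : dPsi (dPhi u m) = lie_bracket u (dPsi m).
Proof.
have dl := dPsi_linear.
apply: etrans (esym (dfun_lin u dl (row_continuous dl) (Phi_rep_mdiff m e0))) _.
apply: dfun_adjoint.
  apply: differentiable_comp (Phi_rep_mdiff m e0) _.
  exact: lin_differentiable dl (row_continuous dl).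
move=> g.
have E : (fun k : H0 => gmul k g) \o @Psi R G \o Phi g = gmul g \o @Psi R G.
  by apply/funext => h /=; rewrite Psi_Phi -gmulA gmulV gmulg1.
have d1 := Phi_mapdiff g e1; have d2 := Psi_mapdiff (Phi g e1).
have d3 := gmulr_mapdiff g (Psi (Phi g e1)).
have E1 := tmap_comp m d1 (mapdiff_comp d2 d3).
have E2 := tmap_comp (Phi_rep g m) d2 d3.
have E3 := tmap_comp m (Psi_mapdiff e1) (gmull_mapdiff g (Psi e1)).
rewrite Phi1 Psi1 in E1 E2; rewrite Psi1 in E3.
apply: etrans (esym E2) _; apply: etrans (esym E1) _; apply: etrans _ E3.
by rewrite -E.
Qed.

(** Phi_(Psi h) (h') h = h h' says that h |-> Phi_rep (Psi h) n satisfies the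
    hypothesis of [dfun_adjoint] with v = n. *)
Lemma dPhi_dPsi m n : dPhi (dPsi m) n = lie_bracket m n.
Proof.
have [md E] := dfun_comp (Psi_mapdiff e1) (Phi_rep_mdiff n (Psi e1)).
have E0 := E m; rewrite Psi1 in E0.
apply: etrans (esym E0) _; apply: dfun_adjoint; first exact: md.
move=> h.
have E1 : (fun k : H1 => gmul k h) \o Phi (Psi h) = gmul h.
  by apply/funext => h' /=; rewrite Phi_Psi -gmulA gmulV gmulg1.
have E2 := tmap_comp n (Phi_mapdiff (Psi h) e1) (gmulr_mapdiff h (Phi (Psi h) e1)).
rewrite Phi1 in E2.
by apply: etrans (esym E2) _; rewrite E1.
Qed.

Lemma dPhi_dPsi_skew m n : dPhi (dPsi m) n = - dPhi (dPsi n) m.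
Proof.
apply: etrans (dPhi_dPsi m n) _; apply: etrans (lie_bracketC m n) _.
by apply: congr1; exact: esym (dPhi_dPsi n m).
Qed.

End CrossedModule.

(** * Trivial bundles and direct sums *)

Section Bundles.
Variables (R : realType) (M : manifold R).

Lemma trivial_vbundle n : is_vbundle (trivial_bundle M n).
Proof.
split.
- by move=> i; exact: openT.
- by move=> p; exists tt.
- by move=> i p _ a u v.
- by move=> i p _ v.
- by move=> i p _ v.
- by move=> i j e c k; exact: Ck_on_cst.
Qed.

Lemma smooth_fun_on_row n m (D : set M) (f : M -> 'rV[R]_n) (g : M -> 'rV[R]_m) : open D ->
  smooth_fun_on D f -> smooth_fun_on D g -> smooth_fun_on D (fun p => row_mx (f p) (g p)).
Proof.
move=> oD fs gs i.
have oi : open (cmap i @` (cdom i `&` D)) by exact: open_image_cdomI.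
pose L (a : 'rV[R]_n) : 'rV[R]_(n + m) := row_mx a 0.
pose L' (a : 'rV[R]_m) : 'rV[R]_(n + m) := row_mx 0 a.
have Ll : linear L by move=> a u v; rewrite /L scale_row_mx add_row_mx scaler0 addr0.
have Ll' : linear L' by move=> a u v; rewrite /L' scale_row_mx add_row_mx scaler0 addr0.
have s1 := smooth_on_lin oi Ll (row_continuous Ll) (fs i).
have s2 := smooth_on_lin oi Ll' (row_continuous Ll') (gs i).
apply: (eq_smooth_on oi _ (smooth_onD oi s1 s2)) => q _ /=.
by rewrite /L /L' add_row_mx addr0 add0r.
Qed.

Lemma sum_vbundle (E F : vbundle M) : is_vbundle E -> is_vbundle F ->
  is_vbundle (sum_bundle E F).
Proof.
move=> hE hF; split=> /=.
- by move=> i; apply: openI; [exact: tdom_open hE _|exact: tdom_open hF _].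
- move=> p; have [i ip] := tdom_cover hE p; have [j jp] := tdom_cover hF p.
  by exists (i, j).
- move=> i p [ip jp] a u v /=.
  by rewrite (tri_linear hE ip) (tri_linear hF jp) scale_row_mx add_row_mx.
- by move=> i p [ip jp] [u v] /=; rewrite row_mxKl row_mxKr (triK hE ip) (triK hF jp).
- by move=> i p [ip jp] v /=; rewrite (trinvK hE ip) (trinvK hF jp) hsubmxK.
- move=> i j e; apply: smooth_fun_on_row.
  + by do 2!apply: openI; first [exact: tdom_open hE _|exact: tdom_open hF _].
  + apply: smooth_fun_on_sub (tri_transition hE i.1 j.1 (lsubmx e)).
    by move=> p [[ip _] [jp _]].
  + apply: smooth_fun_on_sub (tri_transition hF i.2 j.2 (rsubmx e)).
    by move=> p [[_ ip] [_ jp]].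
Qed.

End Bundles.

(** * Linear maps between modules *)

Section LinearMaps.
Variables (R : realType) (V W : lmodType R) (f : V -> W).
Hypothesis fl : linear f.

Lemma linD u v : f (u + v) = f u + f v.
Proof. by have := fl 1 u v; rewrite !scale1r. Qed.

Lemma lin0 : f 0 = 0.
Proof. by apply: (addrI (f 0)); rewrite -linD !addr0. Qed.

Lemma linZ a u : f (a *: u) = a *: f u.
Proof. by have := fl a u 0; rewrite lin0 !addr0. Qed.

Lemma linN u : f (- u) = - f u.
Proof. by rewrite -scaleN1r linZ scaleN1r. Qed.

Lemma linB u v : f (u - v) = f u - f v.
Proof. by rewrite linD linN. Qed.

Lemma linN_alternating a b c d e g :
  f (- (a - b + c - d + e - g)) = - f a + f b - f c + f d - f e + f g.
Proof. by rewrite linN !(linB, linD) !opprD !opprK. Qed.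

End LinearMaps.

(** * The Lie 2-algebra of a connection *)

Section Connection.
Variables (R : realType) (G : crossed_module R) (M : manifold R).
Variables (A : M -> tvec R M -> h0 R G) (B : M -> tvec R M -> tvec R M -> h1 R G).
Hypotheses (hA : is_form1 A) (hB : is_form2 B).

Local Notation sec0 := (M -> fib (bundle0 G M)).
Local Notation sec1 := (M -> h1 R G).
Implicit Types (x y z w : sec0) (m n : sec1) (f : M -> R) (p : M).
Local Notation smooth0 := (smooth_section (E := bundle0 G M)).
Implicit Types u v : h0 R G.
Local Notation br := (@lie_bracket R (H0 G)).
Local Notation phi := (@dPhi R G).
Local Notation psi := (@dPsi R G).

Lemma br_linearl u : linear (br^~ u).
Proof. by move=> a v k; exact: lie_bracket_linearl. Qed.

Lemma br_linearr u : linear (br u).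
Proof. by move=> a v k; exact: lie_bracket_linearr. Qed.

Lemma phi_linearl (m : h1 R G) : linear (phi^~ m).
Proof. exact: dPhi_linearl. Qed.

Lemma phi_linearr u : linear (phi u).
Proof. exact: dPhi_linearr. Qed.

Lemma phiDl u v (m : h1 R G) : phi (u + v) m = phi u m + phi v m.
Proof. exact: linD (phi_linearl m) u v. Qed.

Lemma phiBl u v (m : h1 R G) : phi (u - v) m = phi u m - phi v m.
Proof. exact: linB (phi_linearl m) u v. Qed.

Lemma phiZl (a : R) u (m : h1 R G) : phi (a *: u) m = a *: phi u m.
Proof. exact: linZ (phi_linearl m) a u. Qed.

Lemma phiDr u (m n : h1 R G) : phi u (m + n) = phi u m + phi u n.
Proof. exact: linD (phi_linearr u) m n. Qed.

Lemma phiNr u (m : h1 R G) : phi u (- m) = - phi u m.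
Proof. exact: linN (phi_linearr u) m. Qed.

Lemma phiZr (a : R) u (m : h1 R G) : phi u (a *: m) = a *: phi u m.
Proof. exact: linZ (phi_linearr u) a m. Qed.

Lemma brDl u v (w : h0 R G) : br (u + v) w = br u w + br v w.
Proof. exact: linD (br_linearl w) u v. Qed.

Lemma brDr u v (w : h0 R G) : br u (v + w) = br u v + br u w.
Proof. exact: linD (br_linearr u) v w. Qed.

Lemma brBr u v (w : h0 R G) : br u (v - w) = br u v - br u w.
Proof. exact: linB (br_linearr u) v w. Qed.

Lemma brZr (a : R) u v : br u (a *: v) = a *: br u v.
Proof. exact: linZ (br_linearr u) a v. Qed.

Lemma br_bilinear : cont_bilinear br.
Proof. by apply: row_cont_bilinear; [exact: br_linearr|exact: br_linearl]. Qed.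

Lemma phi_bilinear : cont_bilinear phi.
Proof. by apply: row_cont_bilinear; [exact: phi_linearr|exact: phi_linearl]. Qed.

Lemma A_linear p : linear (A p).
Proof. exact: (form1_linear hA). Qed.

Lemma B_linearl p (v : tvec R M) : linear (B p ^~ v).
Proof. exact: (form2_linearl hB). Qed.

Lemma B_linearr p (v : tvec R M) : linear (B p v).
Proof. exact: (form2_linearr hB). Qed.

Lemma BC p (u v : tvec R M) : B p u v = - B p v u.
Proof.
have := form2_alternating hB p (u + v).
rewrite (linD (B_linearr _ _)) !(linD (B_linearl _ _)) !(form2_alternating hB) addr0 add0r.
by move/eqP; rewrite addrC addr_eq0 => /eqP.
Qed.

(** The component along M x h0 for the splitting of TM + (M x h0) in which TM
    is embedded by X |-> X - A(X). *)
Definition vert x : M -> h0 R G := fun p => hpart x p + A p (vpart x p).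

Definition evB x y : sec1 := ev2 B (vpart x) (vpart y).

Local Notation l200' := (conn_l200 A B).
Local Notation nabla := (conn_l201 A).
Local Notation l3' := (conn_l3 A B).

Lemma smooth0P x : smooth0 x <-> vfield (vpart x) /\ smooth_fun (hpart x).
Proof.
have rl (l k : nat) : linear (lsubmx : 'rV[R]_(l + k) -> 'rV[R]_l).
  by move=> a u v; exact: linearP.
have rr (l k : nat) : linear (rsubmx : 'rV[R]_(l + k) -> 'rV[R]_k).
  by move=> a u v; exact: linearP.
split=> [H|[Xs us] [i []]].
  split=> [i j|].
    have oD : open (cmap j @` (cdom j `&` cdom i)) by exact: open_overlap.
    have := H (i, tt) j; rewrite /= setIT => Hj.
    have := smooth_on_lin oD (rl _ _) (row_continuous (rl _ _)) Hj.
    by apply: eq_smooth_on => // q _ /=; rewrite row_mxKl.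
  apply: smooth_fun_cover => i j.
  have oD : open (cmap j @` (cdom j `&` cdom i)) by exact: open_overlap.
  have := H (i, tt) j; rewrite /= setIT => Hj.
  have := smooth_on_lin oD (rr _ _) (row_continuous (rr _ _)) Hj.
  by apply: eq_smooth_on => // q _ /=; rewrite row_mxKr.
rewrite /= setIT.
apply: (smooth_fun_on_row (open_dom i) (Xs i)).
exact: smooth_fun_on_sub us.
Qed.

Lemma smooth0_vf x : smooth0 x -> vfield (vpart x).
Proof. by move=> /smooth0P[]. Qed.

Lemma vert_smooth x : smooth0 x -> smooth_fun (vert x).
Proof.
move=> /smooth0P[Xs us]; apply: smooth_funD => //.
exact: form1_smooth hA _ Xs.
Qed.

Lemma evB_smooth x y : smooth0 x -> smooth0 y -> smooth_fun (evB x y).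
Proof. by move=> /smooth0_vf xs /smooth0_vf ys; exact: form2_smooth hB _ _ xs ys. Qed.

Lemma section_eq x y : (forall p, vpart x p = vpart y p) ->
  (forall p, vert x p = vert y p) -> x = y.
Proof.
move=> E1 E2; apply/funext => p; apply: injective_projections; first exact: E1.
have := E2 p; rewrite /vert E1; exact: addIr.
Qed.

Lemma psi_smooth m : smooth_fun m -> smooth_fun (fun p => psi (m p)).
Proof.
move=> ms; exact: (smooth_fun_lin (@dPsi_linear R G) (row_continuous (@dPsi_linear R G)) ms).
Qed.

(** The terms of fcurv that involve A are exactly those produced by replacing
    u, v by u + A(X), v + A(Y) in the untwisted bracket; only - psi B is left. *)
Lemma vert_l200 x y p : smooth0 x -> smooth0 y ->
  vert (l200' x y) p = lie_deriv (vpart x) (vert y) p - lie_deriv (vpart y) (vert x) p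
    + br (vert x p) (vert y p) - psi (evB x y p).
Proof.
move=> xs ys; have [Xs us] := (smooth0P x).1 xs; have [Ys vs] := (smooth0P y).1 ys.
have Ax := form1_smooth hA Xs; have Ay := form1_smooth hA Ys.
have d (k l : M -> h0 R G) : smooth_fun k -> smooth_fun l -> forall Z,
   lie_deriv Z (fun p => k p + l p) p = lie_deriv Z k p + lie_deriv Z l p.
  by move=> fs gs Z; apply: dfunD; exact: smooth_fun_mdiff.
rewrite /vert (d _ _ us Ax) (d _ _ vs Ay) /conn_l200 /vpart /hpart /=.
rewrite brDl !brDr /fcurv /ext_d1 /= scalerA mulVf ?scale1r; last first.
  by rewrite pnatr_eq0.
rewrite /ev1 /ev2 (lie_bracketC (A p (y p).1)).
have key (a b c d' e' f' g h k l : h0 R G) :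
  a + b - c - - d' + (e' - f' - g + h - k) + l + g =
  a + e' - (c + f') + (l + d' + (b + h)) - k.
  by apply/rowP => i; rewrite !mxE; ring.
exact: key.
Qed.

Lemma nablaE x m p : nabla x m p = lie_deriv (vpart x) m p + phi (vert x p) (m p).
Proof.
have key (a b c d : h1 R G) : d = c + b -> a + b + c = a + d.
  by move=> ->; rewrite addrA addrAC.
exact: key (linD (phi_linearl (m p)) (hpart x p) (A p (vpart x p))).
Qed.

Lemma nabla_smooth x m : smooth0 x -> smooth_fun m -> smooth_fun (nabla x m).
Proof.
move=> xs ms; have -> : nabla x m = (fun p => lie_deriv (vpart x) m p + phi (vert x p) (m p)).
  by apply/funext => p; exact: nablaE.
apply: smooth_funD; first by apply: lie_deriv_smooth => //; exact: smooth0_vf.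
by apply: smooth_fun_bilin phi_bilinear _ ms; exact: vert_smooth.
Qed.

Lemma nabla_linear x (a : R) m n p : smooth_fun m -> smooth_fun n ->
  nabla x (fun q => a *: m q + n q) p = a *: nabla x m p + nabla x n p.
Proof.
move=> ms ns; rewrite !nablaE phiDr phiZr.
have -> : lie_deriv (vpart x) (fun q => a *: m q + n q) p =
    a *: lie_deriv (vpart x) m p + lie_deriv (vpart x) n p.
  by apply: derive_linear_comb; exact: smooth_fun_mdiff.
by rewrite scalerDr addrACA.
Qed.

Lemma nablaN x m p : smooth_fun m -> nabla x (fun q => - m q) p = - nabla x m p.
Proof.
move=> ms; rewrite !nablaE phiNr opprD; congr (_ + _).
by apply: dfunN; exact: smooth_fun_mdiff.
Qed.

Lemma nablaD x m n p : smooth_fun m -> smooth_fun n ->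
  nabla x (fun q => m q + n q) p = nabla x m p + nabla x n p.
Proof.
move=> ms ns; rewrite !nablaE phiDr.
have -> : lie_deriv (vpart x) (fun q => m q + n q) p =
    lie_deriv (vpart x) m p + lie_deriv (vpart x) n p.
  by apply: dfunD; exact: smooth_fun_mdiff.
by rewrite addrACA.
Qed.

Lemma nablaB x m n p : smooth_fun m -> smooth_fun n ->
  nabla x (fun q => m q - n q) p = nabla x m p - nabla x n p.
Proof. by move=> ms ns; rewrite nablaD ?nablaN //; exact: smooth_funN. Qed.

Lemma nabla_scale x f m p : smooth_fun f -> smooth_fun m ->
  nabla x (fscale f m) p = f p *: nabla x m p + lie_deriv (vpart x) f p *: m p.
Proof.
move=> fs ms; rewrite !nablaE phiZr.
have -> : lie_deriv (vpart x) (fscale f m) p =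
    lie_deriv (vpart x) f p *: m p + f p *: lie_deriv (vpart x) m p.
  by apply: dfun_scale; exact: smooth_fun_mdiff.
have key (a b : R) (u v l : h1 R G) : a *: u + b *: v + b *: l = b *: (v + l) + a *: u.
  by rewrite scalerDr -addrA addrC.
exact: key.
Qed.

(** All terms of the untwisted action cancel, because phi is a representation
    ([dPhi_bracket]); the part - psi B of the bracket remains. *)
Lemma nabla_curvature x y m p : smooth0 x -> smooth0 y -> smooth_fun m ->
  nabla x (nabla y m) p - nabla (l200' x y) m p - nabla y (nabla x m) p =
  phi (psi (evB x y p)) (m p).
Proof.
move=> xs ys ms; have Xs := smooth0_vf xs; have Ys := smooth0_vf ys.
have E (x' y' : sec0) (x's : smooth0 x') (y's : smooth0 y') : nabla x' (nabla y' m) p =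
    lie_deriv (vpart x') (lie_deriv (vpart y') m) p
    + (phi (lie_deriv (vpart x') (vert y') p) (m p) + phi (vert y' p) (lie_deriv (vpart x') m p))
    + (phi (vert x' p) (lie_deriv (vpart y') m p) + phi (vert x' p) (phi (vert y' p) (m p))).
  rewrite nablaE nablaE phiDr; congr (_ + _).
  have -> : nabla y' m = (fun q => lie_deriv (vpart y') m q + phi (vert y' q) (m q)).
    by apply/funext => q; exact: nablaE.
  have ty := vert_smooth y's; have Y's := smooth0_vf y's.
  have d1 := smooth_fun_mdiff p (lie_deriv_smooth Y's ms).
  have d2 := smooth_fun_mdiff p (smooth_fun_bilin phi_bilinear ty ms).
  apply: etrans (dfunD _ d1 d2) _; congr (_ + _).
  exact: dfun_bilin phi_bilinear (smooth_fun_mdiff p ty) (smooth_fun_mdiff p ms).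
have E2 : nabla (l200' x y) m p =
    lie_deriv (vpart x) (lie_deriv (vpart y) m) p
    - lie_deriv (vpart y) (lie_deriv (vpart x) m) p
    + (phi (lie_deriv (vpart x) (vert y) p) (m p) - phi (lie_deriv (vpart y) (vert x) p) (m p)
      + (phi (vert x p) (phi (vert y p) (m p)) - phi (vert y p) (phi (vert x p) (m p)))
      - phi (psi (evB x y p)) (m p)).
  apply: etrans (nablaE _ _ _) _; apply: congr2; first exact: lie_deriv_bracket.
  apply: etrans (congr1 (fun u => phi u (m p)) (vert_l200 p xs ys)) _.
  apply: etrans (phiBl _ _ _) _; apply: congr2; last by [].
  apply: etrans (phiDl _ _ _) _; apply: congr2; last exact: dPhi_bracket.
  exact: phiBl.
rewrite (E x y xs ys) (E y x ys xs) E2.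
have key (a b c d' e' f' g h q : h1 R G) :
  a + (b + c) + (d' + e') - (a - f' + (b - g + (e' - h) - q))
  - (f' + (g + d') + (c + h)) = q.
  by apply/rowP => i; rewrite !mxE; ring.
exact: key.
Qed.

Lemma evBC x y p : evB x y p = - evB y x p.
Proof. exact: BC. Qed.

(** The covariant exterior derivative of B for the action [nabla].  Only the TM
    component of the brackets matters, as B is a form on M. *)
Definition covdB x y z p := nabla x (evB y z) p - nabla y (evB x z) p + nabla z (evB x y) p
  - evB (l200' x y) z p + evB (l200' x z) y p - evB (l200' y z) x p.

(** The terms of l3 in u, v, w and the terms of curv in A combine into the
    action of u + A(X), v + A(Y), w + A(Z). *)
Lemma conn_l3E x y z p : l3' x y z p = - covdB x y z p.
Proof.
rewrite /conn_l3 /covdB !nablaE /curv /ext_d2 /vert /= !phiDl.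
have zx (u : h0 R G) : phi u (ev2 B (vpart z) (vpart x) p) = - phi u (evB x z p).
  by rewrite -phiNr /evB /ev2 BC.
rewrite !zx.
have key (a b c d' e' f' g h k l q r : h1 R G) :
  - (a - b + c - d' + e' - f' + (g + - h + k)) + - l + - q + - - r =
  - (a + (q + g) - (b + (r + h)) + (c + (l + k)) - d' + e' - f').
  by apply/rowP => i; rewrite !mxE; ring.
exact: key.
Qed.

Lemma conn_l200_smooth x y : smooth0 x -> smooth0 y -> smooth0 (l200' x y).
Proof.
move=> xs ys; have Xs := smooth0_vf xs; have Ys := smooth0_vf ys.
have vs : vfield (vpart (l200' x y)) by exact: vf_bracket_vfield.
apply/smooth0P; split=> //.
have -> : hpart (l200' x y) = (fun p =>
    (lie_deriv (vpart x) (vert y) p - lie_deriv (vpart y) (vert x) p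
    + br (vert x p) (vert y p) - psi (evB x y p)) - A p (vpart (l200' x y) p)).
  apply/funext => p; rewrite -(vert_l200 p xs ys) /vert.
  by apply: esym; exact: addrK.
have sx := vert_smooth xs; have sy := vert_smooth ys.
apply: smooth_funB; last exact: form1_smooth hA _ vs.
apply: smooth_funB; last exact: psi_smooth (evB_smooth xs ys).
apply: smooth_funD; last exact: smooth_fun_bilin br_bilinear sx sy.
by apply: smooth_funB; exact: lie_deriv_smooth.
Qed.

Lemma smooth0_linear (a : R) x y : smooth0 x -> smooth0 y -> smooth0 (a *: x + y).
Proof.
move=> /smooth0P[Xs us] /smooth0P[Ys vs]; apply/smooth0P; split.
  exact: (@vfield_linear R M a _ _ Xs Ys).
apply: (@smooth_funD _ _ _ (fun p => a *: hpart x p) (hpart y)) => //.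
by apply: smooth_fun_scale => //; exact: smooth_fun_cst.
Qed.

Lemma smooth0_0 : smooth0 0.
Proof.
apply/smooth0P; split; last exact: smooth_fun_cst.
apply/vfieldP => i; apply: (eq_smooth_on (open_cimg i) _ (smooth_on_cst _ 0)) => q _.
by apply: esym; exact: derive0.
Qed.

Lemma vert_linear (a : R) x y p : vert (a *: x + y) p = a *: vert x p + vert y p.
Proof.
have key (u v k l : h0 R G) : a *: u + v + (a *: k + l) = a *: (u + k) + (v + l).
  by rewrite scalerDr addrACA.
apply: etrans (congr1 (+%R (hpart (a *: x + y) p)) (A_linear p a (vpart x p) (vpart y p))) _.
exact: key.
Qed.

Lemma vertN x p : vert (- x) p = - vert x p.
Proof.
apply: etrans (congr1 (+%R (hpart (- x) p)) (linN (A_linear p) (vpart x p))) _.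
exact: esym (opprD _ _).
Qed.

Lemma vertB x y p : vert (x - y) p = vert x p - vert y p.
Proof.
have -> : x - y = 1 *: x + (- y) by rewrite scale1r.
by rewrite vert_linear scale1r vertN.
Qed.

Lemma vert_scale f x p : vert (fscale f x) p = f p *: vert x p.
Proof.
apply: etrans (congr1 (+%R (hpart (fscale f x) p)) (linZ (A_linear p) (f p) (vpart x p))) _.
exact: esym (scalerDr _ _ _).
Qed.

Lemma evB_linearr (a : R) x y z p : evB x (a *: y + z) p = a *: evB x y p + evB x z p.
Proof. exact: (B_linearr p (vpart x p) a (vpart y p) (vpart z p)). Qed.

Lemma evB_linearl (a : R) x y z p : evB (a *: y + z) x p = a *: evB y x p + evB z x p.
Proof. exact: (B_linearl p (vpart x p) a (vpart y p) (vpart z p)). Qed.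

Lemma evB_scalel f x y p : evB (fscale f x) y p = f p *: evB x y p.
Proof. exact: (linZ (B_linearl p (vpart y p)) (f p) (vpart x p)). Qed.

Lemma evB_scaler f x y p : evB x (fscale f y) p = f p *: evB x y p.
Proof. exact: (linZ (B_linearr p (vpart x p)) (f p) (vpart y p)). Qed.

Lemma lie_deriv_vlin (W : normedModType R) (a : R) (X Y : M -> tvec R M)
    (F : M -> W) p : smooth_fun F ->
  lie_deriv (fun q => a *: X q + Y q) F p = a *: lie_deriv X F p + lie_deriv Y F p.
Proof. by move=> Fs; exact: (dfun_linear (smooth_fun_mdiff p Fs) a (X p) (Y p)). Qed.

Lemma lie_deriv_vscale (W : normedModType R) f (X : M -> tvec R M) (F : M -> W) p : smooth_fun F ->
  lie_deriv (fscale f X) F p = f p *: lie_deriv X F p.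
Proof. by move=> Fs; exact: (linZ (dfun_linear (smooth_fun_mdiff p Fs)) (f p) (X p)). Qed.

Lemma lie_deriv_lin (W : normedModType R) (a : R) (X : M -> tvec R M) (F H : M -> W) p :
  smooth_fun F -> smooth_fun H ->
  lie_deriv X (fun q => a *: F q + H q) p = a *: lie_deriv X F p + lie_deriv X H p.
Proof.
move=> Fs Hs.
exact: (derive_linear_comb a (X p) (smooth_fun_mdiff p Fs) (smooth_fun_mdiff p Hs)).
Qed.

Lemma conn_l200_linearr (a : R) x y z : smooth0 x -> smooth0 y -> smooth0 z ->
  l200' x (a *: y + z) = a *: l200' x y + l200' x z.
Proof.
move=> xs ys zs; have yzs := smooth0_linear a ys zs.
have Xs := smooth0_vf xs; have Ys := smooth0_vf ys; have Zs := smooth0_vf zs.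
apply: section_eq => p; first exact: vf_bracket_linearr.
have T : vert (a *: y + z) = (fun q => a *: vert y q + vert z q).
  by apply/funext => q; exact: vert_linear.
have E1 : lie_deriv (vpart x) (vert (a *: y + z)) p =
    a *: lie_deriv (vpart x) (vert y) p + lie_deriv (vpart x) (vert z) p.
  by rewrite T; exact: lie_deriv_lin (vert_smooth ys) (vert_smooth zs).
have E2 := lie_deriv_vlin a (vpart y) (vpart z) p (vert_smooth xs).
have E3 : br (vert x p) (vert (a *: y + z) p) =
    a *: br (vert x p) (vert y p) + br (vert x p) (vert z p).
  by rewrite vert_linear; exact: br_linearr.
have E4 : psi (evB x (a *: y + z) p) = a *: psi (evB x y p) + psi (evB x z p).
  by rewrite evB_linearr; exact: dPsi_linear.
apply: etrans (vert_l200 p xs yzs) _.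
apply: etrans (congr2 (fun u v : h0 R G => u - v)
  (congr2 (fun u v : h0 R G => u + v) (congr2 (fun u v : h0 R G => u - v) E1 E2) E3) E4) _.
apply: etrans _ (esym (vert_linear a (l200' x y) (l200' x z) p)).
apply: etrans _ (esym (congr2 (fun u v : h0 R G => a *: u + v)
  (vert_l200 p xs ys) (vert_l200 p xs zs))).
have key (b b' c c' d d' k k' : h0 R G) :
  a *: b + b' - (a *: c + c') + (a *: d + d') - (a *: k + k') =
  a *: (b - c + d - k) + (b' - c' + d' - k').
  by apply/rowP => i; rewrite !mxE; ring.
exact: key.
Qed.

Lemma conn_l200C x y : smooth0 x -> smooth0 y -> l200' x y = - l200' y x.
Proof.
move=> xs ys; apply: section_eq => p; first exact: vf_bracketC.
apply: etrans (vert_l200 p xs ys) _; apply: etrans _ (esym (vertN (l200' y x) p)).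
apply: etrans _ (congr1 -%R (esym (vert_l200 p ys xs))).
have E1 : br (vert y p) (vert x p) = - br (vert x p) (vert y p) by exact: lie_bracketC.
have E2 : psi (evB y x p) = - psi (evB x y p).
  by apply: etrans (congr1 psi (evBC y x p)) _; exact: (linN (@dPsi_linear R G)).
rewrite E1 E2.
have key (b c d k : h0 R G) : b - c + d - k = - (c - b + - d - - k).
  by apply/rowP => i; rewrite !mxE; ring.
exact: key.
Qed.

Lemma conn_l200_linearl (a : R) x y z : smooth0 x -> smooth0 y -> smooth0 z ->
  l200' (a *: y + z) x = a *: l200' y x + l200' z x.
Proof.
move=> xs ys zs; have yzs := smooth0_linear a ys zs.
rewrite (conn_l200C yzs xs) (conn_l200_linearr a xs ys zs) (conn_l200C ys xs) (conn_l200C zs xs).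
by rewrite opprD scalerN.
Qed.

Lemma nabla_linearl (a : R) x y m p : smooth_fun m ->
  nabla (a *: x + y) m p = a *: nabla x m p + nabla y m p.
Proof.
move=> ms; rewrite !nablaE.
have E1 := lie_deriv_vlin a (vpart x) (vpart y) p ms.
have E2 : phi (vert (a *: x + y) p) (m p) = a *: phi (vert x p) (m p) + phi (vert y p) (m p).
  by rewrite vert_linear; exact: phi_linearl.
apply: etrans (congr2 (fun u v : h1 R G => u + v) E1 E2) _.
have key (b b' c c' : h1 R G) : a *: b + b' + (a *: c + c') = a *: (b + c) + (b' + c').
  by rewrite scalerDr addrACA.
exact: key.
Qed.

Lemma nabla_scalel f x m p : smooth_fun m -> nabla (fscale f x) m p = f p *: nabla x m p.
Proof.
move=> ms; rewrite !nablaE scalerDr; apply: congr2; first exact: lie_deriv_vscale.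
by rewrite vert_scale phiZl.
Qed.

Lemma covdB_smooth x y z : smooth0 x -> smooth0 y -> smooth0 z -> smooth_fun (covdB x y z).
Proof.
move=> xs ys zs; have s200 := conn_l200_smooth.
apply: smooth_funB; last by apply: evB_smooth => //; exact: s200.
apply: smooth_funD; last by apply: evB_smooth => //; exact: s200.
apply: smooth_funB; last by apply: evB_smooth => //; exact: s200.
apply: smooth_funD; last by apply: nabla_smooth => //; exact: evB_smooth.
by apply: smooth_funB; apply: nabla_smooth => //; exact: evB_smooth.
Qed.

Lemma conn_l3_fun x y z : l3' x y z = (fun p => - covdB x y z p).
Proof. by apply/funext => p; exact: conn_l3E. Qed.

Lemma conn_l3_smooth x y z : smooth0 x -> smooth0 y -> smooth0 z -> smooth_fun (l3' x y z).
Proof. by move=> xs ys zs; rewrite conn_l3_fun; apply: smooth_funN; exact: covdB_smooth. Qed.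

Lemma nabla_evBC x y z p : smooth0 y -> smooth0 z -> nabla x (evB y z) p = - nabla x (evB z y) p.
Proof.
move=> ys zs; have -> : evB y z = (fun q => - evB z y q) by apply/funext => q; exact: evBC.
by apply: nablaN; exact: evB_smooth.
Qed.

Lemma evB_l200C x y z p : evB (l200' x y) z p = - evB (l200' y x) z p.
Proof.
have E : vf_bracket (vpart x) (vpart y) p = - vf_bracket (vpart y) (vpart x) p.
  exact: vf_bracketC.
have D : B p (vf_bracket (vpart x) (vpart y) p) (vpart z p) =
    - B p (vf_bracket (vpart y) (vpart x) p) (vpart z p).
  by rewrite E; exact: (linN (B_linearl p (vpart z p))).
exact: D.
Qed.

Lemma covdB_skew12 x y z p : smooth0 x -> smooth0 y -> smooth0 z ->
  covdB x y z p = - covdB y x z p.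
Proof.
move=> xs ys zs.
have key (a b c c' d d' k l : h1 R G) : c = - c' -> d = - d' ->
    a - b + c - d + k - l = - (b - a + c' - d' + l - k).
  by move=> -> ->; apply/rowP => i; rewrite !mxE; ring.
exact: key (nabla_evBC z p xs ys) (evB_l200C x y z p).
Qed.

Lemma covdB_skew23 x y z p : smooth0 x -> smooth0 y -> smooth0 z ->
  covdB x y z p = - covdB x z y p.
Proof.
move=> xs ys zs.
have key (a a' b c d k l l' : h1 R G) : a = - a' -> l = - l' ->
    a - b + c - d + k - l = - (a' - c + b - k + d - l').
  by move=> -> ->; apply/rowP => i; rewrite !mxE; ring.
exact: key (nabla_evBC x p ys zs) (evB_l200C y z x p).
Qed.

Lemma conn_l3_skew12 x y z : smooth0 x -> smooth0 y -> smooth0 z -> l3' x y z = - l3' y x z.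
Proof.
by move=> xs ys zs; apply/funext => p; rewrite !conn_l3_fun covdB_skew12.
Qed.

Lemma conn_l3_skew23 x y z : smooth0 x -> smooth0 y -> smooth0 z -> l3' x y z = - l3' x z y.
Proof.
by move=> xs ys zs; apply/funext => p; rewrite !conn_l3_fun covdB_skew23.
Qed.

Lemma covdB_linear (a : R) x x' y z p : smooth0 x -> smooth0 x' -> smooth0 y -> smooth0 z ->
  covdB (a *: x + x') y z p = a *: covdB x y z p + covdB x' y z p.
Proof.
move=> xs x's ys zs.
have F (u : sec0) : smooth0 u -> evB (a *: x + x') u = (fun q => a *: evB x u q + evB x' u q).
  by move=> us; apply/funext => q; exact: evB_linearl.
have N k (u : sec0) (us : smooth0 u) : nabla k (evB (a *: x + x') u) p =
    a *: nabla k (evB x u) p + nabla k (evB x' u) p.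
  by rewrite F //; apply: nabla_linear; exact: evB_smooth.
have D (u v : sec0) (us : smooth0 u) : evB (l200' (a *: x + x') u) v p =
    a *: evB (l200' x u) v p + evB (l200' x' u) v p.
  by rewrite conn_l200_linearl // evB_linearl.
have key (b b' b2 c c' c2 d d' d2 k k' k2 l l' l2 r r' r2 : h1 R G) :
  b2 = a *: b + b' -> c2 = a *: c + c' -> d2 = a *: d + d' ->
  k2 = a *: k + k' -> l2 = a *: l + l' -> r2 = a *: r + r' ->
  b2 - c2 + d2 - k2 + l2 - r2 =
  a *: (b - c + d - k + l - r) + (b' - c' + d' - k' + l' - r').
  by move=> -> -> -> -> -> ->; apply/rowP => i; rewrite !mxE; ring.
exact: key (nabla_linearl a x x' p (evB_smooth ys zs)) (N y z zs) (N z y ys) (D y z ys) (D z y zs)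
  (evB_linearr a (l200' y z) x x' p).
Qed.

Lemma conn_l3_linear1 (a : R) x x' y z : smooth0 x -> smooth0 x' -> smooth0 y -> smooth0 z ->
  l3' (a *: x + x') y z = a *: l3' x y z + l3' x' y z.
Proof.
move=> xs x's ys zs; apply/funext => p; rewrite !conn_l3_fun.
apply: etrans (congr1 -%R (covdB_linear a p xs x's ys zs)) _.
by rewrite opprD -scalerN.
Qed.

Lemma conn_l3_linear2 (a : R) x y y' z : smooth0 x -> smooth0 y -> smooth0 y' -> smooth0 z ->
  l3' x (a *: y + y') z = a *: l3' x y z + l3' x y' z.
Proof.
move=> xs ys y's zs; have yys := smooth0_linear a ys y's.
rewrite (conn_l3_skew12 xs yys zs) (conn_l3_linear1 a ys y's xs zs).
rewrite (conn_l3_skew12 xs ys zs) (conn_l3_skew12 xs y's zs).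
by rewrite opprD scalerN.
Qed.

Lemma conn_l3_linear3 (a : R) x y z z' : smooth0 x -> smooth0 y -> smooth0 z -> smooth0 z' ->
  l3' x y (a *: z + z') = a *: l3' x y z + l3' x y z'.
Proof.
move=> xs ys zs z's; have zzs := smooth0_linear a zs z's.
rewrite (conn_l3_skew23 xs ys zzs) (conn_l3_linear2 a xs zs z's ys).
rewrite (conn_l3_skew23 xs ys zs) (conn_l3_skew23 xs ys z's).
by rewrite opprD scalerN.
Qed.

(** The derivatives of f in nabla_y (B(f x, z)) and nabla_z (B(f x, y)) cancel
    with those in the brackets [f x, y] and [f x, z]. *)
Lemma covdB_scale f x y z p : smooth_fun f -> smooth0 x -> smooth0 y -> smooth0 z ->
  covdB (fscale f x) y z p = f p *: covdB x y z p.
Proof.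
move=> fs xs ys zs; have Xs := smooth0_vf xs.
have F (u : sec0) : evB (fscale f x) u = fscale f (evB x u).
  by apply/funext => q; exact: evB_scalel.
have N (k u : sec0) (us : smooth0 u) : nabla k (evB (fscale f x) u) p =
    f p *: nabla k (evB x u) p + lie_deriv (vpart k) f p *: evB x u p.
  by rewrite F; apply: nabla_scale => //; exact: evB_smooth.
have D (u v : sec0) (us : smooth0 u) : evB (l200' (fscale f x) u) v p =
    f p *: evB (l200' x u) v p - lie_deriv (vpart u) f p *: evB x v p.
  have Us := smooth0_vf us.
  have E : vf_bracket (fscale f (vpart x)) (vpart u) p =
      f p *: vf_bracket (vpart x) (vpart u) p + (- lie_deriv (vpart u) f p) *: vpart x p.
    apply: etrans (vf_bracketC _ _ p) _.
    apply: etrans (congr1 -%R (vf_bracket_scaler p fs Us Xs)) _.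
    rewrite (vf_bracketC (vpart u)) opprD scalerN opprK scaleNr; exact: erefl.
  have E2 : B p (vf_bracket (fscale f (vpart x)) (vpart u) p) (vpart v p) =
      f p *: B p (vf_bracket (vpart x) (vpart u) p) (vpart v p)
      - lie_deriv (vpart u) f p *: B p (vpart x p) (vpart v p).
    by rewrite E (linD (B_linearl p _)) !(linZ (B_linearl p _)) scaleNr.
  exact: E2.
have key (s t k : R) (a a' b b' c c' d d' l l' r r' q q' : h1 R G) :
  a' = s *: a -> b' = s *: b + t *: q -> c' = s *: c + k *: r ->
  d' = s *: d - t *: q -> l' = s *: l - k *: r -> q' = s *: r' ->
  a' - b' + c' - d' + l' - q' = s *: (a - b + c - d + l - r').
  by move=> -> -> -> -> -> ->; apply/rowP => i; rewrite !mxE; ring.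
exact: key (nabla_scalel f x p (evB_smooth ys zs)) (N y z zs) (N z y ys) (D y z ys) (D z y zs)
  (evB_scaler f (l200' y z) x p).
Qed.

Lemma smooth0_scale f x : smooth_fun f -> smooth0 x -> smooth0 (fscale f x).
Proof.
move=> fs /smooth0P[Xs us]; apply/smooth0P; split; first exact: vfield_scale.
exact: smooth_fun_scale.
Qed.

Lemma conn_l3_scale1 f x y z : smooth_fun f -> smooth0 x -> smooth0 y -> smooth0 z ->
  l3' (fscale f x) y z = fscale f (l3' x y z).
Proof.
move=> fs xs ys zs; apply/funext => p; rewrite !conn_l3_fun /fscale.
by apply: etrans (congr1 -%R (covdB_scale p fs xs ys zs)) _; rewrite scalerN.
Qed.

Lemma fscaleN (V : lmodType R) f (s : M -> V) : fscale f (- s) = - fscale f s.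
Proof. by apply/funext => p; exact: scalerN. Qed.

Lemma conn_l3_scale2 f x y z : smooth_fun f -> smooth0 x -> smooth0 y -> smooth0 z ->
  l3' x (fscale f y) z = fscale f (l3' x y z).
Proof.
move=> fs xs ys zs; have fys := smooth0_scale fs ys.
rewrite (conn_l3_skew12 xs fys zs) (conn_l3_scale1 fs ys xs zs).
by rewrite (conn_l3_skew12 xs ys zs) fscaleN.
Qed.

Lemma conn_l3_scale3 f x y z : smooth_fun f -> smooth0 x -> smooth0 y -> smooth0 z ->
  l3' x y (fscale f z) = fscale f (l3' x y z).
Proof.
move=> fs xs ys zs; have fzs := smooth0_scale fs zs.
rewrite (conn_l3_skew23 xs ys fzs) (conn_l3_scale2 fs xs zs ys).
by rewrite (conn_l3_skew23 xs ys zs) fscaleN.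
Qed.

Lemma conn_l200_scale f x y : smooth_fun f -> smooth0 x -> smooth0 y ->
  l200' x (fscale f y) = fscale f (l200' x y) + fscale (lie_deriv (vpart x) f) y.
Proof.
move=> fs xs ys; have fys := smooth0_scale fs ys.
have Xs := smooth0_vf xs; have Ys := smooth0_vf ys.
have tE : vert (fscale f y) = fscale f (vert y) by apply/funext => q; exact: vert_scale.
apply: section_eq => p; first exact: vf_bracket_scaler.
have E1 : lie_deriv (vpart x) (vert (fscale f y)) p =
    lie_deriv (vpart x) f p *: vert y p + f p *: lie_deriv (vpart x) (vert y) p.
  by rewrite tE; apply: dfun_scale; apply: smooth_fun_mdiff => //; exact: vert_smooth.
have E2 := lie_deriv_vscale f (vpart y) p (vert_smooth xs).
have E3 : br (vert x p) (vert (fscale f y) p) = f p *: br (vert x p) (vert y p).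
  by rewrite vert_scale brZr.
have E4 : psi (evB x (fscale f y) p) = f p *: psi (evB x y p).
  by rewrite evB_scaler; exact: (linZ (@dPsi_linear R G)).
apply: etrans (vert_l200 p xs fys) _.
have -> : vert (fscale f (l200' x y) + fscale (lie_deriv (vpart x) f) y) p =
    f p *: vert (l200' x y) p + lie_deriv (vpart x) f p *: vert y p.
  have -> : fscale f (l200' x y) + fscale (lie_deriv (vpart x) f) y =
      1 *: fscale f (l200' x y) + fscale (lie_deriv (vpart x) f) y by rewrite scale1r.
  by rewrite vert_linear scale1r !vert_scale.
apply: etrans _ (esym (congr1
  (fun u : h0 R G => f p *: u + lie_deriv (vpart x) f p *: vert y p) (vert_l200 p xs ys))).
have key (s t : R) (a a' b b' c c' d d' k : h0 R G) :
  a' = t *: k + s *: a -> b' = s *: b -> c' = s *: c -> d' = s *: d ->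
  a' - b' + c' - d' = s *: (a - b + c - d) + t *: k.
  by move=> -> -> -> ->; apply/rowP => i; rewrite !mxE; ring.
exact: key E1 E2 E3 E4.
Qed.

Lemma conn_l1_smooth m : smooth_fun m -> smooth0 (@conn_l1 R G M m).
Proof.
move=> ms; apply/smooth0P; split; first exact: smooth0_vf smooth0_0.
exact: psi_smooth.
Qed.

Lemma vert_conn_l1 m p : vert (@conn_l1 R G M m) p = psi (m p).
Proof. by rewrite /vert /vpart /= (lin0 (A_linear p)) addr0. Qed.

Lemma evB_conn_l1r x m : evB x (@conn_l1 R G M m) = (fun _ => 0).
Proof. by apply/funext => p; exact: (lin0 (B_linearr p (vpart x p))). Qed.

Lemma evB_conn_l1l x m : evB (@conn_l1 R G M m) x = (fun _ => 0).
Proof. by apply/funext => p; exact: (lin0 (B_linearl p (vpart x p))). Qed.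

Lemma nabla_conn_l1 m n p : smooth_fun n -> nabla (@conn_l1 R G M m) n p = phi (psi (m p)) (n p).
Proof.
move=> ns; rewrite nablaE vert_conn_l1.
have -> : lie_deriv (vpart (@conn_l1 R G M m)) n p = 0 by exact: derive0.
by rewrite add0r.
Qed.

Lemma nabla0 x p : nabla x (fun _ => 0) p = 0.
Proof. by rewrite nablaE (lin0 (phi_linearr _)) addr0; exact: dfun_cst. Qed.

Lemma conn_l2_l1 m n : smooth_fun m -> smooth_fun n ->
  nabla (@conn_l1 R G M m) n = conn_l210 A m (@conn_l1 R G M n).
Proof.
move=> ms ns; apply/funext => p; rewrite /conn_l210 nabla_conn_l1 // nabla_conn_l1 //.
exact: dPhi_dPsi_skew.
Qed.

Lemma psi_nabla x m p : smooth_fun m ->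
  psi (nabla x m p) = lie_deriv (vpart x) (fun q => psi (m q)) p + br (vert x p) (psi (m p)).
Proof.
move=> ms; have dl := @dPsi_linear R G.
rewrite nablaE (linD dl); apply: congr2; last exact: dPsi_dPhi.
exact: esym (dfun_lin _ dl (row_continuous dl) (smooth_fun_mdiff p ms)).
Qed.

Lemma vf_bracket0 (X : M -> tvec R M) p : vf_bracket X (fun _ => 0) p = 0.
Proof.
rewrite /vf_bracket derive0 subr0.
have -> : vf_coord (chart_at p) (fun _ : M => 0) = (fun _ => 0).
  by apply/funext => x; exact: derive0.
exact: derive_cst.
Qed.

(** Equivariance of psi ([psi_nabla]). *)
Lemma conn_l1_l2 x m : smooth0 x -> smooth_fun m ->
  @conn_l1 R G M (nabla x m) = l200' x (@conn_l1 R G M m).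
Proof.
move=> xs ms; have ls := conn_l1_smooth ms.
apply: section_eq => p; first exact: esym (vf_bracket0 _ _).
rewrite vert_conn_l1; apply: etrans (psi_nabla x p ms) _.
apply: etrans _ (esym (vert_l200 p xs ls)).
have E1 : vert (@conn_l1 R G M m) = (fun q => psi (m q)) by apply/funext => q; exact: vert_conn_l1.
have E2 : lie_deriv (vpart (@conn_l1 R G M m)) (vert x) p = 0 by exact: derive0.
have E3 : psi (evB x (@conn_l1 R G M m) p) = 0.
  by rewrite evB_conn_l1r; exact: (lin0 (@dPsi_linear R G)).
by rewrite E1 E2 E3 !subr0.
Qed.

(** B vanishes on sections in the image of l1, so only the term
    phi_(psi m) B(x, y) of the covariant derivative of B is left; by the
    Peiffer identity it is minus the curvature of nabla applied to m. *)
Lemma conn_l3_l1 x y m : smooth0 x -> smooth0 y -> smooth_fun m ->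
  l3' x y (@conn_l1 R G M m) = nabla x (nabla y m) - nabla (l200' x y) m - nabla y (nabla x m).
Proof.
move=> xs ys ms; have bs := evB_smooth xs ys.
apply/funext => p; apply: etrans (conn_l3E x y _ p) _.
apply: etrans _ (esym (nabla_curvature p xs ys ms)).
have key (n1 n2 n3 b1 b2 b3 q : h1 R G) : n1 = 0 -> n2 = 0 -> n3 = q ->
    b1 = 0 -> b2 = 0 -> b3 = 0 -> n1 - n2 + n3 - b1 + b2 - b3 = q.
  by move=> -> -> -> -> -> ->; rewrite subrr add0r !subr0 addr0.
have N (k l : sec0) : nabla k (evB l (@conn_l1 R G M m)) p = 0.
  by rewrite evB_conn_l1r; exact: nabla0.
have Z1 : evB (l200' x y) (@conn_l1 R G M m) p = 0 by rewrite evB_conn_l1r.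
have Z2 (k l : sec0) : smooth0 k -> evB (l200' k (@conn_l1 R G M m)) l p = 0.
  by move=> ks; rewrite -(conn_l1_l2 ks ms) evB_conn_l1l.
have D := key _ _ _ _ _ _ _ (N x y) (N y x) (nabla_conn_l1 m p bs) Z1 (Z2 _ y xs) (Z2 _ x ys).
apply: etrans (congr1 -%R D) _.
exact: esym (dPhi_dPsi_skew _ _).
Qed.

(** The derivative of psi (B(y, z)) along x and its bracket with [vert x] are
    collected into psi (nabla_x B(y, z)). *)
Lemma vert_l200_l200 x y z p : smooth0 x -> smooth0 y -> smooth0 z ->
  vert (l200' x (l200' y z)) p =
  lie_deriv (vpart x) (lie_deriv (vpart y) (vert z)) p
  - lie_deriv (vpart x) (lie_deriv (vpart z) (vert y)) p
  + (br (lie_deriv (vpart x) (vert y) p) (vert z p)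
     + br (vert y p) (lie_deriv (vpart x) (vert z) p))
  - (lie_deriv (vpart y) (lie_deriv (vpart z) (vert x)) p
     - lie_deriv (vpart z) (lie_deriv (vpart y) (vert x)) p)
  + (br (vert x p) (lie_deriv (vpart y) (vert z) p) - br (vert x p) (lie_deriv (vpart z) (vert y) p)
     + br (vert x p) (br (vert y p) (vert z p)))
  - (psi (nabla x (evB y z) p) + psi (evB x (l200' y z) p)).
Proof.
move=> xs ys zs; have yzs := conn_l200_smooth ys zs.
have Xs := smooth0_vf xs; have Ys := smooth0_vf ys; have Zs := smooth0_vf zs.
have tx := vert_smooth xs; have ty := vert_smooth ys; have tz := vert_smooth zs.
have bs := evB_smooth ys zs.
have T : vert (l200' y z) = (fun q =>
    lie_deriv (vpart y) (vert z) q - lie_deriv (vpart z) (vert y) q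
    + br (vert y q) (vert z q) - psi (evB y z q)) by apply/funext => q; exact: vert_l200.
have s1 := lie_deriv_smooth Ys tz; have s2 := lie_deriv_smooth Zs ty.
have s3 := smooth_fun_bilin br_bilinear ty tz; have s4 := psi_smooth bs.
have s12 := smooth_funB s1 s2; have s123 := smooth_funD s12 s3.
have E1 : lie_deriv (vpart x) (vert (l200' y z)) p =
    lie_deriv (vpart x) (lie_deriv (vpart y) (vert z)) p
  - lie_deriv (vpart x) (lie_deriv (vpart z) (vert y)) p
    + (br (lie_deriv (vpart x) (vert y) p) (vert z p)
       + br (vert y p) (lie_deriv (vpart x) (vert z) p))
    - lie_deriv (vpart x) (fun q => psi (evB y z q)) p.
  rewrite T; apply: etrans (dfunB _ (smooth_fun_mdiff p s123) (smooth_fun_mdiff p s4)) _.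
  apply: congr2; last exact: erefl.
  apply: etrans (dfunD _ (smooth_fun_mdiff p s12) (smooth_fun_mdiff p s3)) _.
  apply: congr2; first exact: (dfunB _ (smooth_fun_mdiff p s1) (smooth_fun_mdiff p s2)).
  exact: dfun_bilin br_bilinear (smooth_fun_mdiff p ty) (smooth_fun_mdiff p tz).
have E2 := lie_deriv_bracket p Ys Zs tx.
have E3 : br (vert x p) (vert (l200' y z) p) =
    br (vert x p) (lie_deriv (vpart y) (vert z) p) - br (vert x p) (lie_deriv (vpart z) (vert y) p)
    + br (vert x p) (br (vert y p) (vert z p)) - br (vert x p) (psi (evB y z p)).
  rewrite T; apply: etrans (brBr _ _ _) _; apply: congr2; last exact: erefl.
  apply: etrans (brDr _ _ _) _; apply: congr2; last exact: erefl.
  exact: brBr.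
apply: etrans (vert_l200 p xs yzs) _.
have key (a b c d e' q b' b2 b3 b4 k k' l t r : h0 R G) :
   t = a - b + c - k -> l = d - e' -> q = b' - b2 + b3 - k' -> b4 = k + k' ->
   t - l + q - r = a - b + c - (d - e') + (b' - b2 + b3) - (b4 + r).
  by move=> -> -> -> ->; apply/rowP => i; rewrite !mxE; ring.
exact: key E1 E2 E3 (psi_nabla x p bs).
Qed.

(** In the sum of the three double brackets, the derivatives and the brackets
    of the untwisted algebroid cancel by the Jacobi identities of vector fields
    and of h0. *)
Lemma conn_l1_l3 x y z : smooth0 x -> smooth0 y -> smooth0 z ->
  @conn_l1 R G M (l3' x y z) =
  l200' x (l200' y z) - l200' (l200' x y) z - l200' y (l200' x z).
Proof.
move=> xs ys zs.
have Xs := smooth0_vf xs; have Ys := smooth0_vf ys; have Zs := smooth0_vf zs.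
have xys := conn_l200_smooth xs ys.
apply: section_eq => p.
  have J := vf_jacobi p Xs Ys Zs.
  have K (b c d : tvec R M) : b = c + d -> 0 = b - c - d.
    by move=> ->; rewrite addrAC addrK subrr.
  exact: K J.
rewrite vert_conn_l1 vertB vertB conn_l3E (conn_l200C xys zs) vertN.
have dl := @dPsi_linear R G.
have D : psi (- covdB x y z p) =
   - psi (nabla x (evB y z) p) + psi (nabla y (evB x z) p) - psi (nabla z (evB x y) p)
   - psi (evB z (l200' x y) p) + psi (evB y (l200' x z) p) - psi (evB x (l200' y z) p).
  have psiN (m : h1 R G) : psi (- m) = - psi m by exact: linN dl m.
  apply: etrans (linN_alternating dl _ _ _ _ _ _) _.
  have K (a b c k k' d d' e' e2 : h0 R G) : d = - d' -> e' = - e2 -> k = - k' ->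
     - a + b - c + d - e' + k = - a + b - c - d' + e2 - k'.
    by move=> -> -> ->; rewrite opprK.
  have C (u v : sec0) : psi (evB u v p) = - psi (evB v u p).
    by apply: etrans (congr1 psi (evBC u v p)) _; exact: psiN.
  exact: K (C _ _) (C _ _) (C _ _).
have J : br (vert x p) (br (vert y p) (vert z p)) =
    - br (vert z p) (br (vert x p) (vert y p)) + br (vert y p) (br (vert x p) (vert z p)).
  by rewrite lie_jacobi (lie_bracketC (br (vert x p) (vert y p))).
have key (d n1 n2 n3 m1 m2 m3 t1 t2 t3 jx jy jz a1 a2 a3 a4 a5 a6
    p1 p2 p3 p4 p5 p6 p7 p8 p9 : h0 R G) :
    d = - n1 + n2 - n3 - m3 + m2 - m1 -> jx = - jz + jy ->
    t1 = a1 - a2 + (p1 + p2) - (a3 - a4) + (p3 - p4 + jx) - (n1 + m1) ->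
    t3 = a5 - a4 + (p5 + p4) - (a1 - a6) + (p6 - p7 + jz) - (n3 + m3) ->
    t2 = a6 - a3 + (p8 + p3) - (a2 - a5) + (p2 - p9 + jy) - (n2 + m2) ->
    p1 = - p6 -> p5 = - p9 -> p8 = - p7 ->
    d = t1 - - t3 - t2.
  by move=> -> -> -> -> -> -> -> ->; apply/rowP => i; rewrite !mxE; ring.
exact: key D J (vert_l200_l200 p xs ys zs) (vert_l200_l200 p zs xs ys) (vert_l200_l200 p ys xs zs)
  (lie_bracketC _ _) (lie_bracketC _ _) (lie_bracketC _ _).
Qed.

Lemma nabla_l3 k x y z p : smooth0 x -> smooth0 y -> smooth0 z ->
  nabla k (l3' x y z) p =
  - (nabla k (nabla x (evB y z)) p - nabla k (nabla y (evB x z)) p + nabla k (nabla z (evB x y)) p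
     - nabla k (evB (l200' x y) z) p + nabla k (evB (l200' x z) y) p
     - nabla k (evB (l200' y z) x) p).
Proof.
move=> xs ys zs; rewrite conn_l3_fun; apply: etrans (nablaN k p (covdB_smooth xs ys zs)) _.
apply: congr1; have s200 := conn_l200_smooth.
have n1 := nabla_smooth xs (evB_smooth ys zs); have n2 := nabla_smooth ys (evB_smooth xs zs).
have n3 := nabla_smooth zs (evB_smooth xs ys); have b1 := evB_smooth (s200 _ _ xs ys) zs.
have b2 := evB_smooth (s200 _ _ xs zs) ys; have b3 := evB_smooth (s200 _ _ ys zs) xs.
have c1 := smooth_funB n1 n2; have c2 := smooth_funD c1 n3; have c3 := smooth_funB c2 b1.
have c4 := smooth_funD c3 b2.
apply: etrans (nablaB k p c4 b3) _; apply: congr2; last exact: erefl.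
apply: etrans (nablaD k p c3 b2) _; apply: congr2; last exact: erefl.
apply: etrans (nablaB k p c2 b1) _; apply: congr2; last exact: erefl.
apply: etrans (nablaD k p c1 n3) _; apply: congr2; last exact: erefl.
exact: (nablaB k p n1 n2).
Qed.

Lemma evB_jacobi x y z w p : smooth0 x -> smooth0 y -> smooth0 z ->
  evB (l200' (l200' x y) z) w p =
  evB (l200' (l200' x z) y) w p - evB (l200' (l200' y z) x) w p.
Proof.
move=> /smooth0_vf Xs /smooth0_vf Ys /smooth0_vf Zs.
have J := vf_jacobi p Xs Ys Zs.
have K (a b c a' c' : tvec R M) : a = b + c -> a = - a' -> c = - c' -> b = - a' + c'.
  by move=> + Ea Ec; rewrite Ea Ec => ->; rewrite addrNK.
have E := K _ _ _ _ _ J (vf_bracketC _ _ p) (vf_bracketC _ _ p).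
have D := congr1 (fun v : tvec R M => B p v (vpart w p)) E.
have K2 (a b c a' : h1 R G) : a = a' + b -> a' = - c -> a = b - c.
  by move=> -> ->; rewrite addrC.
exact: K2 (etrans D (linD (B_linearl p _) _ _)) (linN (B_linearl p _) _).
Qed.

(** All brackets are moved to the first argument of l3, and second covariant
    derivatives are exchanged with [nabla_curvature]. The terms
    nabla_[w, x] B(y, z) and nabla_y B([w, x], z) cancel, the terms
    B([[w, x], y], z) cancel by the Jacobi identity, the terms
    B([y, z], [w, x]) by skew-symmetry, and the curvature terms
    phi_(psi B(w, x)) B(y, z) by the Peiffer identity. *)
Lemma conn_l2_l3 w x y z p : smooth0 w -> smooth0 x -> smooth0 y -> smooth0 z ->
  nabla w (l3' x y z) p - nabla x (l3' w y z) p + nabla y (l3' w x z) p - nabla z (l3' w x y) p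
  - l3' (l200' w x) y z p - l3' x (l200' w y) z p - l3' x y (l200' w z) p
  + l3' w (l200' x y) z p + l3' w y (l200' x z) p - l3' w x (l200' y z) p = 0.
Proof.
move=> ws xs ys zs; have s200 := conn_l200_smooth.
have C a b c d (As : smooth0 a) (bs : smooth0 b) (cs : smooth0 c) (ds : smooth0 d) :
    nabla a (nabla b (evB c d)) p = nabla (l200' a b) (evB c d) p + nabla b (nabla a (evB c d)) p
      + phi (psi (evB a b p)) (evB c d p).
  have K (k l n q : h1 R G) : k - l - n = q -> k = l + n + q.
    by move=> <-; rewrite addrC -[k - l - n]addrA -opprD subrK.
  exact: K (nabla_curvature p As bs (evB_smooth cs ds)).
have Q a b c d : phi (psi (evB a b p)) (evB c d p) = - phi (psi (evB c d p)) (evB a b p).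
  exact: dPhi_dPsi_skew.
have mid k a c (ks : smooth0 k) (As : smooth0 a) (cs : smooth0 c) :
    l3' a k c p = covdB k a c p.
  apply: etrans (conn_l3E _ _ _ p) _.
  exact: etrans (congr1 -%R (covdB_skew12 p As ks cs)) (opprK _).
have lst k a c (ks : smooth0 k) (As : smooth0 a) (cs : smooth0 c) :
    l3' a c k p = - covdB k a c p.
  apply: etrans (conn_l3E _ _ _ p) _; apply: congr1.
  apply: etrans (covdB_skew23 p As cs ks) _.
  exact: etrans (congr1 -%R (covdB_skew12 p As ks cs)) (opprK _).
(* s: second covariant derivatives; n: nabla_[a, b] B; q: curvature terms;
   u: nabla_c B([a, b], d); j: B([[a, b], c], d); k: B([c, d], [a, b]);
   t, r: the ten terms of the identity, in order *)
have key (swx sxw nwx qwx kwx uywx uzwx jwxy jwxz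
    swy syw nwy qwy kwy uxwy uzwy
    jwyx jwyz swz szw nwz qwz kwz uxwz uywz jwzx jwzy
    sxy syx nxy qxy kxy uwxy uzxy
    jxyw jxyz sxz szx nxz qxz kxz uwxz uyxz jxzw jxzy syz szy nyz qyz kyz
    uwyz uxyz jyzw jyzx t1 t2 t3 t4 r1 r2 r3 r4 r5 r6 : h1 R G) :
    t1 = - (swx - swy + swz - uwxy + uwxz - uwyz) ->
    t2 = - (sxw - sxy + sxz - uxwy + uxwz - uxyz) ->
    t3 = - (syw - syx + syz - uywx + uywz - uyxz) ->
    t4 = - (szw - szx + szy - uzwx + uzwy - uzxy) ->
    r1 = - (nwx - uywx + uzwx - jwxy + jwxz - kwx) ->
    r2 = (nwy - uxwy + uzwy - jwyx + jwyz - kwy) ->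
    r3 = - (nwz - uxwz + uywz - jwzx + jwzy - kwz) ->
    r4 = (nxy - uwxy + uzxy - jxyw + jxyz - kxy) ->
    r5 = - (nxz - uwxz + uyxz - jxzw + jxzy - kxz) ->
    r6 = - (nyz - uwyz + uxyz - jyzw + jyzx - kyz) ->
    swx = nwx + sxw + qwx ->
    swy = nwy + syw + qwy ->
    swz = nwz + szw + qwz ->
    sxy = nxy + syx + qxy ->
    sxz = nxz + szx + qxz ->
    syz = nyz + szy + qyz ->
    qyz = - qwx ->
    qxz = - qwy ->
    qxy = - qwz ->
    kyz = - kwx ->
    kxz = - kwy ->
    kxy = - kwz ->
    jwxy = jwyx - jxyw ->
    jwxz = jwzx - jxzw ->
    jwyz = jwzy - jyzw ->
    jxyz = jxzy - jyzx ->
    t1 - t2 + t3 - t4 - r1 - r2 - r3 + r4 + r5 - r6 = 0.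
  by do 26!move=> ->; apply/rowP => i; rewrite !mxE; ring.
exact: key (nabla_l3 w p xs ys zs) (nabla_l3 x p ws ys zs)
  (nabla_l3 y p ws xs zs) (nabla_l3 z p ws xs ys)
  (conn_l3E _ _ _ p)
  (mid _ _ _ (s200 _ _ ws ys) xs zs) (lst _ _ _ (s200 _ _ ws zs) xs ys)
  (mid _ _ _ (s200 _ _ xs ys) ws zs) (lst _ _ _ (s200 _ _ xs zs) ws ys)
  (lst _ _ _ (s200 _ _ ys zs) ws xs)
  (C _ _ _ _ ws xs ys zs) (C _ _ _ _ ws ys xs zs) (C _ _ _ _ ws zs xs ys)
  (C _ _ _ _ xs ys ws zs) (C _ _ _ _ xs zs ws ys) (C _ _ _ _ ys zs ws xs)
  (Q _ _ _ _) (Q _ _ _ _) (Q _ _ _ _) (evBC _ _ p) (evBC _ _ p) (evBC _ _ p)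
  (evB_jacobi z p ws xs ys) (evB_jacobi y p ws xs zs)
  (evB_jacobi x p ws ys zs) (evB_jacobi w p xs ys zs).
Qed.

Lemma conn_l1_linear (a : R) m n :
  @conn_l1 R G M (a *: m + n) = a *: @conn_l1 R G M m + @conn_l1 R G M n.
Proof.
apply/funext => p; apply: injective_projections.
  by rewrite /= scaler0 addr0.
exact: (@dPsi_linear R G a (m p) (n p)).
Qed.

Lemma conn_l1_scale f m : @conn_l1 R G M (fscale f m) = fscale f (@conn_l1 R G M m).
Proof.
apply/funext => p; apply: injective_projections; first by rewrite /= scaler0.
exact: (linZ (@dPsi_linear R G) (f p) (m p)).
Qed.

Lemma conn_lie2_algebra :
  is_lie2_algebra (smooth_section (E := bundle1 G M)) smooth0 (conn_lie2 A B).
Proof.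
have cl1 (a : R) m n : smooth_fun m -> smooth_fun n -> smooth_fun (a *: m + n : sec1).
  move=> ms ns; apply: (@smooth_funD _ _ _ (fun p => a *: m p) n) => //.
  by apply: smooth_fun_scale => //; exact: smooth_fun_cst.
have S1 m : smooth_section (E := bundle1 G M) m <-> smooth_fun m.
  by split=> [H|ms i]; [exact: (H tt)|exact: ms].
split.
- by apply/S1; exact: smooth_fun_cst.
- by move=> a m n /S1 ms /S1 ns; apply/S1; exact: cl1.
- exact: smooth0_0.
- by move=> a x y; exact: smooth0_linear.
- by move=> m /S1 ms; exact: conn_l1_smooth.
- by move=> x y; exact: conn_l200_smooth.
- by move=> x m xs /S1 ms; apply/S1; exact: nabla_smooth.
- by move=> m x /S1 ms xs; apply/S1; apply: smooth_funN; exact: nabla_smooth.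
- by move=> x y z xs ys zs; apply/S1; exact: conn_l3_smooth.
- by move=> a m n _ _; exact: conn_l1_linear.
- by move=> x xs a y z ys zs; exact: conn_l200_linearr.
- by move=> y ys a x z xs zs; exact: conn_l200_linearl.
- by move=> x xs a m n /S1 ms /S1 ns; apply/funext => p; exact: nabla_linear.
- by move=> m /S1 ms a x y xs ys; apply/funext => p; exact: nabla_linearl.
- by move=> y z ys zs a x x' xs x's; exact: conn_l3_linear1.
- by move=> x z xs zs a y y' ys y's; exact: conn_l3_linear2.
- by move=> x y xs ys a z z' zs z's; exact: conn_l3_linear3.
- by move=> x y; exact: conn_l200C.
- by move=> x m _ _; apply/funext => p; exact: esym (opprK _).
- by move=> x y z; exact: conn_l3_skew12.
- by move=> x y z; exact: conn_l3_skew23.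
- by move=> x m xs /S1 ms; exact: conn_l1_l2.
- by move=> m n /S1 ms /S1 ns; exact: conn_l2_l1.
- by move=> x y z; exact: conn_l1_l3.
- by move=> x y m xs ys /S1 ms; exact: conn_l3_l1.
- by move=> w x y z ws xs ys zs; apply/funext => p; exact: conn_l2_l3.
Qed.

End Connection.

(** * The transitive Lie 2-algebroid of a connection *)

Theorem theorem6p8 (R : realType) (G : crossed_module R) (M : manifold R)
  (A : M -> tvec R M -> h0 R G) (B : M -> tvec R M -> tvec R M -> h1 R G)
  (hAB : is_connection A B) :
  is_transitive_lie2_algebroid (E1 := bundle1 G M) (E0 := bundle0 G M)
    (@anchor R G M) (conn_lie2 A B).
Proof.
have [hA hB] := hAB.
split; last by move=> p v; exists (v, 0).
have S1 m : smooth_section (E := bundle1 G M) m <-> smooth_fun m.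
  by split=> [H|ms i]; [exact: (H tt)|exact: ms].
split.
- exact: trivial_vbundle.
- by apply: sum_vbundle; [exact: tangent_vbundle|exact: trivial_vbundle].
- by split=> [p a u v //|s /smooth0_vf].
- exact: conn_lie2_algebra.
- by move=> f m _ _; exact: conn_l1_scale.
- by move=> f x y z; exact: conn_l3_scale1.
- by move=> f x y z; exact: conn_l3_scale2.
- by move=> f x y z; exact: conn_l3_scale3.
- by move=> f x y; exact: conn_l200_scale.
- by move=> f x m fs xs /S1 ms; apply/funext => p; exact: nabla_scale.
Qed.
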